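(* Let $u_0\in\mathcal{M}$. There exist constants $C_u,C_g>0$ and $0<C_\alpha\le1$, depending only on $\Omega$, $d$, $\beta$, $V$ and $\|u_0\|_{H_0^1(\Omega)}$ and having the energy-decay property for the $a_0$-scheme started at $u_0$ (defined in the context), such that the following holds. Suppose $0<\alpha_{\min}\le\alpha_n\le\alpha_{\max}\le C_\alpha$ for all $n\ge0$, and let $\{u_n\}_{n=0}^\infty\subset\mathcal{M}$ be the iterates of the $a_0$-scheme $u_{n+1}=R\big(u_n-\alpha_n\nabla^{\mathcal{R}}_{a_0}E(u_n)\big)$, $n\ge0$, started at $u_0$. Then for any weak limit $u^*$ of $\{u_n\}_{n=0}^\infty$ in $H_0^1(\Omega)$ (that is, any weak limit in $H_0^1(\Omega)$ of a subsequence), $u^*$ is a critical point of the problem of minimizing $E$ over $\mathcal{M}$, i.e. $u^*\in\mathcal{M}$ and $\nabla^{\mathcal{R}}_{a_0}E(u^* )=0$, and $\{u_n\}_{n=0}^\infty$ has a subsequence converging to $u^*$ strongly in $H_0^1(\Omega)$.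
   Context: Standing assumptions: $d\in\{1,2,3\}$, $\Omega\subset\mathbb{R}^d$ is a bounded Lipschitz domain, $V\in L^\infty(\Omega)$ with $0\le V\le V_{\max}<\infty$, $\beta\ge 0$; functions are real-valued. $\|u\|_{H_0^1(\Omega)}=\|\nabla u\|_{L^2(\Omega)}$. The $a_0$-inner product on $H_0^1(\Omega)$ is $(z,w)_{a_0(\Omega)}=\int_\Omega\nabla z\cdot\nabla w+Vzw$, with induced norm $\|\cdot\|_{a_0(\Omega)}$. Energy: $E(u)=\int_\Omega\frac12|\nabla u|^2+\frac12V|u|^2+\frac{\beta}{4}|u|^4$ for $u\in H_0^1(\Omega)$. Manifold: $\mathcal{M}=\{u\in H_0^1(\Omega):\|u\|_{L^2(\Omega)}=1\}$. Retraction: $R(u)=u/\|u\|_{L^2(\Omega)}$ for $u\in H_0^1(\Omega)\setminus\{0\}$. Green's operator: for $w\in L^2(\Omega)$, $\mathcal{G}_{a_0}w\in H_0^1(\Omega)$ is the unique element with $(z,\mathcal{G}_{a_0}w)_{a_0(\Omega)}=(z,w)_{L^2(\Omega)}$ for all $z\in H_0^1(\Omega)$. $a_0$-gradient: $\nabla_{a_0}E(u)=u+\beta\mathcal{G}_{a_0}(|u|^2u)$. Riemannian $a_0$-gradient at $u\in\mathcal{M}$: $$\nabla^{\mathcal{R}}_{a_0}E(u)=u+\beta\mathcal{G}_{a_0}(|u|^2u)-\frac{1+\beta(\mathcal{G}_{a_0}(|u|^2u),u)_{L^2(\Omega)}}{\|\mathcal{G}_{a_0}u\|_{a_0(\Omega)}^2}\,\mathcal{G}_{a_0}u.$$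 Energy-decay property of $(C_u,C_g,C_\alpha)$ for the $a_0$-scheme started at $u_0$: for all $0<\alpha_{\min}\le\alpha_{\max}\le C_\alpha$ and all sequences $\alpha_n\in[\alpha_{\min},\alpha_{\max}]$, the iterates satisfy for every $n\ge0$: (i) $\|u_n\|_{a_0(\Omega)}\le C_u$; (ii) $\|\nabla^{\mathcal{R}}_{a_0}E(u_n)\|_{a_0(\Omega)}\le\|\nabla_{a_0}E(u_n)\|_{a_0(\Omega)}\le C_g$; (iii) $E(u_n)-E(u_{n+1})\ge\frac{\alpha_{\min}}{2}\|\nabla^{\mathcal{R}}_{a_0}E(u_n)\|_{a_0(\Omega)}^2$. *)

(* Defs.v *)
From HB Require Import structures.
From mathcomp Require Import all_boot all_order all_algebra.
From mathcomp Require Import all_classical all_reals all_analysis.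

Set Implicit Arguments.
Unset Strict Implicit.
Unset Printing Implicit Defensive.
Import Order.TTheory GRing.Theory Num.Theory.
Import numFieldNormedType.Exports.
Local Open Scope classical_set_scope.
Local Open Scope ring_scope.

(* The sigma-algebra of 'rV[R]_n is generated by the coordinate maps: it is
   the Borel sigma-algebra. *)
Section measurable_rV.
Context (R : realType) (n : nat).

Definition rV_coord (i : 'I_n) (x : 'rV[R]_n) : measurableTypeR R := x ord0 i.

Let rV_set0 : g_sigma_preimage rV_coord set0.
Proof. exact: sigma_algebra0. Qed.

Let rV_setC A : g_sigma_preimage rV_coord A -> g_sigma_preimage rV_coord (~` A).
Proof. exact: sigma_algebraC. Qed.

Let rV_bigcup (F : _^nat) : (forall i, g_sigma_preimage rV_coord (F i)) ->
  g_sigma_preimage rV_coord (\bigcup_i (F i)).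
Proof. exact: sigma_algebra_bigcup. Qed.

HB.instance Definition _ :=
  @isMeasurable.Build (sigma_display (g_sigma_preimage rV_coord))
    'rV[R]_n (g_sigma_preimage rV_coord) rV_set0 rV_setC rV_bigcup.

End measurable_rV.

Section measurable_rV_theory.
Context (R : realType).

Lemma measurable_rV_coord n (i : 'I_n) :
  measurable_fun [set: 'rV[R]_n] (@rV_coord R n i).
Proof.
move=> _ Y mY; rewrite setTI; apply: sub_sigma_algebra => /=.
rewrite -bigcup_seq/=; exists i => /=; first by rewrite mem_index_enum.
by exists Y => //; rewrite setTI.
Qed.

Lemma measurable_fun_rV d (T : measurableType d) n (f : T -> 'rV[R]_n) :
  (forall i, measurable_fun [set: T] (@rV_coord R n i \o f)) ->
  measurable_fun [set: T] f.
Proof.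
move=> mf.
suff : g_sigma_preimage (fun i => @rV_coord R n i \o f) `<=` measurable.
  rewrite g_sigma_preimage_comp => prefS _ A mA.
  by apply: prefS; exists A.
apply: smallest_sub; first exact: sigma_algebra_measurable.
case: n => [|n] in f mf *; first by rewrite big_ord0.
rewrite -bigcup_mkord_ord; apply: bigcup_sub => i Ii.
by move=> A [B mB <-]; exact: mf.
Qed.

Definition rV_cons n (p : measurableTypeR R * 'rV[R]_n) : 'rV[R]_n.+1 :=
  row_mx (p.1)%:M p.2 : 'rV[R]_(1 + n).

Definition rV_uncons n (x : 'rV[R]_n.+1) : measurableTypeR R * 'rV[R]_n :=
  (x ord0 ord0, rsubmx (x : 'rV[R]_(1 + n))).

Lemma rV_cons0 n a (y : 'rV[R]_n) : rV_coord ord0 (rV_cons (a, y)) = a.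
Proof.
rewrite /rV_coord /rV_cons /=.
rewrite (_ : (ord0 : 'I_n.+1) = lshift n (ord0 : 'I_1)); last exact/val_inj.
by rewrite (@row_mxEl _ 1 1 n) mxE eqxx.
Qed.

Lemma rV_consS n a (y : 'rV[R]_n) i :
  rV_coord (lift ord0 i) (rV_cons (a, y)) = rV_coord i y.
Proof.
rewrite /rV_coord /rV_cons /=.
rewrite (_ : lift ord0 i = rshift 1 i); last exact/val_inj.
by rewrite (@row_mxEr _ 1 1 n).
Qed.

Lemma rV_consK n : cancel (@rV_cons n) (@rV_uncons n).
Proof.
case=> a y; rewrite /rV_uncons; congr pair; last exact: row_mxKr.
exact: rV_cons0.
Qed.

Lemma rV_unconsK n : cancel (@rV_uncons n) (@rV_cons n).
Proof.
move=> x; rewrite /rV_uncons /rV_cons /= -[RHS](@hsubmxK _ 1 1 n x).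
apply: (congr2 (@row_mx R 1 1 n)) => //; apply/matrixP => i j; rewrite !ord1 !mxE eqxx mulr1n.
by congr (x _ _); apply/val_inj.
Qed.

Lemma measurable_rV_cons n : measurable_fun setT (@rV_cons n).
Proof.
apply: measurable_fun_rV => i.
case: (unliftP ord0 i) => [j|] ->.
  rewrite (_ : _ \o _ = @rV_coord R n j \o snd).
    by apply: measurableT_comp => //; exact: measurable_rV_coord.
  by apply/funext => -[a y]; exact: rV_consS.
by rewrite (_ : _ \o _ = fst)//; apply/funext => -[a y]; exact: rV_cons0.
Qed.

Lemma measurable_rV_uncons n : measurable_fun setT (@rV_uncons n).
Proof.
apply/measurable_fun_pairP; split; first exact: measurable_rV_coord.
apply: measurable_fun_rV => i.
rewrite (_ : _ \o _ = @rV_coord R n.+1 (rshift 1 i)).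
  exact: measurable_rV_coord.
by apply/funext => x /=; rewrite /rV_coord /rV_uncons /= mxE.
Qed.

End measurable_rV_theory.

Section lebesgue_rV.
Context (R : realType).
Local Open Scope ereal_scope.

Section step.
Context (n : nat) (m : {sigma_finite_measure set 'rV[R]_n -> \bar R}).

Definition lebesgue_step : set 'rV[R]_n.+1 -> \bar R :=
  pushforward (@lebesgue_measure R \x m) (@rV_cons R n).

HB.instance Definition _ := Measure.copy lebesgue_step
  (measure_function_pushforward__canonical__measure_function_Measure
     (@lebesgue_measure R \x m) (@measurable_rV_cons R n)).

Let step_sigma_finite : sigma_finite setT lebesgue_step.
Proof.
have /sigma_finiteP[F [FT Fnd Foo]] := sigma_finiteT (@lebesgue_measure R).
have /sigma_finiteP[G [GT Gnd Goo]] := sigma_finiteT m.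
exists (fun k => @rV_uncons R n @^-1` (F k `*` G k)).
  rewrite -preimage_bigcup (_ : \bigcup_k _ = setT) ?preimage_setT//.
  apply/seteqP; split => // -[x y] _.
  have [i _ Fx] : (\bigcup_k F k) x by rewrite -FT.
  have [j _ Gy] : (\bigcup_k G k) y by rewrite -GT.
  exists (maxn i j) => //; split.
  - by move: x Fx; exact/subsetPset/Fnd/leq_maxl.
  - by move: y Gy; exact/subsetPset/Gnd/leq_maxr.
move=> k; have [mF Fk] := Foo k; have [mG Gk] := Goo k; split.
  rewrite -[X in measurable X]setTI; apply: measurable_rV_uncons => //.
  exact: measurableX.
rewrite /lebesgue_step /pushforward -comp_preimage.
rewrite (_ : _ \o _ = id); last by apply/funext => p /=; rewrite rV_consK.
by rewrite preimage_id product_measure1E// lte_mul_pinfty// ge0_fin_numE.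
Qed.

HB.instance Definition _ :=
  Measure_isSigmaFinite.Build _ _ _ lebesgue_step step_sigma_finite.

End step.

Fixpoint lebesgue_rV n : {sigma_finite_measure set 'rV[R]_n -> \bar R} :=
  match n with
  | 0 => \d_ (0%R : 'rV[R]_0)
  | n'.+1 => lebesgue_step (lebesgue_rV n')
  end.

Lemma lebesgue_rV_box n (A : 'I_n -> set (measurableTypeR R)) :
  (forall i, measurable (A i)) ->
  lebesgue_rV n [set x | forall i, A i (rV_coord i x)] =
  \prod_(i < n) lebesgue_measure (A i).
Proof.
elim: n A => [|n IH] A mA.
  by rewrite big_ord0 /= diracE mem_set// => -[].
have mB : measurable
    [set y : 'rV[R]_n | forall i, A (lift ord0 i) (rV_coord i y)].
  rewrite (_ : mkset _ = \big[setI/setT]_(i < n)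
    ((@rV_coord R n i) @^-1` A (lift ord0 i))).
    apply: bigsetI_measurable => i _; rewrite -[X in measurable X]setTI.
    exact: measurable_rV_coord.
  apply/seteqP; rewrite -bigcap_seq; split => [y /= + i _|y /= Ay i]; first exact.
  by apply: Ay => /=; rewrite mem_index_enum.
rewrite big_ord_recl -(IH (fun i => A (lift ord0 i)))// -product_measure1E//.
rewrite /= /lebesgue_step /pushforward; congr (_ _).
apply/seteqP; split => -[a y] /= => [H|[Aa Ay] i].
  split; first by have := H ord0; rewrite rV_cons0.
  by move=> i; have := H (lift ord0 i); rewrite rV_consS.
by case: (unliftP ord0 i) => [j|] ->; rewrite ?rV_cons0 ?rV_consS.
Qed.

End lebesgue_rV.

Section domain.
Context (R : realType) (d : nat).
Implicit Type Omega : set 'rV[R]_d.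

(* Near each boundary point, and in some orthonormal coordinate system (the
   rows of Q, the last of which is the vertical direction), Omega is the strict
   epigraph of a Lipschitz function of the first d - 1 coordinates. *)
Definition lipschitz_boundary Omega : Prop :=
  forall x0, closure Omega x0 -> ~ interior Omega x0 ->
  exists r : R, exists Q : 'M[R]_(d.-1 + 1, d), exists gamma : 'rV[R]_d.-1 -> R,
    [/\ 0 < r, Q *m Q^T = 1%:M, lipschitz gamma &
      forall (y : 'rV[R]_d.-1) (t : R),
        let x := x0 + row_mx y t%:M *m Q in
        ball x0 r x -> (Omega x <-> gamma y < t)].

Definition bounded_lipschitz_domain Omega : Prop :=
  [/\ open Omega, connected Omega, Omega !=set0, bounded_set Omega &
      lipschitz_boundary Omega].

End domain.

Section sobolev.
Context (R : realType) (d : nat) (Omega : set 'rV[R]_d).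
Implicit Types (u v w g phi : 'rV[R]_d -> R) (i : 'I_d).

Notation mu := (lebesgue_rV R d).

(* Elements of L^2(Omega) and of the Sobolev spaces are represented by functions
   on R^d, of which only the restriction to Omega, up to equality almost
   everywhere, is relevant. *)
Definition L2 u : Prop :=
  measurable_fun Omega u /\ mu.-integrable Omega (fun x => ((u x) ^+ 2)%:E).

Definition L2_dot u v : R := \int[mu]_(x in Omega) (u x * v x).

Definition L2_norm u : R := Num.sqrt (L2_dot u u).

Definition partial i phi : 'rV[R]_d -> R := 'D_(delta_mx ord0 i) phi.

Definition smooth phi : Prop :=
  forall s : seq 'I_d, let psi := foldr partial phi s in
    continuous psi /\ forall i x, derivable psi x (delta_mx ord0 i).

Definition test_function phi : Prop :=
  let supp := closure [set x | phi x != 0] in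
  [/\ smooth phi, compact supp & supp `<=` Omega].

Definition is_weak_partial i u g : Prop :=
  L2 g /\ forall phi, test_function phi ->
    L2_dot u (partial i phi) = - L2_dot g phi.

Definition H1 u : Prop := L2 u /\ forall i, exists g, is_weak_partial i u g.

(* A choice of weak partial derivative, unique up to equality almost everywhere
   in Omega. *)
Definition weak_partial i u : 'rV[R]_d -> R :=
  xget (cst 0) [set g | is_weak_partial i u g].

Definition grad_dot u v : 'rV[R]_d -> R :=
  fun x => \sum_(i < d) weak_partial i u x * weak_partial i v x.

Definition H1_norm u : R :=
  Num.sqrt (\int[mu]_(x in Omega) (u x ^+ 2 + grad_dot u u x)).

Definition H10 u : Prop :=
  H1 u /\ forall e : R, 0 < e ->
    exists phi, test_function phi /\ H1_norm (u \- phi) < e.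

Definition H10_norm u : R := Num.sqrt (\int[mu]_(x in Omega) grad_dot u u x).

Definition H10_dual (l : ('rV[R]_d -> R) -> R) : Prop :=
  (forall (a : R) u v, H10 u -> H10 v -> l (a \*o u \+ v) = a * l u + l v) /\
  exists C : R, forall u, H10 u -> `|l u| <= C * H10_norm u.

Definition weakly_converges (u_ : nat -> 'rV[R]_d -> R) u : Prop :=
  H10 u /\ forall l, H10_dual l -> l (u_ n) @[n --> \oo] --> l u.

Definition strongly_converges (u_ : nat -> 'rV[R]_d -> R) u : Prop :=
  H10 u /\ H10_norm (u_ n \- u) @[n --> \oo] --> 0.

Definition sphere u : Prop := H10 u /\ L2_norm u = 1.

Definition retraction u : 'rV[R]_d -> R := fun x => u x / L2_norm u.

End sobolev.

Section gross_pitaevskii.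
Context (R : realType) (d : nat) (Omega : set 'rV[R]_d).
Context (V : 'rV[R]_d -> R) (beta : R).
Implicit Types (u v w z : 'rV[R]_d -> R).

Notation mu := (lebesgue_rV R d).
Local Notation L2_dot := (L2_dot Omega).

Definition a0_dot z w : R :=
  \int[mu]_(x in Omega) (grad_dot Omega z w x + V x * z x * w x).

Definition a0_norm u : R := Num.sqrt (a0_dot u u).

Definition energy u : R :=
  \int[mu]_(x in Omega) (2^-1 * grad_dot Omega u u x
    + 2^-1 * V x * `|u x| ^+ 2 + beta / 4 * `|u x| ^+ 4).

Definition is_green w g : Prop :=
  H10 Omega g /\ forall z, H10 Omega z -> a0_dot z g = L2_dot z w.

(* A choice of representative of the element of H^1_0 determined by
   is_green. *)
Definition green w : 'rV[R]_d -> R := xget (cst 0) [set g | is_green w g].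

Definition cube u : 'rV[R]_d -> R := fun x => `|u x| ^+ 2 * u x.

Definition a0_grad u : 'rV[R]_d -> R := fun x => u x + beta * green (cube u) x.

Definition a0_riemannian_grad u : 'rV[R]_d -> R := fun x =>
  u x + beta * green (cube u) x
  - (1 + beta * L2_dot (green (cube u)) u) / a0_norm (green u) ^+ 2 * green u x.

Definition critical_point u : Prop :=
  sphere Omega u /\ a0_riemannian_grad u = cst 0 %[ae mu in Omega].

Fixpoint a0_iterate (alpha : nat -> R) (u0 : 'rV[R]_d -> R) (n : nat) :
    'rV[R]_d -> R :=
  if n is n'.+1 then
    let u := a0_iterate alpha u0 n' in
    retraction Omega (fun x => u x - alpha n' * a0_riemannian_grad u x)
  else u0.

Definition energy_decay u0 (Cu Cg Calpha : R) : Prop :=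
  forall (amin amax : R) (alpha : nat -> R),
    0 < amin -> amin <= amax -> amax <= Calpha ->
    (forall n, amin <= alpha n <= amax) ->
  let u := a0_iterate alpha u0 in
  forall n,
    [/\ a0_norm (u n) <= Cu,
        a0_norm (a0_riemannian_grad (u n)) <= a0_norm (a0_grad (u n)),
        a0_norm (a0_grad (u n)) <= Cg &
        energy (u n) - energy (u n.+1)
          >= amin / 2 * a0_norm (a0_riemannian_grad (u n)) ^+ 2].

End gross_pitaevskii.

(* Main.v *)
Require Import Defs.
From HB Require Import structures.
From mathcomp Require Import all_boot all_order all_algebra.
From mathcomp Require Import all_classical all_reals all_analysis.
From mathcomp Require Import measurable_realfun ring lra.
Set Implicit Arguments.
Unset Strict Implicit.
Unset Printing Implicit Defensive.
Import Order.TTheory GRing.Theory Num.Theory.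
Import numFieldNormedType.Exports.
Local Open Scope classical_set_scope.
Local Open Scope ring_scope.

(** Along the iterates the energy decreases by at least a multiple of the squared norm of
    the Riemannian gradient, which therefore tends to zero; and a weak limit is critical
    because every term of this gradient other than the identity is compact.

    Decay. At a point [u] of the sphere the Riemannian gradient [g] is L2-orthogonal to
    [u], so that [u - alpha g] has L2 norm at least one and the retraction can only shrink
    it, hence decrease its energy ([energy_shrink]). Along the segment the energy is a
    polynomial of degree four in [alpha], whose linear coefficient is minus the squared
    norm of [g]; the terms of higher order are dominated as soon as [alpha] is small with
    respect to bounds on [u] and on its gradient ([energy_step]). These bounds follow from
    the energy of [u] alone, so they propagate along the iteration ([run_invariant]), and
    the squared norms of the gradients are summable ([run_gradient_cvg0]).

    Limits. Let [G] be Green's operator and [C u] the image under it of the cube of [u].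
    The Riemannian gradient is [g_n = u_n + beta C u_n - gamma_n G u_n]. By Rellich's
    theorem ([rellich]) a weakly convergent subsequence converges in L2, and [G] and [C]
    turn L2 convergence of sequences bounded in [H10] into convergence in [H10]. Since
    [g_n] tends to zero, [u_n] itself then converges in [H10], and the limit of the
    gradients is the gradient of the limit ([limit_is_critical]).

    This uses three facts on [H10]: the Poincare inequality ([poincare]), the Ladyzhenskaya
    inequality bounding the integral of [u ^ 4] by the norms of [u] and of its gradient for
    [d <= 3] ([ladyzhenskaya]), and Rellich's theorem. Each is proved for test functions,
    by integration along lines parallel to the axes, and extended by density. The operators
    [G] and [C] come from the Riesz representation theorem, hence from the completeness of
    [H10] ([H10_complete]), itself a consequence of that of L2 ([L2_complete]). Weak
    derivatives are unique by the fundamental lemma of the calculus of variations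
    ([fundamental_lemma]), for which smooth bump functions are constructed. *)

(** * Sequences of real numbers *)

Lemma le_of_sqr (R : realDomainType) (x y : R) : 0 <= y -> x ^+ 2 <= y ^+ 2 -> x <= y.
Proof. by move=> y0 h; rewrite leNgt; apply/negP => xy; nra. Qed.

Lemma invS_lt (R : realType) (e : R) : 0 < e ->
  exists N, forall n, (N <= n)%N -> n.+1%:R^-1 < e.
Proof.
move=> e0; exists (Num.truncn e^-1) => n hn.
rewrite invf_plt ?posrE//; apply: lt_le_trans (truncnS_gt _) _.
by rewrite ler_nat ltnS.
Qed.

Lemma cvg_to_eq (R : realType) (f : nat -> R) (l l' : R) :
  l = l' -> f @ \oo --> l -> f @ \oo --> l'.
Proof. by move=> ->. Qed.

Lemma cvg0_of_le (R : realType) (f g : nat -> R) :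
  (forall n, 0 <= f n <= g n) -> g @ \oo --> 0 -> f @ \oo --> 0.
Proof.
move=> fg g0; apply: (@squeeze_cvgr _ _ _ _ (fun=> 0) g) => //; last exact: cvg_cst.
by apply: nearW => n; exact: fg.
Qed.

Lemma cvg0_of_sqr_le (R : realType) (f g : nat -> R) :
  (forall n, f n ^+ 2 <= g n) -> g @ \oo --> 0 -> f @ \oo --> 0.
Proof.
move=> fg g0; apply/cvgr0Pnorm_lt => e e0.
have e20 : 0 < e ^+ 2 by rewrite exprn_gt0.
near=> n.
rewrite -(ltr_pXn2r (ltn0Sn 1))// ?nnegrE ?ltW// real_normK ?num_real//.
apply: le_lt_trans (fg n) _; apply: le_lt_trans (ler_norm _) _.
by near: n; move/cvgr0Pnorm_lt : g0; exact.
Unshelve. all: by end_near. Qed.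

(** * Semi-inner product spaces *)

Section semi_inner_product.
Context (R : realType) (X : lmodType R).
Implicit Types (u v w z : X).

(** Functions are only determined almost everywhere, so that the inner products below are
    semi-definite on the space of representatives. *)
Record semi_inner (H : X -> Prop) (dot : X -> X -> R) : Prop := SemiInner {
  si_0 : H 0;
  si_lin : forall a u v, H u -> H v -> H (a *: u + v);
  si_dotl : forall a u v w, H u -> H v -> H w ->
    dot (a *: u + v) w = a * dot u w + dot v w;
  si_sym : forall u v, H u -> H v -> dot u v = dot v u;
  si_ge0 : forall u, H u -> 0 <= dot u u }.

Context (H : X -> Prop) (dot : X -> X -> R) (hd : semi_inner H dot).

Lemma siZ a u : H u -> H (a *: u).
Proof. by move=> Hu; rewrite -[_ *: _]addr0; apply: (si_lin hd) => //; apply: si_0 hd. Qed.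

Lemma siD u v : H u -> H v -> H (u + v).
Proof. by move=> Hu Hv; rewrite -[u]scale1r; apply: (si_lin hd). Qed.

Lemma siN u : H u -> H (- u).
Proof. by move=> Hu; rewrite -scaleN1r; apply: siZ. Qed.

Lemma siB u v : H u -> H v -> H (u - v).
Proof. by move=> Hu Hv; apply: siD => //; apply: siN. Qed.

Lemma dotDl u v w : H u -> H v -> H w -> dot (u + v) w = dot u w + dot v w.
Proof. by move=> *; rewrite -{1}[u]scale1r (si_dotl hd)// mul1r. Qed.

Lemma dot0l w : H w -> dot 0 w = 0.
Proof.
move=> Hw; have H0 := si_0 hd.
by have := dotDl H0 H0 Hw; rewrite addr0 -[X in X = _]addr0 => /addrI.
Qed.

Lemma dotZl a u w : H u -> H w -> dot (a *: u) w = a * dot u w.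
Proof.
move=> Hu Hw; have H0 := si_0 hd.
by rewrite -[_ *: _]addr0 (si_dotl hd)// dot0l// addr0.
Qed.

Lemma dotBl u v w : H u -> H v -> H w -> dot (u - v) w = dot u w - dot v w.
Proof.
move=> Hu Hv Hw; rewrite dotDl//; last exact: siN.
by rewrite -scaleN1r dotZl// mulN1r.
Qed.

Lemma dotDr w u v : H u -> H v -> H w -> dot w (u + v) = dot w u + dot w v.
Proof.
by move=> Hu Hv Hw; rewrite (si_sym hd Hw (siD Hu Hv)) dotDl// (si_sym hd Hu Hw) (si_sym hd Hv Hw).
Qed.

Lemma dotZr a u w : H u -> H w -> dot w (a *: u) = a * dot w u.
Proof.
by move=> Hu Hw; rewrite (si_sym hd Hw (siZ a Hu)) dotZl// (si_sym hd Hu Hw).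
Qed.

Lemma dotBr w u v : H u -> H v -> H w -> dot w (u - v) = dot w u - dot w v.
Proof.
by move=> Hu Hv Hw; rewrite (si_sym hd Hw (siB Hu Hv)) dotBl// (si_sym hd Hu Hw) (si_sym hd Hv Hw).
Qed.

Lemma dot_sqrD t u v : H u -> H v ->
  dot (t *: u + v) (t *: u + v) = t ^+ 2 * dot u u + 2 * t * dot u v + dot v v.
Proof.
move=> Hu Hv; have Hs := siZ t Hu.
rewrite dotDl//; last exact: siD.
rewrite !dotDr// !dotZl// !dotZr// (si_sym hd Hv Hu); ring.
Qed.

Lemma dot_sqrB u v : H u -> H v ->
  dot (u - v) (u - v) = dot u u - 2 * dot u v + dot v v.
Proof.
move=> Hu Hv.
by rewrite addrC -scaleN1r dot_sqrD// (si_sym hd Hv Hu); ring.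
Qed.

End semi_inner_product.

(** With [e] the constant term of a nonnegative quadratic function of [t], this is the
    Cauchy--Schwarz inequality; it is also the first-order condition satisfied by a
    minimizer up to [e] of a quadratic functional. *)
Lemma quadratic_linear_coeff (R : realType) (a b e : R) : 0 <= a ->
  (forall t, - e <= t ^+ 2 * a + 2 * t * b) -> b ^+ 2 <= e * a.
Proof.
move=> a0 h; have [a_0|an0] := eqVneq a 0.
  rewrite a_0 mulr0.
  have [->|bn0] := eqVneq b 0; first by rewrite expr0n.
  have := h (- (e + 1) / (2 * b)).
  have -> : 2 * (- (e + 1) / (2 * b)) * b = - (e + 1) by field.
  by rewrite a_0 mulr0; lra.
have ap : 0 < a by rewrite lt_neqAle eq_sym an0.
have := h (- b / a).
have -> : (- b / a) ^+ 2 * a + 2 * (- b / a) * b = - (b ^+ 2 / a) by field.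
by rewrite lerN2 ler_pdivrMr.
Qed.

Section semi_inner_theory.
Context (R : realType) (X : lmodType R).
Context (H : X -> Prop) (dot : X -> X -> R) (hd : semi_inner H dot).
Implicit Types (u v w z : X).

Lemma semi_inner_CS u v : H u -> H v -> dot u v ^+ 2 <= dot u u * dot v v.
Proof.
move=> Hu Hv; rewrite mulrC; apply: quadratic_linear_coeff.
  exact: si_ge0 hd _ Hu.
move=> t; have := si_ge0 hd (siD hd (siZ hd t Hu) Hv).
by rewrite (dot_sqrD hd)//; lra.
Qed.

Lemma parallelogram_le u v : H u -> H v ->
  dot (u + v) (u + v) <= 2 * dot u u + 2 * dot v v.
Proof.
move=> Hu Hv; have := si_ge0 hd (siB hd Hu Hv).
by have := dot_sqrD hd 1 Hu Hv; rewrite scale1r (dot_sqrB hd)// => ->; lra.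
Qed.

(** Stated without filters because [X] carries no topology. *)
Definition semi_complete := forall u_ : nat -> X, (forall n, H (u_ n)) ->
  (forall e : R, 0 < e -> exists N, forall m n, (N <= m)%N -> (N <= n)%N ->
     dot (u_ m - u_ n) (u_ m - u_ n) < e) ->
  exists2 u, H u & forall e : R, 0 < e -> exists N, forall n, (N <= n)%N ->
     dot (u_ n - u) (u_ n - u) < e.

(** The representative is the limit of a minimizing sequence of [dot u u - 2 * l u], which is
    Cauchy by the parallelogram identity. *)
Theorem Riesz_representation (l : X -> R) (C : R) : semi_complete -> 0 <= C ->
  (forall a u v, H u -> H v -> l (a *: u + v) = a * l u + l v) ->
  (forall u, H u -> l u ^+ 2 <= C * dot u u) ->
  exists2 g, H g & forall z, H z -> dot z g = l z.
Proof.
move=> cH C0 llin lb.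
pose J u := dot u u - 2 * l u.
have J_lb u : H u -> - C <= J u.
  move=> Hu; rewrite /J; have h1 := lb _ Hu; have h2 := si_ge0 hd Hu.
  suff : 2 * l u <= C + dot u u by lra.
  apply: le_of_sqr; first exact: addr_ge0.
  by have := sqr_ge0 (C - dot u u); lra.
have infJ : has_inf (J @` H).
  split; first by exists (J 0), 0 => //; exact: si_0 hd.
  by exists (- C) => _ [u Hu <-]; exact: J_lb.
pose m := inf (J @` H).
have m_le u : H u -> m <= J u by move=> Hu; apply: ge_inf; [exact: infJ.2|exists u].
have /choice[u_ u_P] (n : nat) : exists u, H u /\ J u < m + n.+1%:R^-1.
  have n0 : 0 < n.+1%:R^-1 :> R by rewrite invr_gt0.
  have [_ [u Hu <-] Ju] := inf_adherent n0 infJ.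
  by exists u.
have Hu n : H (u_ n) by case: (u_P n).
have lZ a u : H u -> l (a *: u) = a * l u.
  move=> H1; have H0 := si_0 hd.
  have l0 : l 0 = 0 by have := llin 1 0 0 H0 H0; rewrite scaler0 addr0; lra.
  by rewrite -[_ *: u]addr0 llin// l0 addr0.
have cauchy : forall e : R, 0 < e -> exists N, forall m n, (N <= m)%N -> (N <= n)%N ->
     dot (u_ m - u_ n) (u_ m - u_ n) < e.
  move=> e e0; have [N hN] := invS_lt (divr_gt0 e0 (ltr0n _ 4)).
  exists N => p q /hN hp /hN hq.
  have [[Hp Jp] [Hq Jq]] := (u_P p, u_P q).
  have := m_le _ (siZ hd 2^-1 (siD hd Hp Hq)).
  have Hq2 := siZ hd 2^-1 Hq.
  rewrite /J scalerDr (dot_sqrD hd)// llin// lZ// !(dotZr hd)// (dotZl hd)//.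
  rewrite (dot_sqrB hd)//; move: Jp Jq hp hq; rewrite /J.
  by move: (p.+1%:R^-1) (q.+1%:R^-1) => dp dq; lra.
have [g Hg ug] := cH _ Hu cauchy.
exists g => // z Hz; apply/eqP; rewrite -subr_eq0 -sqrf_eq0 eq_le sqr_ge0 andbT.
apply/ler_addgt0Pr => e e0; rewrite add0r.
have d0 := si_ge0 hd Hz.
have e'0 : 0 < e / (4 * (1 + dot z z)) by apply: divr_gt0 => //; lra.
have [N1 h1] := invS_lt e'0.
have [N2 h2] := ug _ e'0.
pose n := maxn N1 N2.
have {}h1 := h1 _ (leq_maxl N1 N2); have {}h2 := h2 _ (leq_maxr N1 N2).
rewrite -/n in h1 h2.
have k1 : (dot z (u_ n) - l z) ^+ 2 <= n.+1%:R^-1 * dot z z.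
  apply: quadratic_linear_coeff => // t.
  have [_ Jn] := u_P n; have := m_le _ (si_lin hd t Hz (Hu n)).
  by rewrite /J (dot_sqrD hd)// llin//; move: Jn; rewrite /J; move: (n.+1%:R^-1) => dn; lra.
have k2 := semi_inner_CS Hz (siB hd (Hu n) Hg).
rewrite (dotBr hd) // in k2.
have k3 : n.+1%:R^-1 * dot z z <= e / 4.
  apply: (@le_trans _ _ (e / (4 * (1 + dot z z)) * (1 + dot z z))).
    by apply: ler_pM => //; [exact: ltW | lra].
  by rewrite le_eqVlt; apply/orP; left; apply/eqP; field; lra.
have k4 : dot z z * dot (u_ n - g) (u_ n - g) <= e / 4.
  apply: (@le_trans _ _ ((1 + dot z z) * (e / (4 * (1 + dot z z))))).
    apply: ler_pM => //; [|lra|exact: ltW].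
    by apply: (si_ge0 hd); exact: (siB hd).
  by rewrite le_eqVlt; apply/orP; left; apply/eqP; field; lra.
have := sqr_ge0 ((dot z (u_ n) - l z) + (dot z (u_ n) - dot z g)).
move: (le_trans k1 k3) (le_trans k2 k4).
by move: (dot z (u_ n)) (dot z g) (l z) e {e0 e'0 h1 h2 k1 k2 k3 k4} => x y k f; lra.
Qed.

Definition sconv (u_ : nat -> X) u := dot (u_ n - u) (u_ n - u) @[n --> \oo] --> 0.

Lemma cvg_dot (u_ v_ : nat -> X) u v : (forall n, H (u_ n)) -> (forall n, H (v_ n)) -> H u -> H v ->
  sconv u_ u -> sconv v_ v -> dot (u_ n) (v_ n) @[n --> \oo] --> dot u v.
Proof.
move=> Hu_ Hv_ Hu Hv uu vv.
have Hun n := siB hd (Hu_ n) Hu; have Hvn n := siB hd (Hv_ n) Hv.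
have E n : dot (u_ n) (v_ n) = dot (u_ n - u) (v_ n - v) + dot (u_ n - u) v
    + dot u (v_ n - v) + dot u v.
  by rewrite !(dotBr hd)// !(dotBl hd)//; ring.
under eq_fun do rewrite E; apply: (cvg_to_eq (add0r _)).
apply: cvgD; last exact: cvg_cst.
apply: (cvg_to_eq (add0r _)); apply: cvgD; last first.
  apply: (@cvg0_of_sqr_le _ _ (fun n => dot u u * dot (v_ n - v) (v_ n - v))).
    by move=> n; exact: semi_inner_CS.
  by apply: (cvg_to_eq (mulr0 (dot u u))); apply: cvgMr.
apply: (cvg_to_eq (add0r _)); apply: cvgD.
  apply: (@cvg0_of_sqr_le _ _ (fun n => dot (u_ n - u) (u_ n - u) * dot (v_ n - v) (v_ n - v))).
    by move=> n; exact: semi_inner_CS.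
  by apply: (cvg_to_eq (mulr0 0)); apply: cvgM.
apply: (@cvg0_of_sqr_le _ _ (fun n => dot (u_ n - u) (u_ n - u) * dot v v)).
  by move=> n; exact: semi_inner_CS.
by apply: (cvg_to_eq (mul0r (dot v v))); apply: cvgMl.
Qed.

Lemma sconvD (u_ v_ : nat -> X) u v : (forall n, H (u_ n)) -> (forall n, H (v_ n)) -> H u -> H v ->
  sconv u_ u -> sconv v_ v -> sconv (fun n => u_ n + v_ n) (u + v).
Proof.
move=> Hu_ Hv_ Hu Hv uu vv.
apply: (@cvg0_of_le _ _ (fun n => 2 * dot (u_ n - u) (u_ n - u) + 2 * dot (v_ n - v) (v_ n - v))).
  move=> n; rewrite opprD addrACA; have hu := siB hd (Hu_ n) Hu; have hv := siB hd (Hv_ n) Hv.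
  by rewrite (si_ge0 hd (siD hd hu hv)) parallelogram_le.
have E0 : 2 * 0 + 2 * 0 = 0 :> R by ring.
apply: (cvg_to_eq E0).
by apply: cvgD; apply: cvgMr.
Qed.

Lemma sconvZ (c_ : nat -> R) (c : R) (u_ : nat -> X) u : (forall n, H (u_ n)) -> H u ->
  c_ @ \oo --> c -> sconv u_ u -> sconv (fun n => c_ n *: u_ n) (c *: u).
Proof.
move=> Hu_ Hu cc uu.
have E n : c_ n *: u_ n - c *: u = c_ n *: (u_ n - u) + (c_ n - c) *: u.
  by rewrite scalerBr scalerBl addrA subrK.
apply: (@cvg0_of_le _ _ (fun n => 2 * (c_ n ^+ 2 * dot (u_ n - u) (u_ n - u)) +
    2 * ((c_ n - c) ^+ 2 * dot u u))).
  move=> n; rewrite E; have hu := siB hd (Hu_ n) Hu.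
  have h1 := siZ hd (c_ n) hu; have h2 := siZ hd (c_ n - c) Hu.
  rewrite (si_ge0 hd (siD hd h1 h2))/=; apply: le_trans (parallelogram_le h1 h2) _.
  by rewrite !(dotZl hd)// !(dotZr hd)// !expr2 !mulrA.
have E0 : 2 * 0 + 2 * 0 = 0 :> R by ring.
apply: (cvg_to_eq E0).
apply: cvgD; apply: cvgMr.
  by apply: (cvg_to_eq (mulr0 (c ^+ 2))); apply: cvgM => //; rewrite !expr2; exact: cvgM.
apply: (cvg_to_eq (mul0r (dot u u))); apply: cvgMl.
have E1 : (c - c) * (c - c) = 0 by ring.
apply: (cvg_to_eq E1).
by under eq_fun do rewrite expr2; apply: cvgM; apply: cvgB => //; exact: cvg_cst.
Qed.

Lemma sconv_cst u : H u -> sconv (fun=> u) u.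
Proof. by move=> Hu; rewrite /sconv subrr (dot0l hd)//; [exact: cvg_cst|exact: si_0 hd]. Qed.

End semi_inner_theory.

(** * Riemannian gradient descent on a sphere *)

(** What the argument needs of the Gross--Pitaevskii problem: [a] is the inner product in
    which gradients are taken, [b] that of L2, [G] is Green's operator, [4 * cub u z] is the
    derivative of [quart] at [u] in the direction [z], and [C u] represents [cub u]. *)
Section descent.
Context (R : realType) (X : lmodType R).
Context (H : X -> Prop) (a b : X -> X -> R).
Context (quart : X -> R) (cub : X -> X -> R) (G C : X -> X).
Context (P K beta : R).
Implicit Types (u v w z g : X).
Hypotheses (ha : semi_inner H a) (hb : semi_inner H b).
Hypotheses (P0 : 0 <= P) (K0 : 0 <= K) (beta0 : 0 <= beta).
Hypothesis ba : forall u, H u -> b u u <= P * a u u.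
Hypothesis GH : forall u, H u -> H (G u).
Hypothesis aG : forall u z, H u -> H z -> a z (G u) = b u z.
Hypothesis CH : forall u, H u -> H (C u).
Hypothesis aC : forall u z, H u -> H z -> a z (C u) = cub u z.
Hypothesis quart_ge0 : forall u, H u -> 0 <= quart u.
Hypothesis quartZ : forall t u, H u -> quart (t *: u) = t ^+ 4 * quart u.
Hypothesis quart_le : forall u, H u -> quart u <= K * a u u ^+ 2.
Hypothesis cub_le : forall u z, H u -> H z -> cub u z ^+ 2 <= K * a u u ^+ 3 * a z z.
Hypothesis quart_taylor : forall (t : R) u g, H u -> H g -> 0 <= t <= 1 ->
  quart (u - t *: g) <=
  quart u - 4 * t * cub u g + t ^+ 2 * (K * (a u u + a g g) * a g g).

Definition model_energy u := 2^-1 * a u u + beta / 4 * quart u.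
Definition egrad u := u + beta *: C u.
(** The Lagrange multiplier of the constraint [b u u = 1], whose [a]-normal direction is
    [G u]. *)
Definition multiplier u := (1 + beta * b (C u) u) / a (G u) (G u).
Definition rgrad u := egrad u - multiplier u *: G u.
Definition unit_sphere u := H u /\ b u u = 1.

Lemma egradH u : H u -> H (egrad u).
Proof. by move=> Hu; apply: (siD ha) => //; apply: (siZ ha); exact: CH. Qed.

Lemma rgradH u : H u -> H (rgrad u).
Proof.
move=> Hu; apply: (siB ha); first exact: egradH.
by apply: (siZ ha); exact: GH.
Qed.

Lemma aGG_gt0 u : unit_sphere u -> 0 < a (G u) (G u).
Proof.
move=> [Hu u1]; have := semi_inner_CS ha Hu (GH Hu).
rewrite aG// u1 expr1n => h.
have h0 := si_ge0 ha (GH Hu); rewrite lt_neqAle h0 andbT; apply/eqP => h1.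
by move: h; rewrite -h1 mulr0 ler10.
Qed.

Lemma rgrad_tangent u : unit_sphere u -> b u (rgrad u) = 0.
Proof.
move=> uS; have [Hu u1] := uS; have GG := aGG_gt0 uS.
have HC := CH Hu; have HG := GH Hu; have Hgr := egradH Hu.
rewrite -aG//; last exact: rgradH.
rewrite (dotBl ha)// ?(dotZl ha)//; last exact: (siZ ha).
rewrite (dotDl ha)//; last exact: (siZ ha).
rewrite (dotZl ha)// !aG// u1 -(aG Hu HC) (aG Hu HC) (si_sym hb Hu HC) /multiplier.
by rewrite (aG Hu HG) divfK ?subrr// -(aG Hu HG) lt0r_neq0.
Qed.

Lemma egrad_rgrad u : unit_sphere u -> a (egrad u) (rgrad u) = a (rgrad u) (rgrad u).
Proof.
move=> uS; have [Hu u1] := uS; have HG := GH Hu; have Hr := rgradH Hu.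
rewrite {3}/rgrad (dotBl ha)//; [|exact: egradH|exact: (siZ ha)].
rewrite (dotZl ha)// (si_sym ha HG Hr) aG// rgrad_tangent// mulr0 subr0.
by [].
Qed.

(** By [egrad_rgrad], the Riemannian gradient is an [a]-orthogonal projection of the
    gradient. *)
Lemma rgrad_le_egrad u : unit_sphere u -> a (rgrad u) (rgrad u) <= a (egrad u) (egrad u).
Proof.
move=> uS; have [Hu _] := uS; have Hr := rgradH Hu; have Hg := egradH Hu.
have := si_ge0 ha (siB ha Hg Hr); rewrite (dot_sqrB ha)// egrad_rgrad//; lra.
Qed.

(** [a (C u) (C u)] is the value at [C u] of the functional that [C u] represents. *)
Lemma C_le u : H u -> a (C u) (C u) <= K * a u u ^+ 3.
Proof.
move=> Hu; have HC := CH Hu.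
have := cub_le Hu HC; rewrite -aC// expr2.
have := si_ge0 ha HC; rewrite le_eqVlt => /predU1P[<-|h].
  by move=> _; rewrite mulr_ge0// exprn_ge0//; exact: si_ge0 ha _ _.
by rewrite ler_pM2r.
Qed.

Lemma egrad_le u : H u -> a (egrad u) (egrad u) <= 2 * a u u + 2 * beta ^+ 2 * (K * a u u ^+ 3).
Proof.
move=> Hu; have HC := CH Hu; have HbC := siZ ha beta HC.
apply: le_trans (parallelogram_le ha Hu HbC) _.
rewrite (dotZl ha)// (dotZr ha)//.
by have := ler_wpM2l (sqr_ge0 beta) (C_le Hu); lra.
Qed.

Lemma a_le_energy u : H u -> a u u <= 2 * model_energy u.
Proof.
move=> Hu; rewrite /model_energy; have := mulr_ge0 beta0 (quart_ge0 Hu); lra.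
Qed.

Lemma energy_le u : H u -> 2 * model_energy u <= a u u + beta / 2 * (K * a u u ^+ 2).
Proof. move=> Hu; rewrite /model_energy; have := ler_wpM2l beta0 (quart_le Hu); lra. Qed.

(** Applied below to the retraction, which divides by a norm that is at least one. *)
Lemma energy_shrink s u : H u -> 0 <= s <= 1 -> model_energy (s *: u) <= model_energy u.
Proof.
move=> Hu /andP[s0 s1]; rewrite /model_energy (dotZl ha) ?(dotZr ha) ?quartZ//; last exact: (siZ ha).
apply: lerD; apply: ler_wpM2l => //.
- rewrite mulrA -expr2 ler_piMl//; first exact: si_ge0 ha _ _.
  exact: exprn_ile1.
- exact: divr_ge0.
- by rewrite ler_piMl ?quart_ge0// exprn_ile1.
Qed.

Definition step t u := (Num.sqrt (b (u - t *: rgrad u) (u - t *: rgrad u)))^-1 *: (u - t *: rgrad u).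

(** Pythagoras' theorem, the gradient being [b]-orthogonal to [u]. *)
Lemma step_sphere t u : unit_sphere u -> 1 <= b (u - t *: rgrad u) (u - t *: rgrad u) /\ unit_sphere (step t u).
Proof.
move=> uS; have [Hu u1] := uS; have Hr := rgradH Hu.
have Htr := siZ ha t Hr; have Hv := siB ha Hu Htr.
have le1 : 1 <= b (u - t *: rgrad u) (u - t *: rgrad u).
  rewrite (dot_sqrB hb)// (dotZr hb t Hr Hu) rgrad_tangent// !mulr0 subr0 u1 lerDl.
  exact: si_ge0 hb _ _.
split=> //; split; first exact: (siZ ha).
rewrite (dotZl hb) ?(dotZr hb)//; last exact: (siZ ha).
rewrite mulrA -expr2 exprVn sqr_sqrtr ?mulVf//; last exact: le_trans le1.
by apply: lt0r_neq0; exact: lt_le_trans le1.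
Qed.

(** On the segment, the term linear in [t] is [- t * a (rgrad u) (rgrad u)] by
    [egrad_rgrad]; the condition on [t] makes half of it dominate the remaining terms. *)
Lemma energy_step (A B t : R) u : unit_sphere u -> a u u <= A -> a (egrad u) (egrad u) <= B ->
  0 <= t <= 1 -> t * (1 + beta / 2 * (K * (A + B))) <= 1 ->
  t / 2 * a (rgrad u) (rgrad u) <= model_energy u - model_energy (step t u).
Proof.
move=> uS uA uB t01 tM; have /andP[t0 t1] := t01.
have [Hu u1] := uS; have Hr := rgradH Hu.
have Htr := siZ ha t Hr; have Hv := siB ha Hu Htr.
have [v1 _] := step_sphere t uS.
have s1 : 0 <= (Num.sqrt (b (u - t *: rgrad u) (u - t *: rgrad u)))^-1 <= 1.
  rewrite invr_ge0 sqrtr_ge0/= invf_le1.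
    by rewrite -[leLHS]sqrtr1; apply: ler_wsqrtr.
  by rewrite sqrtr_gt0; exact: lt_le_trans v1.
have h1 := energy_shrink Hv s1.
have h2 := quart_taylor Hu Hr t01.
have HC := CH Hu; have HbC := siZ ha beta HC.
have h3 := egrad_rgrad uS; rewrite /egrad (dotDl ha)// (dotZl ha)// in h3.
rewrite (si_sym ha HC Hr) aC// in h3.
suff : model_energy (u - t *: rgrad u) <= model_energy u - t / 2 * a (rgrad u) (rgrad u) by rewrite /step; lra.
rewrite /model_energy (dot_sqrB ha)// (dotZr ha t Hr Hu) (dotZl ha)// (dotZr ha)//.
have rB := le_trans (rgrad_le_egrad uS) uB.
have rg0 := si_ge0 ha Hr.
have h4 : t ^+ 2 * (K * (a u u + a (rgrad u) (rgrad u)) * a (rgrad u) (rgrad u)) <=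
    t ^+ 2 * (K * (A + B) * a (rgrad u) (rgrad u)).
  by apply: ler_wpM2l; [exact: sqr_ge0|apply: ler_wpM2r => //; apply: ler_wpM2l => //; lra].
have h5 : t * (1 + beta / 2 * (K * (A + B))) * (t * a (rgrad u) (rgrad u)) <= t * a (rgrad u) (rgrad u).
  by rewrite ler_piMl// mulr_ge0.
have := ler_wpM2l beta0 (le_trans h2 (lerD (lexx _) h4)).
have {}h3 := congr1 ( *%R t) h3; move: h3 h5; move: (cub u (rgrad u)) (a u (rgrad u)) (a (rgrad u) (rgrad u)) (quart _) (quart _) => c d e q1 q2.
lra.
Qed.

Fixpoint iterates (alpha : nat -> R) u0 n : X :=
  if n is n'.+1 then step (alpha n') (iterates alpha u0 n') else u0.

(** Bounds on the points of the sphere with an energy at most that of a point [u0] such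
    that [a u0 u0 <= A0], and the step size they allow. *)
Definition a_bound (A0 : R) := A0 + beta / 2 * (K * A0 ^+ 2).
Definition egrad_bound A0 := 2 * a_bound A0 + 2 * beta ^+ 2 * (K * a_bound A0 ^+ 3).
Definition step_bound A0 := (1 + beta / 2 * (K * (a_bound A0 + egrad_bound A0)))^-1.

Lemma bounds_ge0 A0 : 0 <= A0 -> 0 <= a_bound A0 /\ 0 <= egrad_bound A0.
Proof.
move=> A00; have a0 : 0 <= a_bound A0.
  by rewrite /a_bound addr_ge0// !mulr_ge0// sqr_ge0.
by split => //; rewrite /egrad_bound addr_ge0// !mulr_ge0// ?sqr_ge0// exprn_ge0.
Qed.

Lemma step_bound_le1 A0 : 0 <= A0 -> 0 < step_bound A0 <= 1.
Proof.
move=> /bounds_ge0[h1 h2]; have h : 0 <= beta / 2 * (K * (a_bound A0 + egrad_bound A0)).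
  by rewrite !mulr_ge0// addr_ge0.
have h3 : 1 <= 1 + beta / 2 * (K * (a_bound A0 + egrad_bound A0)) by rewrite lerDl.
have h4 := lt_le_trans ltr01 h3.
by rewrite /step_bound invr_gt0 h4 invf_le1.
Qed.

Section run.
Context (alpha : nat -> R) (amin A0 : R) (u0 : X).
Hypotheses (u0S : unit_sphere u0) (u0A : a u0 u0 <= A0) (amin0 : 0 < amin).
Hypothesis halpha : forall n, amin <= alpha n <= step_bound A0.
Notation u_ := (iterates alpha u0).

Let A00 : 0 <= A0.
Proof. by apply: le_trans u0A; case: u0S => Hu _; exact: si_ge0 ha _ Hu. Qed.

(** A bound on the energy alone entails the bounds under which a step decreases the energy,
    so that the hypotheses are inherited by the next iterate. *)
Lemma run_invariant v n : unit_sphere v -> model_energy v <= model_energy u0 ->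
  [/\ a v v <= a_bound A0, a (egrad v) (egrad v) <= egrad_bound A0, unit_sphere (step (alpha n) v) &
    alpha n / 2 * a (rgrad v) (rgrad v) <= model_energy v - model_energy (step (alpha n) v)].
Proof.
move=> vS ve; have [Hv _] := vS; have [Hu0 _] := u0S.
have vA : a v v <= a_bound A0.
  apply: le_trans (a_le_energy Hv) _; apply: (@le_trans _ _ (2 * model_energy u0)); first by rewrite ler_pM2l.
  apply: le_trans (energy_le Hu0) _; apply: lerD => //; apply: ler_wpM2l; first exact: divr_ge0.
  apply: ler_wpM2l => //; apply: lerXn2r => //; rewrite nnegrE//; exact: si_ge0 ha _ Hu0.
have vB : a (egrad v) (egrad v) <= egrad_bound A0.
  apply: le_trans (egrad_le Hv) _; apply: lerD; first by rewrite ler_pM2l.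
  apply: ler_wpM2l; first by rewrite mulr_ge0// sqr_ge0.
  apply: ler_wpM2l => //; apply: lerXn2r => //; rewrite nnegrE; first exact: si_ge0 ha _ Hv.
  by case: (bounds_ge0 A00).
have /andP[h1 h2] := halpha n; have /andP[s0 s1] := step_bound_le1 A00.
have [_ sS] := step_sphere (alpha n) vS; split => //.
apply: energy_step vS vA vB _ _; first by rewrite (le_trans h2 s1) (le_trans (ltW amin0)).
by rewrite -ler_pdivlMr ?div1r// -invr_gt0.
Qed.

Lemma run_sphere n : unit_sphere (u_ n) /\ model_energy (u_ n) <= model_energy u0.
Proof.
elim: n => [|n [uS ue]]; first by [].
have [_ _ sS dec] := run_invariant n uS ue; split => //=.
apply: le_trans ue; rewrite -subr_ge0; apply: le_trans dec.
have /andP[h1 _] := halpha n; apply: mulr_ge0; last by apply: (si_ge0 ha); apply: rgradH; case: uS.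
by apply: divr_ge0 => //; exact: le_trans (ltW amin0) h1.
Qed.

Lemma run_decay n : amin / 2 * a (rgrad (u_ n)) (rgrad (u_ n)) <= model_energy (u_ n) - model_energy (u_ n.+1).
Proof.
have [uS ue] := run_sphere n; have [_ _ _] := run_invariant n uS ue; apply: le_trans.
apply: ler_wpM2r; first by apply: (si_ge0 ha); apply: rgradH; case: uS.
by rewrite ler_pM2r//; case/andP: (halpha n).
Qed.

(** The energy decreases and is nonnegative, so that its decrements tend to zero. *)
Lemma run_gradient_cvg0 : a (rgrad (u_ n)) (rgrad (u_ n)) @[n --> \oo] --> 0.
Proof.
have r0 n : 0 <= a (rgrad (u_ n)) (rgrad (u_ n)).
  by apply: (si_ge0 ha); apply: rgradH; case: (run_sphere n) => -[].
have noninc : nonincreasing_seq (fun n => model_energy (u_ n)).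
  apply/nonincreasing_seqP => n; rewrite -subr_ge0; apply: le_trans (run_decay n).
  by rewrite mulr_ge0// ?divr_ge0// ltW.
have en0 n : 0 <= model_energy (u_ n).
  have [[Hu _] _] := run_sphere n; have := le_trans (si_ge0 ha Hu) (a_le_energy Hu); lra.
have cv : cvgn (fun n => model_energy (u_ n)).
  by apply: nonincreasing_is_cvgn => //; exists 0 => _ [n _ <-].
have cv1 : model_energy (u_ n.+1) @[n --> \oo] --> limn (fun n => model_energy (u_ n)).
  by rewrite (cvg_shiftS (fun n => model_energy (u_ n))).
apply: (@cvg0_of_le _ _ (fun n => 2 / amin * (model_energy (u_ n) - model_energy (u_ n.+1)))).
  move=> n; rewrite r0/=; have := run_decay n; rewrite -(ler_pM2l (divr_gt0 (ltr0Sn R 1) amin0)).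
  by rewrite mulrA (_ : 2 / amin * (amin / 2) = 1) ?mul1r//; field; rewrite gt_eqF.
by apply: (cvg_to_eq (mulr0 (2 / amin))); apply: cvgMr; rewrite -(subrr (limn (fun n => model_energy (u_ n)))); exact: cvgB.
Qed.

End run.

Hypothesis b0a0 : forall z, H z -> b z z = 0 -> a z z = 0.
Hypothesis cub_cont : forall (v_ : nat -> X) u M, (forall n, H (v_ n)) -> H u ->
  (forall n, a (v_ n) (v_ n) <= M) -> sconv b v_ u ->
  exists2 e_ : nat -> R, e_ @ \oo --> 0 &
    forall n z, H z -> (cub (v_ n) z - cub u z) ^+ 2 <= e_ n * a z z.

Lemma le_of_sqr_le_mul (x e : R) : 0 <= x -> x ^+ 2 <= e * x -> x <= `|e|.
Proof.
rewrite le_eqVlt => /predU1P[<-//|x0]; rewrite expr2 ler_pM2r// => h.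
exact: le_trans h (ler_norm _).
Qed.

(** With [z = G (v_ n) - G u], [a z z = b (v_ n - u) z], which Cauchy--Schwarz and [ba]
    bound by the square root of [a z z] times that of [P * b (v_ n - u) (v_ n - u)]. *)
Lemma sconv_G (v_ : nat -> X) u : (forall n, H (v_ n)) -> H u -> sconv b v_ u ->
  sconv a (G \o v_) (G u).
Proof.
move=> Hv Hu vu; apply: (@cvg0_of_le _ _ (fun n => `|P * b (v_ n - u) (v_ n - u)|)).
  move=> n; have HG := siB ha (GH (Hv n)) (GH Hu).
  have Hd := siB hb (Hv n) Hu.
  rewrite (si_ge0 ha HG)/=; apply: le_of_sqr_le_mul; first exact: si_ge0 ha _ HG.
  rewrite {1}(dotBr ha (GH (Hv n)) (GH Hu) HG) !aG// -(dotBl hb)//.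
  apply: le_trans (semi_inner_CS hb Hd HG) _; rewrite mulrAC mulrC.
  by apply: ler_wpM2r; [exact: si_ge0 hb _ Hd|exact: ba].
by apply: (cvg_to_eq (@normr0 _ R)); apply: cvg_norm; apply: (cvg_to_eq (mulr0 P)); apply: cvgMr.
Qed.

Lemma sconv_C (v_ : nat -> X) u M : (forall n, H (v_ n)) -> H u -> (forall n, a (v_ n) (v_ n) <= M) ->
  sconv b v_ u -> sconv a (C \o v_) (C u).
Proof.
move=> Hv Hu vM vu; have [e_ e0 he] := cub_cont Hv Hu vM vu.
apply: (@cvg0_of_le _ _ (fun n => `|e_ n|)); last first.
  by apply: (cvg_to_eq (@normr0 _ R)); exact: cvg_norm.
move=> n; have HC := siB ha (CH (Hv n)) (CH Hu).
rewrite (si_ge0 ha HC)/=; apply: le_of_sqr_le_mul; first exact: si_ge0 ha _ HC.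
by rewrite {1}(dotBr ha (CH (Hv n)) (CH Hu) HC) !aC//; exact: he.
Qed.

(** Since [v_ n = rgrad (v_ n) - beta *: C (v_ n) + multiplier (v_ n) *: G (v_ n)], and the
    three terms converge for [a], the sequence converges for [a] to some [w], which is
    equivalent to [u] because both are limits for [b]; and [rgrad u] is [u - w]. *)
Theorem limit_is_critical (v_ : nat -> X) u M : (forall n, unit_sphere (v_ n)) -> H u ->
  (forall n, a (v_ n) (v_ n) <= M) -> a (rgrad (v_ n)) (rgrad (v_ n)) @[n --> \oo] --> 0 ->
  sconv b v_ u -> [/\ b u u = 1, sconv a v_ u & a (rgrad u) (rgrad u) = 0].
Proof.
move=> vS Hu vM rg0 vu.
have Hv n : H (v_ n) by case: (vS n).
have u1 : b u u = 1.
  have := cvg_dot hb Hv Hv Hu Hu vu vu.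
  under eq_fun do rewrite (vS _).2.
  by move=> /cvg_lim <-//; rewrite lim_cst.
have uS : unit_sphere u by [].
have HG n := GH (Hv n); have HC n := CH (Hv n).
have cG := sconv_G Hv Hu vu; have cC := sconv_C Hv Hu vM vu.
have bC v : H v -> b (C v) v = a (C v) (G v).
  by move=> H1; rewrite aG ?(si_sym hb (CH H1) H1)//; exact: CH.
have cgam : multiplier (v_ n) @[n --> \oo] --> multiplier u.
  rewrite /multiplier; apply: cvgM; last first.
    apply: cvgV; first by rewrite lt0r_neq0// aGG_gt0.
    by apply: (cvg_dot ha) => //; exact: GH.
  apply: cvgD; first exact: cvg_cst.
  apply: cvgMr; rewrite bC//; under eq_fun do rewrite bC//.
  by apply: (cvg_dot ha) => //; [exact: CH|exact: GH].
pose w := (- beta) *: C u + multiplier u *: G u.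
have Hw : H w by apply: (siD ha); apply: (siZ ha); [exact: CH|exact: GH].
have rgE v : rgrad v = v - ((- beta) *: C v + multiplier v *: G v).
  by rewrite /rgrad /egrad scaleNr opprD opprK addrA.
have vw : sconv a v_ w.
  have -> : v_ = fun n => rgrad (v_ n) + ((- beta) *: C (v_ n) + multiplier (v_ n) *: G (v_ n)).
    by apply/funext => n; rewrite rgE subrK.
  rewrite /sconv -[w]add0r; apply: (sconvD ha) => //.
  - by move=> n; exact: rgradH.
  - by move=> n; apply: (siD ha); apply: (siZ ha).
  - exact: si_0 ha.
  - by rewrite /sconv; under eq_fun do rewrite subr0.
  apply: (sconvD ha).
  - by move=> n; apply: (siZ ha).
  - by move=> n; apply: (siZ ha).
  - by apply: (siZ ha); exact: CH.
  - by apply: (siZ ha); exact: GH.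
  - by apply: (sconvZ ha) => //; [exact: CH|exact: cvg_cst].
  - by apply: (sconvZ ha) => //; exact: GH.
have vwb : sconv b v_ w.
  apply: (@cvg0_of_le _ _ (fun n => P * a (v_ n - w) (v_ n - w))).
    move=> n; have Hd := siB ha (Hv n) Hw; rewrite (si_ge0 hb Hd)/=; exact: ba.
  by apply: (cvg_to_eq (mulr0 P)); apply: cvgMr.
have Huw := siB ha Hu Hw.
have uw0 : a (u - w) (u - w) = 0.
  apply: b0a0 => //; have : b (v_ n - v_ n) (v_ n - v_ n) @[n --> \oo] --> b (u - w) (u - w).
    have Hm v : H v -> H (- v) by move=> ?; apply: (siN ha).
    have c1 : sconv b (fun n => v_ n - v_ n) (u - w).
      apply: (sconvD hb) => //; [by move=> n; exact: Hm|exact: Hm|].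
      have c1 : (fun=> -1) @ \oo --> (-1 : R) by exact: cvg_cst.
      have := sconvZ hb Hv Hw c1 vwb; rewrite scaleN1r.
      by congr (sconv b _ _); apply/funext => n; rewrite scaleN1r.
    by apply: (cvg_dot hb) => // n; exact: (siB hb).
  under eq_fun do rewrite subrr (dot0l hb (si_0 hb)).
  by move=> /cvg_lim <-//; rewrite lim_cst.
split=> //; last by rewrite rgE.
apply: (@cvg0_of_le _ _ (fun n => 2 * a (v_ n - w) (v_ n - w))).
  move=> n; have Hn := siB ha (Hv n) Hw; have Hnu := siB ha (Hv n) Hu.
  rewrite (si_ge0 ha Hnu)/=.
  have -> : v_ n - u = (v_ n - w) + (-1) *: (u - w).
    by rewrite scaleN1r opprB addrA subrK.
  have Hm := siZ ha (-1) Huw.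
  apply: le_trans (parallelogram_le ha Hn Hm) _.
  by rewrite (dotZl ha)// (dotZr ha)// uw0; lra.
by apply: (cvg_to_eq (mulr0 2)); apply: cvgMr.
Qed.

End descent.

(** * Lebesgue measure on row vectors *)

Section borel.
Context (R : realType) (n : nat).
Implicit Types (A : set 'rV[R]_n).

Lemma mx_norm_coord (x : 'rV[R]_n) i : `|x ord0 i| <= `|x|.
Proof.
rewrite [leRHS]/Num.norm/= mx_normrE; apply/bigmax_geP; right => /=.
by exists (ord0, i).
Qed.

Lemma mx_norm_lt (x : 'rV[R]_n) e : 0 < e -> (forall i, `|x ord0 i| < e) -> `|x| < e.
Proof.
move=> e0 h; rewrite [ltLHS]/Num.norm/= mx_normrE; apply/bigmax_ltP; split => //= -[i j] _ /=.
by rewrite ord1.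
Qed.

Lemma measurable_box (B : 'I_n -> set (measurableTypeR R)) :
  (forall i, measurable (B i)) -> measurable [set x : 'rV[R]_n | forall i, B i (rV_coord i x)].
Proof.
move=> mB.
rewrite (_ : mkset _ = \big[setI/setT]_(i < n) ((@rV_coord R n i) @^-1` B i)).
  apply: bigsetI_measurable => i _; rewrite -[X in measurable X]setTI.
  exact: measurable_rV_coord.
apply/seteqP; rewrite -bigcap_seq; split => [y /= + i _|y /= Ay i]; first exact.
by apply: Ay => /=; rewrite mem_index_enum.
Qed.

Definition obox (a b : 'I_n -> R) : set 'rV[R]_n :=
  [set x | forall i, `](a i), (b i)[%classic (rV_coord i x)].

Definition oboxes : set (set 'rV[R]_n) := [set B | exists a b, B = obox a b].

Lemma measurable_obox a b : measurable (obox a b).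
Proof.
by apply: (@measurable_box (fun i => `](a i), (b i)[%classic)) => i; exact: measurable_itv.
Qed.

Definition cbox (a b : 'I_n -> R) : set 'rV[R]_n :=
  [set x | forall i, `[(a i), (b i)]%classic (x ord0 i)].

Definition rat_lo (p : 'rV[rat]_n * nat) i : R := ratr (p.1 ord0 i) - p.2.+1%:R^-1.
Definition rat_hi (p : 'rV[rat]_n * nat) i : R := ratr (p.1 ord0 i) + p.2.+1%:R^-1.

Lemma obox_sub_cbox a b : obox a b `<=` cbox a b.
Proof.
move=> x h i; have := h i; rewrite /= !in_itv/= => /andP[? ?].
by apply/andP; split; exact: ltW.
Qed.

(** Boxes with rational centers and radii [k.+1%:R^-1] form a countable basis, so that open
    sets belong to the sigma-algebra generated by boxes. *)
Lemma open_rat_box A x : open A -> A x ->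
  exists p, obox (rat_lo p) (rat_hi p) x /\ cbox (rat_lo p) (rat_hi p) `<=` A.
Proof.
move=> oA Ax.
have /nbhs_ballP[e /= e0 xeA] := open_nbhs_nbhs (conj oA Ax).
have [k hk] : exists k, k.+1%:R^-1 < e / 2.
  exists (Num.truncn (e / 2)^-1); rewrite invf_plt ?posrE ?divr_gt0//.
  exact: truncnS_gt.
have k0 : 0 < k.+1%:R^-1 :> R by rewrite invr_gt0.
have /choice[q qP] i : exists q : rat, ratr q \in `](x ord0 i - k.+1%:R^-1), (x ord0 i + k.+1%:R^-1)[.
  by apply: rat_in_itvoo; move: k0; move: (k.+1%:R^-1) => z; lra.
exists (\row_i q i, k); rewrite /rat_lo /rat_hi; split.
  move=> i /=; rewrite /rV_coord mxE; have := qP i; rewrite !in_itv/=.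
  by move: (k.+1%:R^-1) => z /andP[? ?]; apply/andP; split; lra.
move=> y By; apply: xeA; rewrite -ball_normE /=; apply: mx_norm_lt => // i.
have := By i; have := qP i; rewrite /= !in_itv/= !mxE ltr_norml.
move: hk; move: (k.+1%:R^-1) => z hz /andP[? ?] /andP[? ?]; apply/andP; split; lra.
Qed.

Lemma open_sigma_oboxes A : open A -> <<s oboxes >> A.
Proof.
move=> oA; pose B p := obox (rat_lo p) (rat_hi p).
have -> : A = \bigcup_p (if `[< B p `<=` A >] then B p else set0).
  apply/seteqP; split => [x Ax|x [p _]]; last first.
    by case: asboolP => // h; exact: h.
  have [p [Bx BA]] := open_rat_box oA Ax; exists p => //.
  by case: asboolP => // nBA; exfalso; apply: nBA; apply: subset_trans BA; exact: obox_sub_cbox.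
apply: (@countable_bigcupT_measurable _ (g_sigma_algebraType oboxes)); first exact: countableP.
move=> p; case: ifP => _; last exact: measurable0.
by apply: sub_sigma_algebra; do 2 eexists.
Qed.

(** This makes the boxes, which are stable under intersection, a generating class for
    Dynkin's lemma. *)
Lemma measurable_rVE : @measurable _ 'rV[R]_n = <<s oboxes >>.
Proof.
apply/seteqP; split; last first.
  apply: smallest_sub; first exact: sigma_algebra_measurable.
  by move=> _ [a [b ->]]; exact: measurable_obox.
apply: smallest_sub; first exact: smallest_sigma_algebra.
move=> A; rewrite -bigcup_seq => -[i _ [Y mY <-]].
have : @measurable_fun _ _ (g_sigma_algebraType oboxes) _ setT (@rV_coord R n i).
  apply: (measurability _ (measurable_realfun.RGenOpens.measurableE R)).
  move=> _ [_ [a [b ->] <-]]; rewrite setTI; apply: open_sigma_oboxes.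
  by apply: open_comp; [move=> x _; exact: coord_continuous|exact: interval_open].
by move=> /(_ measurableT _ mY).
Qed.

Lemma open_measurable_rV A : open A -> measurable A.
Proof. by move=> /open_sigma_oboxes; rewrite -measurable_rVE. Qed.

Lemma continuous_measurable_rV (f : 'rV[R]_n -> R) :
  continuous f -> measurable_fun setT f.
Proof.
move=> /continuousP cf; apply: (measurability _ (measurable_realfun.RGenOpens.measurableE R)).
move=> _ [_ [a [b ->] <-]]; rewrite setTI; apply: open_measurable_rV.
exact/cf/interval_open.
Qed.

End borel.
Arguments rat_lo {R n} p i.
Arguments rat_hi {R n} p i.

Section translation.
Context (R : realType).

Lemma measurable_shiftR (t : R) :
  measurable_fun setT (fun x : measurableTypeR R => (x + t : measurableTypeR R)).
Proof. by apply: measurable_funD => //; exact: measurable_id. Qed.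

Lemma lebesgue_measure_shift (t : R) (A : set (measurableTypeR R)) : measurable A ->
  lebesgue_measure ((fun x : measurableTypeR R => x + t) @^-1` A) = lebesgue_measure A.
Proof.
move=> mA; apply/esym.
pose m : {measure set (measurableTypeR R) -> \bar R} :=
  measure_function_pushforward__canonical__measure_function_Measure
     (@lebesgue_measure R) (measurable_shiftR t).
apply: (@lebesgue_measure_unique R m) => // _ [[a b] _ <-].
rewrite /m/= /pushforward.
rewrite (_ : _ @^-1` _ = `]a - t, b - t]%classic); last first.
  by apply/seteqP; split => x /=; rewrite !in_itv/= => /andP[? ?]; apply/andP; split; lra.
rewrite !lebesgue_measure_itv/= !lte_fin ltrD2r.
by case: ifP => // _; congr EFin; ring.
Qed.

Lemma measurable_shift_rV n (v : 'rV[R]_n) : measurable_fun setT (fun x : 'rV[R]_n => x + v).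
Proof.
apply: measurable_fun_rV => i.
rewrite (_ : _ \o _ = (fun x => x + v ord0 i) \o @rV_coord R n i); last first.
  by apply/funext => x; rewrite /rV_coord /= mxE.
by apply: measurableT_comp; [exact: measurable_shiftR|exact: measurable_rV_coord].
Qed.

(** By induction on the dimension, from the uniqueness of product measures. *)
Lemma lebesgue_rV_shift n (v : 'rV[R]_n) (A : set 'rV[R]_n) : measurable A ->
  lebesgue_rV R n ((fun x => x + v) @^-1` A) = lebesgue_rV R n A.
Proof.
elim: n v A => [|n IH] v A mA.
  congr (_ _); apply/seteqP; split => x /=; by rewrite (_ : x + v = x)//; apply/rowP => -[].
pose a := v ord0 ord0; pose w := (rV_uncons v).2.
have mtau : measurable_fun setT (fun p : measurableTypeR R * 'rV[R]_n =>
    ((p.1 + a, p.2 + w) : measurableTypeR R * 'rV[R]_n)).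
  apply/measurable_fun_pairP; split.
    apply: (measurableT_comp (measurable_shiftR a)); exact: measurable_fst.
  apply: (measurableT_comp (measurable_shift_rV w)); exact: measurable_snd.
pose m : {measure set _ -> \bar R} :=
  measure_function_pushforward__canonical__measure_function_Measure
     (@lebesgue_measure R \x lebesgue_rV R n)%E mtau.
have mcA : measurable (@rV_cons R n @^-1` A).
  by rewrite -[X in measurable X]setTI; exact: measurable_rV_cons.
have consD x y : rV_cons (x, y) + v = rV_cons (x + a, y + w).
  by rewrite -{1}[v]rV_unconsK /rV_cons /= (@add_row_mx _ 1 1 n) -raddfD.
rewrite /= /lebesgue_step /pushforward.
rewrite (@product_measure_unique _ _ _ _ _ (@lebesgue_measure R) (lebesgue_rV R n) m _ _ mcA); last first.
  move=> B C mB mC; rewrite /m/= /pushforward.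
  rewrite (_ : _ @^-1` _ = ((fun x => x + a) @^-1` B) `*` ((fun y => y + w) @^-1` C))//.
  rewrite product_measure1E//.
  - by congr (_ * _)%E; [exact: lebesgue_measure_shift|exact: IH].
  - by rewrite -[X in measurable X]setTI; exact: measurable_shiftR.
  - by rewrite -[X in measurable X]setTI; exact: measurable_shift_rV.
by rewrite /m/= /pushforward; congr (_ _); apply/seteqP; split => -[x y] /=; rewrite consD.
Qed.

Lemma ge0_integral_shift n (v : 'rV[R]_n) (f : 'rV[R]_n -> \bar R) :
  measurable_fun setT f -> (forall x, 0 <= f x)%E ->
  (\int[lebesgue_rV R n]_x f (x + v)%R = \int[lebesgue_rV R n]_x f x)%E.
Proof.
move=> mf f0.
have /= := ge0_integral_pushforward (measurable_shift_rV v) (lebesgue_rV R n) measurableT mf (fun y _ => f0 y).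
rewrite preimage_setT => <-.
apply: (@eq_measure_integral _ _ _ _ _ (measure_function_pushforward__canonical__measure_function_Measure
  (lebesgue_rV R n) (measurable_shift_rV v))) => A mA _.
exact: lebesgue_rV_shift.
Qed.

Lemma Rintegral_shift n (v : 'rV[R]_n) (f : 'rV[R]_n -> R) :
  measurable_fun setT f ->
  \int[lebesgue_rV R n]_x f (x + v) = \int[lebesgue_rV R n]_x f x.
Proof.
move=> mf; rewrite /Rintegral; congr fine; rewrite [LHS]integralE [RHS]integralE.
have mf' : measurable_fun setT (EFin \o f) by exact/measurable_EFinP.
congr (_ - _)%E.
- have := ge0_integral_shift v (measurable_funepos mf') (funepos_ge0 _).
  move=> <-; apply: eq_integral => x _.
  by rewrite -[LHS]/(((EFin \o f) \o (fun x => x + v)%R)^\+%E x) funepos_comp.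
- have := ge0_integral_shift v (measurable_funeneg mf') (funeneg_ge0 _).
  move=> <-; apply: eq_integral => x _.
  by rewrite -[LHS]/(((EFin \o f) \o (fun x => x + v)%R)^\-%E x) funeneg_comp.
Qed.

End translation.

Section tonelli.
Context (R : realType) (n : nat).
Local Open Scope ereal_scope.

Lemma tonelli_cons (f : 'rV[R]_n.+1 -> \bar R) :
  measurable_fun setT f -> (forall x, 0 <= f x) ->
  \int[lebesgue_rV R n.+1]_x f x =
  \int[@lebesgue_measure R]_a \int[lebesgue_rV R n]_y f (rV_cons (a, y)).
Proof.
move=> mf f0; have mc := @measurable_rV_cons R n.
transitivity (\int[(@lebesgue_measure R \x lebesgue_rV R n)]_p f (rV_cons p)).
  have := ge0_integral_pushforward mc (@lebesgue_measure R \x lebesgue_rV R n) measurableT mf (fun y _ => f0 y).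
  by rewrite preimage_setT => <-; apply: eq_measure_integral.
by rewrite fubini_tonelli1//; exact: measurableT_comp mf mc.
Qed.

End tonelli.

Section finite.
Context (R : realType) (n : nat).

Definition cube_rV (r : R) : set 'rV[R]_n := [set x | forall i, `](- r), r]%classic (rV_coord i x)].

Lemma measurable_cube_rV r : measurable (cube_rV r).
Proof. by apply: (@measurable_box _ _ (fun=> `](- r), r]%classic)) => i; exact: measurable_itv. Qed.

Lemma bounded_subset_cube (A : set 'rV[R]_n) : bounded_set A ->
  exists2 r : R, 0 < r & A `<=` cube_rV r.
Proof.
move=> [M [Mr hM]]; exists (`|M| + 1); first by rewrite ltr_wpDl.
move=> x Ax i /=; have := hM (`|M| + 2^-1) _ x Ax.
have hN := ler_norm M; have /[swap] /[apply] /= : M < `|M| + 2^-1 by lra.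
have := mx_norm_coord x i; rewrite /rV_coord in_itv/=.
move=> h1 h2; have : `|x ord0 i| <= `|M| + 2^-1 := le_trans h1 h2.
by rewrite ler_norml => /andP[? ?]; apply/andP; split; lra.
Qed.

Lemma cube_rV_lty r : (lebesgue_rV R n (cube_rV r) < +oo)%E.
Proof.
rewrite (lebesgue_rV_box (A := fun=> `](- r), r]%classic)); last by move=> i; exact: measurable_itv.
rewrite ltey_eq; apply/orP; left.
elim/big_ind : _ => // [x y hx hy|i _]; first by rewrite fin_numM.
by rewrite lebesgue_measure_itv/=; case: ifP.
Qed.

Lemma bounded_measure_lty (A : set 'rV[R]_n) : measurable A -> bounded_set A ->
  (lebesgue_rV R n A < +oo)%E.
Proof.
move=> mA /bounded_subset_cube[r r0 Ar].
apply: le_lt_trans (cube_rV_lty r); apply: le_measure => //; rewrite inE//.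
exact: measurable_cube_rV.
Qed.

End finite.

(** * The space L2 *)

Section L2_space.
Context (R : realType) (d : nat) (Omega : set 'rV[R]_d).
Hypothesis mO : measurable Omega.
Implicit Types (u v w f g : 'rV[R]_d -> R).

Notation mu := (lebesgue_rV R d).
Notation rint f := (mu.-integrable Omega (EFin \o f)).

Lemma rint_le f g : measurable_fun Omega f -> rint g ->
  (forall x, Omega x -> `|f x| <= g x) -> rint f.
Proof.
move=> mf ig fg; apply: (le_integrable mO _ _ ig); first exact/measurable_EFinP.
by move=> x Ox /=; rewrite lee_fin (le_trans (fg x Ox))// ler_norm.
Qed.

Lemma rintD f g : rint f -> rint g -> rint (fun x => f x + g x).
Proof. by move=> hf hg; have := integrableD mO hf hg. Qed.

Lemma rintZ k f : rint f -> rint (fun x => k * f x).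
Proof. by move=> hf; have := integrableZl mO k hf. Qed.

Lemma rintB f g : rint f -> rint g -> rint (fun x => f x - g x).
Proof. by move=> hf hg; have := integrableB mO hf hg. Qed.

Lemma rint_sum (I : Type) (r : seq I) (P : pred I) (F : I -> 'rV[R]_d -> R) :
  (forall i, P i -> rint (F i)) -> rint (fun x => \sum_(i <- r | P i) F i x).
Proof.
move=> h; have := integrable_sum mO r h.
by congr (integrable _ _ _); apply/funext => x; rewrite /= sumEFin.
Qed.

Lemma rint_measurable f : rint f -> measurable_fun Omega f.
Proof. by move=> /integrableP[/measurable_EFinP]. Qed.

Lemma Rintegral_sum (I : Type) (r : seq I) (F : I -> 'rV[R]_d -> R) :
  (forall i, rint (F i)) ->
  \int[mu]_(x in Omega) (\sum_(i <- r) F i x) = \sum_(i <- r) \int[mu]_(x in Omega) F i x.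
Proof.
move=> h; elim: r => [|a r IH].
  rewrite big_nil; under eq_Rintegral do rewrite big_nil.
  by rewrite Rintegral_cst// mul0r.
rewrite big_cons -IH -RintegralD//; last exact: rint_sum.
by apply: eq_Rintegral => x _; rewrite big_cons.
Qed.

Lemma ae_eq_Rintegral f g : measurable_fun Omega f -> measurable_fun Omega g ->
  ae_eq mu Omega f g -> \int[mu]_(x in Omega) f x = \int[mu]_(x in Omega) g x.
Proof.
move=> mf mg fg; rewrite /Rintegral; congr fine; apply: ae_eq_integral => //.
- exact/measurable_EFinP.
- exact/measurable_EFinP.
- by apply: filterS fg => x /= h Ox; rewrite h.
Qed.

Lemma L2_rintM u v : L2 Omega u -> L2 Omega v -> rint (fun x => u x * v x).
Proof.
move=> [mu1 iu] [mv iv]; apply: (rint_le _ (rintD iu iv)); first exact: measurable_funM.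
move=> x _ /=; rewrite normrM -[u x ^+ 2]real_normK ?num_real// -[v x ^+ 2]real_normK ?num_real//.
have := sqr_ge0 (`|u x| - `|v x|); have := mulr_ge0 (normr_ge0 (u x)) (normr_ge0 (v x)); lra.
Qed.

Lemma L2_0 : L2 Omega (0 : 'rV[R]_d -> R).
Proof.
split; first exact: measurable_cst.
have := integrable0 mu Omega; congr (integrable _ _ _); apply/funext => x.
by rewrite /= expr2 mul0r.
Qed.

Lemma L2_lin a u v : L2 Omega u -> L2 Omega v -> L2 Omega (a *: u + v).
Proof.
move=> hu hv; have [mu1 iu] := hu; have [mv iv] := hv; split.
  by apply: measurable_funD => //; apply: measurable_funM => //; exact: measurable_cst.
have -> : (fun x => (((a *: u + v) x) ^+ 2)%:E) =
  EFin \o (fun x => (a ^+ 2) * (u x ^+ 2) + ((2 * a) * (u x * v x) + v x ^+ 2)).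
  by apply/funext => x; rewrite /= -[(_ + _) x]/(a * u x + v x); congr EFin; ring.
apply: rintD; first exact: rintZ.
by apply: rintD => //; apply: rintZ; exact: L2_rintM.
Qed.

Lemma L2_semi_inner : semi_inner (L2 Omega) (L2_dot Omega).
Proof.
split.
- exact: L2_0.
- by move=> *; exact: L2_lin.
- move=> a u v w hu hv hw; rewrite /L2_dot -RintegralZl//; last exact: L2_rintM.
  rewrite -RintegralD//; [|by apply: rintZ; exact: L2_rintM|exact: L2_rintM].
  apply: eq_Rintegral => x _; rewrite -[(_ + _) x]/(a * u x + v x); ring.
- by move=> u v _ _; apply: eq_Rintegral => x _; rewrite mulrC.
- by move=> u _; apply: Rintegral_ge0 => x _; rewrite -expr2 sqr_ge0.
Qed.

Lemma L2_dot_EFin u v : L2 Omega u -> L2 Omega v ->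
  (L2_dot Omega u v)%:E = (\int[mu]_(x in Omega) (u x * v x)%:E)%E.
Proof.
move=> hu hv; rewrite /L2_dot /Rintegral fineK//.
by apply: integrable_fin_num => //; exact: L2_rintM.
Qed.

Lemma ae_eq_L2_dot u u' v v' : L2 Omega u -> L2 Omega u' -> L2 Omega v -> L2 Omega v' ->
  ae_eq mu Omega u u' -> ae_eq mu Omega v v' -> L2_dot Omega u v = L2_dot Omega u' v'.
Proof.
move=> [mu1 _] [mu2 _] [mv1 _] [mv2 _] uu vv; apply: ae_eq_Rintegral.
- exact: measurable_funM.
- exact: measurable_funM.
- by apply: filterS2 uu vv => x h1 h2 Ox /=; rewrite h1// h2.
Qed.

Lemma L2_dot_eq0 u : L2 Omega u -> L2_dot Omega u u = 0 -> ae_eq mu Omega u (cst 0).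
Proof.
move=> hu u0.
have : (\int[mu]_(x in Omega) `|(u x * u x)%:E|)%E = 0%E.
  transitivity (L2_dot Omega u u)%:E; last by rewrite u0.
  rewrite L2_dot_EFin//; apply: eq_integral => x _.
  by rewrite gee0_abs// lee_fin -expr2 sqr_ge0.
have m2 : measurable_fun Omega (fun x => (u x * u x)%:E).
  by apply/measurable_EFinP; have [mu1 _] := hu; exact: measurable_funM.
move/(ae_eq_integral_abs mu mO m2); apply: filterS => x h Ox.
by have /= [] := h Ox; move/eqP; rewrite mulf_eq0 => /orP[]/eqP.
Qed.

Hypothesis Ofin : (mu Omega < +oo)%E.

Lemma rint_cst (c : R) : rint (fun=> c).
Proof.
apply/integrableP; split; first exact: measurable_cst.
under eq_integral do rewrite /=.
rewrite (integral_cst mu mO (`|c|)%:E) //; first by rewrite lte_mul_pinfty.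
Qed.

Lemma L2_bounded u (M : R) : measurable_fun Omega u -> (forall x, Omega x -> `|u x| <= M) -> L2 Omega u.
Proof.
move=> mu1 uM; split => //.
have mu2 : measurable_fun Omega (fun x => u x ^+ 2) by exact: measurable_funX.
apply: (@rint_le (fun x => u x ^+ 2) (fun=> M ^+ 2) mu2).
  exact: rint_cst.
move=> x Ox; rewrite normrX ler_pXn2r// ?nnegrE ?uM//.
exact: le_trans (uM x Ox).
Qed.

Lemma L2_rint u : L2 Omega u -> rint u.
Proof.
move=> hu; have h1 : L2 Omega (fun=> 1) by apply: (L2_bounded (M := 1)) => // x _; rewrite normr1.
have := L2_rintM hu h1; congr (integrable _ _ _).
by apply/funext => x /=; rewrite mulr1.
Qed.

Lemma L2_abs u : L2 Omega u -> L2 Omega (fun x => `|u x|).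
Proof.
move=> [mu1 iu]; split; first exact: measurableT_comp.
by under eq_fun do rewrite real_normK ?num_real//.
Qed.

Lemma Rintegral_abs_sqr_le u : L2 Omega u ->
  (\int[mu]_(x in Omega) `|u x|) ^+ 2 <= fine (mu Omega) * L2_dot Omega u u.
Proof.
move=> hu; have h1 : L2 Omega (fun=> 1) by apply: (L2_bounded (M := 1)) => // x _; rewrite normr1.
have := semi_inner_CS L2_semi_inner h1 (L2_abs hu).
have -> : L2_dot Omega (fun=> 1) (fun x => `|u x|) = \int[mu]_(x in Omega) `|u x|.
  by apply: eq_Rintegral => x _; rewrite mul1r.
have -> : L2_dot Omega (fun=> 1) (fun=> 1) = fine (mu Omega).
  by rewrite /L2_dot Rintegral_cst// !mul1r.
have -> : L2_dot Omega (fun x => `|u x|) (fun x => `|u x|) = L2_dot Omega u u.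
  by apply: eq_Rintegral => x _; rewrite -normrM ger0_norm// -expr2 sqr_ge0.
by [].
Qed.

Lemma limn_einf_le (v : nat -> \bar R) (e : \bar R) : (forall k, v k <= e)%E ->
  (limn_einf v <= e)%E.
Proof.
move=> ve; rewrite limn_einf_lim; apply: lime_le; first exact: is_cvg_einfs.
by apply: nearW => n; apply: le_trans (ve n); apply: ereal_inf_lbound; exists n => /=.
Qed.

(** Riesz--Fischer: a subsequence with summable successive distances converges almost
    everywhere, and Fatou's lemma transfers the Cauchy estimate to its limit. *)
Theorem L2_complete : semi_complete (L2 Omega) (L2_dot Omega).
Proof.
have L2B u v : L2 Omega u -> L2 Omega v -> L2 Omega (u - v) by move=> ? ?; apply: (siB L2_semi_inner).
move=> u_ hu cau.
have /choice[N hN] (k : nat) : exists N, forall m n, (N <= m)%N -> (N <= n)%N ->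
    L2_dot Omega (u_ m - u_ n) (u_ m - u_ n) < (4^-1) ^+ k.
  by apply: cau; rewrite exprn_gt0.
(* Squared distances below 4 ^ -k along s make the L1 distances summable. *)
pose s k := (k + \max_(j < k.+1) N j)%N.
have sN k : (N k <= s k)%N.
  by apply: leq_trans (leq_addl _ _); exact: (leq_bigmax (@ord_max k)).
have sS k : (s k <= s k.+1)%N.
  by apply: leq_add => //; rewrite [X in (_ <= X)%N]big_ord_recr/= leq_maxl.
pose f k := u_ (s k).
have hf k : L2 Omega (f k) by exact: hu.
have mf k : measurable_fun Omega (f k) by case: (hf k).
pose C : R := Num.sqrt (fine (mu Omega)).
have hd k : L2 Omega (f k.+1 - f k) by exact: L2B.
have int_le k : \int[mu]_(x in Omega) `|(f k.+1 - f k) x| <= C * (2^-1) ^+ k.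
  apply: le_of_sqr; first by rewrite mulr_ge0 ?sqrtr_ge0// exprn_ge0.
  apply: le_trans (Rintegral_abs_sqr_le (hd k)) _.
  rewrite exprMn sqr_sqrtr ?fine_ge0// -exprM mulnC exprM ler_wpM2l ?fine_ge0//.
  have -> : (2^-1) ^+ 2 = 4^-1 :> R by field.
  apply/ltW/hN => //; exact: leq_trans (sS k).
pose a k x := (`|(f k.+1 - f k) x|)%:E.
have ma k : measurable_fun Omega (a k).
  by apply/measurable_EFinP; case: (L2_abs (hd k)).
have a0 k x : Omega x -> (0 <= a k x)%E by move=> _; rewrite lee_fin.
pose S (x : 'rV[R]_d) : \bar R := (\sum_(0 <= k <oo) a k x)%E.
have S0 x : (0 <= S x)%E by apply: nneseries_ge0 => k _ _; rewrite lee_fin.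
have mS : measurable_fun Omega S by apply: ge0_emeasurable_sum => // k x Ox _; exact: a0.
have iS : mu.-integrable Omega S.
  apply/integrableP; split => //.
  under eq_integral do rewrite gee0_abs//.
  rewrite integral_nneseries//.
  have C0 : 0 <= C by exact: sqrtr_ge0.
  apply: (@le_lt_trans _ _ (2 * C)%:E); last exact: ltry.
  apply: lime_le; first by apply: is_cvg_nneseries => n _ _; apply: integral_ge0 => x; exact: a0.
  apply: nearW => n.
  apply: (@le_trans _ _ (2 * C - 2 * C * (2^-1) ^+ n)%:E); last first.
    by rewrite lee_fin lerBlDr lerDl !mulr_ge0// exprn_ge0.
  elim: n => [|n IH]; first by rewrite big_geq// expr0 mulr1 subrr.
  rewrite big_nat_recr//=; apply: (@le_trans _ _ ((2 * C - 2 * C * 2^-1 ^+ n)%:E + (C * 2^-1 ^+ n)%:E)).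
    apply: leeD => //; rewrite /a -(@fineK _ (\int[mu]_(x in Omega) _)%E) ?lee_fin; first exact: int_le.
    apply: integrable_fin_num => //; exact: (L2_rint (L2_abs (hd n))).
  by rewrite -EFinD lee_fin exprS; lra.
(* The successive distances have a finite sum on T, where f therefore converges. *)
pose T := Omega `&` [set x | S x < +oo]%E.
have mT : measurable T by exact: emeasurable_fun_infty_o.
pose h k : 'rV[R]_d -> R := (f k : 'rV[R]_d -> R) \_ T.
have TO : T `<=` Omega by move=> x [].
have mh k : measurable_fun Omega (h k).
  apply/(measurable_restrict (f k) mT mO).
  by rewrite setIidr//; exact: measurable_funS (mf k).
have h_cvg x : Omega x -> cvgn (h ^~ x).
  move=> Ox; have [xT|xT] := boolP (x \in T); last first.
    have -> : h ^~ x = fun=> 0 by apply/funext => k; rewrite /h /patch (negbTE xT).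
    exact: is_cvg_cst.
  have -> : h ^~ x = f ^~ x by apply/funext => k; rewrite /h /patch xT.
  move: xT; rewrite inE => -[_ /= Sx].
  have : cvgn (series (fun k => (f k.+1 - f k) x)).
    apply: normed_cvg; apply: nondecreasing_is_cvgn.
      by apply: nondecreasing_series => n _ _; exact: normr_ge0.
    exists (fine (S x)) => _ [n _ <-] /=.
    rewrite -lee_fin fineK ?ge0_fin_numE// /series/= -sumEFin.
    by apply: (nneseries_lim_ge (u_ := a ^~ x)) => k _ _; rewrite lee_fin.
  have -> : series (fun k => (f k.+1 - f k) x) = (fun n => f n x - f 0%N x).
    by apply/funext => n; rewrite /series/= (telescope_sumr (fun k => f k x)).
  move=> /cvg_ex[l hl]; apply/cvg_ex; exists (l + f 0%N x).
  have -> : (f ^~ x) = (fun n => f n x - f 0%N x + f 0%N x).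
    by apply/funext => n; rewrite subrK.
  by apply: cvgD => //; exact: cvg_cst.
pose g x := limn (h ^~ x).
have hg x : Omega x -> h k x @[k --> \oo] --> g x by move/h_cvg.
have mg : measurable_fun Omega g by exact: (measurable_fun_cvg mh).
have aeT k : ae_eq mu Omega (h k) (f k).
  have := integrable_ae mO iS; apply: filterS => x /= Sx Ox; rewrite /h /patch ifT// inE.
  by split => //=; rewrite -ge0_fin_numE// Sx.
have key (e : R) : 0 < e -> exists M, forall n, (M <= n)%N ->
    (\int[mu]_(x in Omega) ((u_ n x - g x) ^+ 2)%:E <= e%:E)%E.
  move=> e0; have [M hM] := cau _ e0; exists M => n Mn.
  have mun : measurable_fun Omega (u_ n) by case: (hu n).
  pose F k x := ((u_ n x - h (k + M)%N x) ^+ 2)%:E.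
  have mF k : measurable_fun Omega (F k).
    by apply/measurable_EFinP; apply: measurable_funX; exact: measurable_funB.
  have F0 k x : Omega x -> (0 <= F k x)%E by move=> _; rewrite lee_fin sqr_ge0.
  apply: (@le_trans _ _ (\int[mu]_(x in Omega) limn_einf (F ^~ x))%E).
    rewrite le_eqVlt; apply/orP; left; apply/eqP; apply: eq_integral => x; rewrite inE => Ox.
    have : F k x @[k --> \oo] --> ((u_ n x - g x) ^+ 2)%:E.
      apply: cvg_EFin; first exact: nearW.
      have c1 : (u_ n x - h (k + M)%N x) @[k --> \oo] --> u_ n x - g x.
        apply: cvgB; first exact: cvg_cst.
        by have := hg _ Ox; rewrite -(cvg_shiftn M).
      by rewrite /F/=; under eq_fun do rewrite /= expr2; rewrite expr2; exact: cvgM.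
    by move=> /cvg_limn_einf_sup[-> _].
  apply: le_trans (fatou mu mO mF F0) _; apply: limn_einf_le => k.
  have -> : (\int[mu]_(x in Omega) F k x = (L2_dot Omega (u_ n - f (k + M)%N) (u_ n - f (k + M)%N))%:E)%E.
    have hnk := L2B _ _ (hu n) (hf (k + M)%N).
    rewrite L2_dot_EFin//; apply: ae_eq_integral => //.
      by apply/measurable_EFinP; apply: measurable_funM; case: hnk.
    by apply: filterS (aeT (k + M)%N) => x h1 Ox; rewrite /F h1//.
  rewrite lee_fin; apply/ltW/hM => //.
  by rewrite /s addnAC leq_addl.
have L2ng n e : (\int[mu]_(x in Omega) ((u_ n x - g x) ^+ 2)%:E <= e%:E)%E -> L2 Omega (u_ n - g).
  move=> h1; have mun : measurable_fun Omega (u_ n) by case: (hu n).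
  have mn : measurable_fun Omega (u_ n - g) by exact: measurable_funB.
  split => //; apply/integrableP; split.
    by apply/measurable_EFinP; exact: measurable_funX.
  apply: le_lt_trans (ltry e); apply: le_trans h1.
  by under eq_integral do rewrite gee0_abs ?lee_fin ?sqr_ge0//.
have Lg : L2 Omega g.
  have [M hM] := key 1 ltr01.
  have -> : g = u_ M - (u_ M - g) by rewrite opprB addrC subrK.
  by apply: L2B => //; exact: L2ng (hM _ (leqnn M)).
exists g => // e e0; have [M hM] := key (e / 2) (divr_gt0 e0 (ltr0n _ 2)).
exists M => n Mn; have h1 := hM n Mn.
have h2 : L2_dot Omega (u_ n - g) (u_ n - g) <= e / 2.
  by rewrite -lee_fin L2_dot_EFin//; exact: L2ng h1.
by apply: le_lt_trans h2 _; lra.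
Qed.

End L2_space.

(** * Bump functions *)

Section expinv.
Context {R : realType}.
Implicit Types x : R.

(** Up to linear combinations, this family is stable under differentiation, and it contains
    the standard smooth function [exp (- 1 / x)]. *)
Definition expinv (k : nat) x : R := if 0 < x then x ^- k * expR (- x^-1) else 0.

Lemma expinv_ge0 k x : 0 <= expinv k x.
Proof.
by rewrite /expinv; case: ifP => // x0; rewrite mulr_ge0 ?expR_ge0// invr_ge0 exprn_ge0// ltW.
Qed.

Lemma expinv0_le1 x : expinv 0 x <= 1.
Proof.
rewrite /expinv; case: ifP => // x0; rewrite expr0 invr1 mul1r.
by rewrite -[leRHS]expR0 ler_expR oppr_le0 invr_ge0 ltW.
Qed.

(** The exponential dominates every power, so all the [expinv k] are flat at 0. *)
Lemma expinv_flat k x : expinv k x <= (k.+2)`!%:R * x ^+ 2.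
Proof.
rewrite /expinv; case: ifP => [x0|_]; last by rewrite mulr_ge0// sqr_ge0.
have y0 : 0 < x^-1 by rewrite invr_gt0.
have := expR_ge1Dxn k.+1 (ltW y0).
have f0 : 0 < (k.+2)`!%:R :> R by rewrite ltr0n fact_gt0.
move=> h; have {}h : x^-1 ^+ k.+2 <= (k.+2)`!%:R * expR x^-1.
  by rewrite mulrC -ler_pdivrMr//; apply: le_trans h; rewrite lerDr.
rewrite expRN ler_pdivrMr ?expR_gt0//.
rewrite -[leRHS]mulrA [_ ^+ 2 * _]mulrC mulrA -ler_pdivrMr ?exprn_gt0//.
by apply: le_trans h; rewrite -exprVn -exprVn -exprD addn2.
Qed.

Lemma is_derive_of_cvg (V W : normedModType R) (f : V -> W) (a v : V) (df : W) :
  (h^-1 *: (f (h *: v + a) - f a) @[h --> (0:R)^'] --> df) -> is_derive a v f df.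
Proof.
move=> h; split; first by apply/cvg_ex; exists df.
exact: cvg_lim h.
Qed.

Lemma is_derive_expinv k x :
  is_derive x 1 (expinv k) (expinv k.+2 x - k%:R * expinv k.+1 x).
Proof.
have [x0|x0|->] := ltgtP x 0.
- have e : {near x, cst 0 =1 expinv k}.
    near=> y; rewrite /expinv ifF//; apply/negbTE; rewrite -leNgt ltW//.
    by near: y; exact: lt_nbhsl.
  have -> : expinv k.+2 x - k%:R * expinv k.+1 x = 0.
    by rewrite /expinv ltNge (ltW x0)/= mulr0 subrr.
  by apply: (near_eq_is_derive e); exact: is_derive_cst.
- have e : {near x, (fun y => (y ^+ k)^-1 * expR (- y^-1)) =1 expinv k}.
    near=> y; rewrite /expinv ifT//; near: y; exact: lt_nbhsr.
  apply: (near_eq_is_derive e).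
  have xn0 : x != 0 by rewrite gt_eqF.
  have xk0 : x ^+ k != 0 by rewrite expf_neq0.
  rewrite /expinv x0.
  have h1 : is_derive x 1 (fun y : R => (y ^+ k)^-1) (- (x ^+ k) ^- 2 *: ((k%:R * x ^+ k.-1) *: 1)).
    apply: is_deriveV => //.
    have -> : (fun y : R => y ^+ k) = (id : R -> R) ^+ k.
      by apply/funext => y; elim: (k) => // m IH; rewrite !exprS -[RHS]/(y * ((id : R -> R) ^+ m) y) -IH.
    exact: is_deriveX.
  have h2 : is_derive x 1 (fun y : R => y^-1) (- x ^- 2 *: 1) by exact: is_deriveV.
  have h3 := is_deriveN h2.
  have h4 := is_derive1_comp (is_derive_expR _) h3.
  have := is_deriveM h1 h4.
  rewrite /= => h5; apply: (is_derive_eq h5).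
  have mE (a b : R) : a *: b = a * b by [].
  rewrite !mE !mulr1; case: k e xk0 h1 h5 => [|k] _ xk0 _ _ /=.
    by rewrite !mul0r !expr0 -[(- [eta GRing.inv]) x]/(- x^-1); field.
  have pk0 : x ^+ k != 0 by rewrite expf_neq0.
  rewrite -[(- [eta GRing.inv]) x]/(- x^-1) !exprS.
  by move: (expR (- x^-1)) (x ^+ k) pk0 (k.+1%:R : R) => E p p0 q; field; rewrite p0.
- rewrite /expinv ltxx mulr0 subrr; apply: is_derive_of_cvg.
  apply/cvgr0Pnorm_lt => e e0.
  have f0 : 0 < (k.+2)`!%:R :> R by rewrite ltr0n fact_gt0.
  near=> h; have hn0 : h != 0 by near: h; exact: nbhs_dnbhs_neq.
  rewrite ltxx subr0 addr0 -/(expinv k (h *: 1)) -[h *: 1]/(h * 1) mulr1.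
  rewrite -[_ *: _]/(h^-1 * expinv k h) normrM normfV.
  rewrite ltr_pdivrMl ?normr_gt0//.
  rewrite (ger0_norm (expinv_ge0 _ _)).
  apply: le_lt_trans (expinv_flat _ _) _.
  rewrite -[h ^+ 2]real_normK ?num_real// expr2 mulrA mulrC ltr_pM2l ?normr_gt0//.
  rewrite mulrC -ltr_pdivlMr//; near: h.
  apply: dnbhs0_lt; exact: divr_gt0.
Unshelve. all: by end_near. Qed.

End expinv.

Section bump1.
Context {R : realType} (a b : R).

(** A class of functions vanishing off [a, b] that differentiation preserves. *)
Inductive bump1 (n : R) : (R -> R) -> Prop :=
| bump1_base k l : bump1 n (fun x => expinv k (n * (x - a)) * expinv l (n * (b - x)))
| bump1_lin c g h : bump1 n g -> bump1 n h -> bump1 n (fun x => c * g x + h x).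

Lemma is_derive_affine (n c x : R) : is_derive x 1 (fun y : R => n * y + c) n.
Proof.
have h := is_deriveD (is_deriveZ n (is_derive_id x (1:R))) (is_derive_cst c x 1).
by apply: (is_derive_eq h); rewrite addr0 -[_ *: _]/(n * 1) mulr1.
Qed.

Lemma bump1_derive n (g : R -> R) : bump1 n g -> exists2 g' : R -> R, bump1 n g' &
  forall x : R, is_derive x 1 g (g' x).
Proof.
elim=> [k l|c {}g h _ [g' bg' dg] _ [h' bh' dh]]; last first.
  exists (fun x => c * g' x + h' x); first exact: bump1_lin.
  move=> x; exact: is_deriveD (is_deriveZ c (dg x)) (dh x).
pose f k l x := expinv k (n * (x - a)) * expinv l (n * (b - x)).
pose z : R -> R := fun x => 0 * f 0%N 0%N x + (0 * f 0%N 0%N x + f 0%N 0%N x).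
exists (fun x => n * f k.+2 l x + ((- (k%:R * n)) * f k.+1 l x +
  ((- n) * f k l.+2 x + ((l%:R * n - 1) * f k l.+1 x + f k l.+1 x)))).
  by do 4 (apply: bump1_lin; first exact: bump1_base); exact: bump1_base.
move=> x.
have h1 := is_derive1_comp (is_derive_expinv k _) (is_derive_affine n (- (n * a)) x).
have h2 := is_derive1_comp (is_derive_expinv l _) (is_derive_affine (- n) (n * b) x).
have := is_deriveM h1 h2.
have -> : (expinv k \o (fun y => n * y - n * a)) * (expinv l \o (fun y => - n * y + n * b)) =
  (fun x => expinv k (n * (x - a)) * expinv l (n * (b - x))).
  apply/funext => y; rewrite -[LHS]/(expinv k (n * y - n * a) * expinv l (- n * y + n * b)).
  by congr (expinv _ _ * expinv _ _); ring.
move=> h; apply: (is_derive_eq h); rewrite /= /f.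
have -> : n * x - n * a = n * (x - a) by ring.
have -> : - n * x + n * b = n * (b - x) by ring.
rewrite -![_ *: _]/(_ * _); ring.
Qed.

Lemma bump1_supp n (g : R -> R) : 0 < n -> bump1 n g -> forall x : R, ~~ (a < x < b) -> g x = 0.
Proof.
move=> n0; elim=> [k l|c {}g h _ hg _ hh] x xab; last by rewrite hg// hh// mulr0 addr0.
rewrite /expinv !pmulr_rgt0// !subr_gt0.
by case: ifP xab => ax; case: ifP => xb; rewrite ?ax ?xb//= ?mulr0 ?mul0r.
Qed.

End bump1.

Section line.
Context {R : realType} (V W : normedModType R).

Lemma is_derive_line (f : V -> W) (x v : V) (t : R) (df : W) :
  is_derive t 1 (fun s : R => f (x + s *: v)) df <-> is_derive (x + t *: v) v f df.
Proof.
have E : (fun h : R => h^-1 *: (((fun s : R => f (x + s *: v)) \o shift t) (h *: 1) - f (x + t *: v)))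
  = (fun h : R => h^-1 *: ((f \o shift (x + t *: v)) (h *: v) - f (x + t *: v))).
  apply/funext => h /=; congr (_ *: (f _ - _)).
  by rewrite -[h *: 1]/(h * 1) mulr1 scalerDl addrCA.
split=> -[d1 d2]; split.
- by rewrite /derivable -E.
- by rewrite /derive -E.
- by rewrite /derivable E.
- by rewrite /derive E.
Qed.

End line.

Lemma continuous_prod (R : realType) (T : topologicalType) (I : Type) (r : seq I) (F : I -> T -> R) :
  (forall i, continuous (F i)) -> continuous (fun x => \prod_(i <- r) F i x).
Proof.
move=> cF; elim: r => [|i r IH].
  by under eq_fun do rewrite big_nil; move=> x; exact: cvg_cst.
under eq_fun do rewrite big_cons; move=> x; apply: cvgM; [exact: cF|exact: IH].
Qed.

Lemma cvg_prod (R : realType) (I : Type) (r : seq I) (F : I -> nat -> R) (l : I -> R) :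
  (forall i, F i @ \oo --> l i) -> \prod_(i <- r) F i k @[k --> \oo] --> \prod_(i <- r) l i.
Proof.
move=> cF; elim: r => [|i r IH].
  by rewrite big_nil; under eq_fun do rewrite big_nil; exact: cvg_cst.
by rewrite big_cons; under eq_fun do rewrite big_cons; apply: cvgM; [exact: cF|exact: IH].
Qed.

Section bump.
Context {R : realType} (d : nat) (a b : 'I_d -> R).
Notation e_ i := (delta_mx ord0 i : 'rV[R]_d).

Lemma compact_cbox : compact (cbox a b).
Proof. by apply: (@rV_compact R d (fun i => `[(a i), (b i)]%classic)) => i; exact: segment_compact. Qed.

Lemma closed_cbox : closed (cbox a b).
Proof. by apply: compact_closed; [exact: norm_hausdorff|exact: compact_cbox]. Qed.

Definition tensor_bump (n : R) (phi : 'rV[R]_d -> R) := exists2 h : 'I_d -> R -> R,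
  (forall i, bump1 (a i) (b i) n (h i)) & phi = (fun x => \prod_i h i (x ord0 i)).

Lemma is_derive_tensor (h h' : 'I_d -> R -> R) (x : 'rV[R]_d) (i : 'I_d) :
  (forall j (y : R), is_derive y 1 (h j) (h' j y)) ->
  is_derive x (e_ i) (fun x => \prod_j h j (x ord0 j))
    (\prod_j (if j == i then h' i else h j) (x ord0 j)).
Proof.
pose F (x : 'rV[R]_d) : R := \prod_j h j (x ord0 j).
move=> dh; have := (is_derive_line F x (e_ i) 0
  (\prod_j (if j == i then h' i else h j) (x ord0 j))).
rewrite scale0r addr0 /F => -[+ _]; apply.
pose C := \prod_(j | j != i) h j (x ord0 j).
have -> : (fun s : R => \prod_j h j ((x + s *: e_ i) ord0 j)) =
    (fun s : R => C * h i (1 * s + x ord0 i) + 0).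
  apply/funext => s; rewrite (bigD1 i)//= addr0 mulrC; congr (_ * h i _).
    by apply: eq_bigr => j ji; rewrite !mxE eqxx/= (negbTE ji) mulr0 addr0.
  by rewrite !mxE !eqxx/=; ring.
have -> : \prod_j (if j == i then h' i else h j) (x ord0 j) = C * h' i (x ord0 i).
  rewrite (bigD1 i)//= eqxx mulrC; congr (_ * _).
  by apply: eq_bigr => j ji; rewrite (negbTE ji).
have h1 := is_derive1_comp (dh i _) (is_derive_affine 1 (x ord0 i) 0).
have := is_deriveD (is_deriveZ C h1) (is_derive_cst (0:R) (0:R) (1:R)).
move=> h2; apply: (is_derive_eq h2).
by rewrite mulr1 addr0 mulr0 add0r.
Qed.

Lemma bump1_continuous a' b' n (h : R -> R) : bump1 a' b' n h -> continuous h.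
Proof.
move=> /bump1_derive[h' _ dh] y; apply: differentiable_continuous.
by apply/derivable1_diffP; case: (dh y).
Qed.

Lemma tensor_bump_continuous n phi : tensor_bump n phi -> continuous phi.
Proof.
move=> [h bh ->]; apply: continuous_prod => i x.
by apply: continuous_comp; [exact: coord_continuous|exact: bump1_continuous (bh i) _].
Qed.

Lemma tensor_bump_partial n phi i : tensor_bump n phi ->
  (forall x, derivable phi x (e_ i)) /\ tensor_bump n (partial i phi).
Proof.
move=> [h bh ->].
have /choice[h' h'P] j : exists h' : R -> R, bump1 (a j) (b j) n h' /\
    forall y : R, is_derive y 1 (h j) (h' y).
  by have [h' ? ?] := bump1_derive (bh j); exists h'.
have dh j : forall y : R, is_derive y 1 (h j) (h' j y) by case: (h'P j).
have D x := is_derive_tensor x i dh.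
split; first by move=> x; case: (D x).
exists (fun j => if j == i then h' i else h j).
  by move=> j; case: eqP => [->|_]; [case: (h'P i)|exact: bh].
by apply/funext => x; rewrite /partial; apply: derive_val.
Qed.

Lemma tensor_bump_test (Omega : set 'rV[R]_d) n phi : 0 < n -> cbox a b `<=` Omega ->
  tensor_bump n phi -> test_function Omega phi.
Proof.
move=> n0 BO bphi.
have sub : closure [set x | phi x != 0] `<=` cbox a b.
  rewrite [X in _ `<=` X](closure_id (cbox a b)).1; last exact: closed_cbox.
  apply: closure_subset => x /=; have [h bh ->] := bphi => xn0 i /=; rewrite in_itv/=.
  apply/negPn/negP => nx; move/negP: xn0; apply; apply/eqP; rewrite (bigD1 i)//=.
  rewrite (bump1_supp n0 (bh i)) ?mul0r//; apply: contra nx => /andP[? ?].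
  by rewrite !ltW.
split.
- have {}bphi s : tensor_bump n (foldr (@partial R d) phi s).
    by elim: s => //= i s IH; case: (tensor_bump_partial i IH).
  move=> s /=; split; first exact: tensor_bump_continuous (bphi s).
  by move=> i; case: (tensor_bump_partial i (bphi s)).
- by apply: subclosed_compact sub; [exact: closed_closure|exact: compact_cbox].
- exact: subset_trans sub BO.
Qed.

(** As [k] grows, the bump converges to the indicator of the open box. *)
Definition bump (k : nat) : 'rV[R]_d -> R := fun x =>
  \prod_i (expinv 0 (k.+1%:R * (x ord0 i - a i)) * expinv 0 (k.+1%:R * (b i - x ord0 i))).

Lemma bump_tensor k : tensor_bump k.+1%:R (bump k).
Proof.
exists (fun i x => expinv 0 (k.+1%:R * (x - a i)) * expinv 0 (k.+1%:R * (b i - x))) => // i.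
exact: bump1_base.
Qed.

Lemma bump_ge0 k x : 0 <= bump k x.
Proof. by apply: prodr_ge0 => i _; rewrite mulr_ge0// expinv_ge0. Qed.

Lemma bump_le1 k x : bump k x <= 1.
Proof.
by apply: prodr_ile1 => i _; rewrite mulr_ge0 ?expinv_ge0//= mulr_ile1 ?expinv_ge0 ?expinv0_le1.
Qed.

Lemma expinv0_cvg1 (y : R) : 0 < y -> expinv 0 (k.+1%:R * y) @[k --> \oo] --> (1:R).
Proof.
move=> y0; have -> : (fun k : nat => expinv 0 (k.+1%:R * y)) =
    (fun k => expR ((- y^-1) * k.+1%:R^-1)).
  apply/funext => k; rewrite /expinv mulr_gt0// expr0 invr1 mul1r invfM.
  by congr expR; ring.
apply: (cvg_to_eq (@expR0 R)); apply: continuous_cvg; first exact: continuous_expR.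
by apply: (cvg_to_eq (mulr0 (- y^-1))); apply: cvgMr; exact: cvg_harmonic.
Qed.

Lemma bump_cvg x : bump k x @[k --> \oo] --> (\1_(obox a b) x : R).
Proof.
have [xB|xB] := boolP (x \in obox a b).
  rewrite indicE xB /=; have -> : true%:R = \prod_(i < d) (1 * 1) :> R.
    by rewrite big1// => i _; rewrite mulr1.
  apply: cvg_prod => i; move: xB; rewrite inE => /(_ i); rewrite /= in_itv/= => /andP[? ?].
  by apply: cvgM; apply: expinv0_cvg1; rewrite subr_gt0.
rewrite indicE (negbTE xB)/=; have -> : bump ^~ x = fun=> 0; last exact: cvg_cst.
apply/funext => k; apply/eqP/negPn/negP => kn0; move/negP: xB; apply; rewrite inE => i /=.
rewrite in_itv/=; apply/negPn/negP => nx; move/negP: kn0; apply; apply/eqP.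
rewrite /bump (bigD1 i)//= (bump1_supp (n := k.+1%:R) (a := a i) (b := b i) _ (bump1_base _ _ _ 0 0))//.
by rewrite mul0r.
Qed.

End bump.

(** ** The fundamental lemma of the calculus of variations *)

Section fundamental.
Context (R : realType) (d : nat) (Omega : set 'rV[R]_d).
Hypothesis oO : open Omega.
Hypothesis Ofin : (lebesgue_rV R d Omega < +oo)%E.
Notation mu := (lebesgue_rV R d).
Let mO : measurable Omega := open_measurable_rV oO.

Lemma test_function_measurable (phi : 'rV[R]_d -> R) : test_function Omega phi ->
  measurable_fun setT phi.
Proof. by move=> [sm _ _]; apply: continuous_measurable_rV; case: (sm [::]). Qed.

Context (g : 'rV[R]_d -> R) (hg : L2 Omega g).
Hypothesis g0 : forall phi, test_function Omega phi -> L2_dot Omega g phi = 0.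

Let ig : mu.-integrable Omega (EFin \o g).
Proof. exact: L2_rint. Qed.

Lemma integral_obox_eq0 a b : cbox a b `<=` Omega ->
  (\int[mu]_(x in obox a b) (g x)%:E = 0)%E.
Proof.
move=> BO.
have tb k : test_function Omega (bump a b k).
  by apply: tensor_bump_test BO (bump_tensor a b k).
have mg : measurable_fun Omega g by case: hg.
have bO : obox a b `<=` Omega by apply: subset_trans BO; exact: obox_sub_cbox.
have mb k : measurable_fun Omega (bump a b k).
  exact: measurable_funS (test_function_measurable (tb k)).
have ibk k : L2 Omega (bump a b k).
  apply: (L2_bounded mO Ofin (M := 1)) => // x _.
  by rewrite ger0_norm ?bump_le1// bump_ge0.
have := @dominated_cvg _ _ _ mu Omega mO (fun k x => (g x * bump a b k x)%:E)
  (fun x => (g x * \1_(obox a b) x)%:E) (fun x => `|g x|%:E).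
have -> : (\int[mu]_(x in Omega) (g x * \1_(obox a b) x)%:E = \int[mu]_(x in obox a b) (g x)%:E)%E.
  rewrite -[in RHS](setIidr bO) integral_mkcondr; apply: eq_integral => x _.
  rewrite /patch indicE; case: ifP => /= _; by rewrite ?mulr1 ?mulr0.
have z k : (\int[mu]_(x in Omega) (g x * bump a b k x)%:E = 0)%E.
  by rewrite -(L2_dot_EFin mO hg (ibk _)) g0.
move=> h; have {h} := h _ _ _ _ _.
have -> : (fun k : nat => \int[mu]_(x in Omega) (g x * bump a b k x)%:E)%E = fun=> 0%E.
  by apply/funext => k; exact: z.
move=> h; apply/esym/(cvg_unique _ (cvg_cst _) (h _ _ _ _ _)) => //.
- by move=> k; apply/measurable_EFinP; exact: measurable_funM.
- move=> x Ox; apply: cvg_EFin; first exact: nearW.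
  by apply: cvgMr; exact: bump_cvg.
- by have := integrable_abse ig.
- by move=> k x Ox; rewrite lee_fin normrM ler_piMr// ger0_norm ?bump_le1// bump_ge0.
Qed.

Lemma obox_setI (a b a' b' : 'I_d -> R) :
  obox a b `&` obox a' b' = obox (fun i => Num.max (a i) (a' i)) (fun i => Num.min (b i) (b' i)).
Proof.
apply/seteqP; split => [x [h h'] i|x h].
  have := h i; have := h' i; rewrite /= !in_itv/= => /andP[? ?] /andP[? ?].
  by rewrite gt_max lt_min; do 2 (apply/andP; split => //); apply/andP; split.
split=> i; have := h i; rewrite /= !in_itv/= gt_max lt_min => /andP[/andP[? ?] /andP[? ?]];
  by apply/andP; split.
Qed.

(** Dynkin's lemma, the boxes being stable under intersection. *)
Lemma integral_setI_obox_eq0 a b E : cbox a b `<=` Omega -> measurable E ->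
  (\int[mu]_(x in E `&` obox a b) (g x)%:E = 0)%E.
Proof.
move=> BO mE.
have bO : obox a b `<=` Omega by apply: subset_trans BO; exact: obox_sub_cbox.
have mB := measurable_obox a b.
have iS S : measurable S -> S `<=` Omega -> mu.-integrable S (EFin \o g).
  by move=> mS SO; exact: integrableS ig.
apply: (@dynkin_induction _ _ (@oboxes R d)
  (fun E => (\int[mu]_(x in E `&` obox a b) (g x)%:E = 0)%E) (@measurable_rVE R d)).
- by move=> _ _ [a1 [b1 ->]] [a2 [b2 ->]]; rewrite obox_setI; do 2 eexists.
- by rewrite setTI integral_obox_eq0.
- move=> _ [a1 [b1 ->]]; rewrite obox_setI; apply: integral_obox_eq0.
  apply: subset_trans BO => x h i; have := h i; rewrite /= !in_itv/=.
  by rewrite ge_max le_min => /andP[/andP[? ?] /andP[? ?]]; apply/andP; split.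
- move=> S mS S0; have := integral_obox_eq0 BO.
  rewrite -{1}(setTI (obox a b)) -(setvU S) setIUl integral_setU//.
  + by rewrite S0 adde0.
  + by apply: measurableI => //; exact: measurableC.
  + exact: measurableI.
  + have h : ~` S `&` obox a b `|` S `&` obox a b `<=` Omega.
      by rewrite -setIUl; apply: subIset; right.
    by apply: measurable_funS mO h _; apply/measurable_EFinP; case: hg.
  + by apply/disj_setPS => x [[? ?] [? ?]].
- move=> F mF tF F0; rewrite setI_bigcupl integral_bigcup.
  + by rewrite eseries0// => i _ _; exact: F0.
  + apply/trivIsetP => i j _ _ ij; rewrite setIACA setIid.
    by move/trivIsetP: tF => ->//; rewrite set0I.
  + by move=> k; exact: measurableI.
  + apply: iS; first by apply: bigcupT_measurable => k; exact: measurableI.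
    by apply: bigcup_sub => k _; apply: subIset; right.
- by rewrite -measurable_rVE.
Qed.

(** Bumps approximate indicators of boxes, so [g] has zero integral over every box contained
    in [Omega], then over every measurable part of it, and countably many boxes cover
    [Omega]. *)
Theorem fundamental_lemma : ae_eq mu Omega g (cst 0).
Proof.
have box p : cbox (rat_lo p) (rat_hi p) `<=` Omega ->
    ae_eq mu (@obox R d (rat_lo p) (rat_hi p)) g (cst 0).
  move=> BO; have mB := measurable_obox (@rat_lo R d p) (rat_hi p).
  have bO : obox (rat_lo p) (rat_hi p) `<=` Omega.
    by apply: subset_trans BO; exact: obox_sub_cbox.
  have iB : mu.-integrable (obox (rat_lo p) (rat_hi p)) (EFin \o g) by exact: integrableS ig.
  have := integral_ae_eq mB iB (measurable_cst 0%E).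
  move=> h; have {}h : ae_eq mu (obox (rat_lo p) (rat_hi p)) (EFin \o g) (cst 0%E).
    apply: h => E EB mE; rewrite integral0.
    by rewrite -(setIidl EB); exact: integral_setI_obox_eq0.
  by apply: filterS h => x h /h [].
have all : {ae mu, forall x, forall k p, unpickle k = Some p -> cbox (rat_lo p) (rat_hi p) `<=` Omega ->
    obox (rat_lo p) (rat_hi p) x -> g x = 0}.
  apply: ae_foralln => k; case: unpickle => [p|]; last first.
    by apply: aeW => x p; discriminate.
  have [/box h|nh] := pselect (cbox (rat_lo p) (rat_hi p) `<=` Omega); last first.
    by apply: aeW => x _ [<-].
  by apply: filterS h => x /= h _ [<-].
apply: filterS all => x h Ox; have [p [Bx BO]] := open_rat_box oO Ox.
exact: (h _ _ (pickleK p) BO Bx).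
Qed.

End fundamental.

(** * Test functions *)

Section test_functions.
Context (R : realType) (d : nat) (Omega : set 'rV[R]_d).
Notation e_ i := (delta_mx ord0 i : 'rV[R]_d).
Notation mu := (lebesgue_rV R d).
Implicit Types (phi psi : 'rV[R]_d -> R).

Lemma smooth_foldr_lin a phi psi s : smooth phi -> smooth psi ->
  foldr (@partial R d) (a *: phi + psi) s =
  a *: foldr (@partial R d) phi s + foldr (@partial R d) psi s.
Proof.
move=> sp sq; elim: s => //= i s ->; apply/funext => x; rewrite /partial.
have [_ dp] := sp s; have [_ dq] := sq s.
rewrite deriveD//; last exact: derivableZ.
by rewrite deriveZ.
Qed.

Lemma test_function_lin a phi psi : test_function Omega phi -> test_function Omega psi ->
  test_function Omega (a *: phi + psi).
Proof.
move=> [sp cp pO] [sq cq qO].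
have sub : closure [set x | (a *: phi + psi) x != 0] `<=`
    closure [set x | phi x != 0] `|` closure [set x | psi x != 0].
  rewrite -closureU; apply: closure_subset => x /=.
  apply: contraPP => /not_orP[/negP/negPn/eqP h1 /negP/negPn/eqP h2].
  by rewrite -[(_ + _) x]/(a * phi x + psi x) h1 h2 mulr0 addr0 eqxx.
split.
- move=> s /=; rewrite smooth_foldr_lin//; have [cs ds] := sp s; have [cs' ds'] := sq s.
  split=> [x|i x]; first exact: (cvgD (cvgM (cvg_cst a) (cs x)) (cs' x)).
  by apply: derivableD => //; exact: derivableZ.
- apply: subclosed_compact sub; first exact: closed_closure.
  exact: compactU.
- by apply: subset_trans sub _ => x [/pO|/qO].
Qed.

Lemma test_function0 : test_function Omega (0 : 'rV[R]_d -> R).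
Proof.
have sub0 : closure [set x | (0 : 'rV[R]_d -> R) x != 0] = set0.
  rewrite (_ : mkset _ = set0) ?closure0//.
  by apply/seteqP; split => // x /=; rewrite eqxx.
split; rewrite /= ?sub0 //; last exact: compact0.
have foldr0 s : foldr (@partial R d) 0 s = 0.
  by elim: s => //= i s ->; apply/funext => x; rewrite /partial derive_cst.
move=> s /=; rewrite foldr0; split; first exact: (@cst_continuous _ _ (0 : R)).
by move=> i x; exact: derivable_cst.
Qed.

Lemma test_function_continuous phi : test_function Omega phi -> continuous phi.
Proof. by move=> [sp _ _]; case: (sp [::]). Qed.

Lemma test_function_derive i phi : test_function Omega phi ->
  forall x, is_derive x (e_ i) phi (partial i phi x).
Proof. by move=> [sp _ _] x; split=> //; case: (sp [::]) => _; exact. Qed.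

Lemma test_function_partial i phi : test_function Omega phi -> test_function Omega (partial i phi).
Proof.
move=> tp; have [sp cp pO] := tp.
have sub : closure [set x | partial i phi x != 0] `<=` closure [set x | phi x != 0].
  rewrite [X in _ `<=` X](closure_id _).1; last exact: closed_closure.
  apply: closure_subset => x /=; apply: contraPP => nx.
  have /= /filterS : nbhs x (~` closure [set x | phi x != 0]).
    by apply: open_nbhs_nbhs; split => //; apply/closed_openC/closed_closure.
  move=> h; apply/negP; rewrite negbK; apply/eqP; rewrite /partial.
  have e : {near x, cst 0 =1 phi}.
    apply: h => y /= ny; apply/esym/eqP/negPn/negP => py; apply: ny.
    exact: subset_closure.
  by apply: derive_val; apply: (near_eq_is_derive e); exact: is_derive_cst.
split.
- by move=> s; have := sp (rcons s i); rewrite foldr_rcons.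
- by apply: subclosed_compact sub => //; exact: closed_closure.
- exact: subset_trans sub pO.
Qed.

Lemma test_function_out phi x : test_function Omega phi -> ~ Omega x -> phi x = 0.
Proof.
move=> [_ _ pO] nx; apply/eqP/negPn/negP => p0; apply: nx; apply: pO.
exact: subset_closure.
Qed.

Lemma test_function_bounded phi : test_function Omega phi ->
  exists2 M : R, 0 <= M & forall x, `|phi x| <= M.
Proof.
move=> tp; have [sp cp pO] := tp; have cont := test_function_continuous tp.
have := @continuous_compact _ _ (fun x => `|phi x|) _ _ cp.
move=> /(_ _)/compact_bounded[].
  apply: continuous_subspaceT => x; apply: continuous_comp; [exact: cont|exact: norm_continuous].
move=> M [Mr hM]; exists (`|M| + 1); first by rewrite addr_ge0.
move=> x; have [->|pn0] := eqVneq (phi x) 0; first by rewrite normr0 addr_ge0.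
have M1 : M < `|M| + 1 by have := ler_norm M; lra.
have := hM _ M1 `|phi x|; rewrite /= normr_id; apply.
by exists x => //; exact: subset_closure.
Qed.

End test_functions.

(** * Difference quotients *)

Section difference_quotient.
Context (R : realType) (d : nat).
Notation e_ i := (delta_mx ord0 i : 'rV[R]_d).
Notation mu := (lebesgue_rV R d).
Notation leb := (@lebesgue_measure R).

Lemma Rintegral_supp (D : set 'rV[R]_d) (f : 'rV[R]_d -> R) :
  (forall x, ~ D x -> f x = 0) -> \int[mu]_x f x = \int[mu]_(x in D) f x.
Proof.
move=> f0; rewrite [RHS]Rintegral_mkcond; apply: eq_Rintegral => x _.
by rewrite /patch; case: ifPn => // /negP; rewrite inE => /f0.
Qed.

Context (i : 'I_d) (F F' : 'rV[R]_d -> R) (r M : R).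
Hypotheses (cF : continuous F) (cF' : continuous F').
Hypothesis dF : forall x, is_derive x (e_ i) F (F' x).
Hypothesis F0 : forall x, ~ cube_rV r x -> F x = 0.
Hypothesis F'0 : forall x, ~ cube_rV r x -> F' x = 0.
Hypothesis FM : forall x, `|F x| <= M.
Hypothesis F'M : forall x, `|F' x| <= M.

Let mF : measurable_fun setT F := continuous_measurable_rV cF.
Let mF' : measurable_fun setT F' := continuous_measurable_rV cF'.

Lemma line_is_derive x (s : R) : is_derive s 1 (fun s : R => F (x + s *: e_ i)) (F' (x + s *: e_ i)).
Proof. by apply/is_derive_line. Qed.

Lemma line_continuous x (f : 'rV[R]_d -> R) : continuous f -> continuous (fun s : R => f (x + s *: e_ i)).
Proof.
move=> cf s; apply: (@continuous_comp _ _ _ (fun s : R => x + s *: e_ i) f); last exact: cf.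
by apply: cvgD; [exact: cvg_cst|apply: cvgZl; exact: cvg_id].
Qed.

Lemma line_lipschitz x (h : R) : 0 < h -> `|F (x + h *: e_ i) - F x| <= M * h.
Proof.
move=> h0; have [||c _] := @MVT _ (fun s : R => F (x + s *: e_ i)) (fun s => F' (x + s *: e_ i)) 0 h h0.
- by move=> s _; exact: line_is_derive.
- by apply: continuous_subspaceT; exact: line_continuous.
- by rewrite scale0r addr0 subr0 => ->; rewrite normrM (gtr0_norm h0) ler_pM2r.
Qed.

Lemma quotient_cvg x : (k.+1%:R * (F (x + k.+1%:R^-1 *: e_ i) - F x)) @[k --> \oo] --> F' x.
Proof.
have [d1 d2] := dF x.
have /cvgr_dnbhsP/(_ (fun k => k.+1%:R^-1)) := d1.
rewrite -/(derive F x (e_ i)) d2 => h.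
have {}h := h (conj _ (@cvg_harmonic R)).
suff -> : (fun k : nat => k.+1%:R * (F (x + k.+1%:R^-1 *: e_ i) - F x)) =
  (fun n : nat => (n.+1%:R^-1)^-1 *: ((F \o shift x) (n.+1%:R^-1 *: e_ i) - F x)).
  by apply: h => n; rewrite invr_eq0 pnatr_eq0.
by apply/funext => k; rewrite invrK /= [x + _]addrC.
Qed.

Lemma cube_shift (x : 'rV[R]_d) (h : R) : `|h| <= 1 -> cube_rV r (x + h *: e_ i) -> cube_rV (r + 1) x.
Proof.
move=> h1 + j => /(_ j); rewrite /rV_coord /= !mxE !in_itv/= ?eqxx/=.
have hM : `|h * (j == i)%:R| <= 1 by case: (j == i); rewrite ?mulr1 ?mulr0 ?normr0.
move: hM; rewrite ler_norml => /andP[? ?] /andP[? ?]; apply/andP; split; lra.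
Qed.

(** By translation invariance the difference quotients of [F] have zero integral; these
    quotients are bounded and supported in a fixed cube, and converge to [F']. *)
Lemma Rintegral_derive_eq0 : \int[mu]_x F' x = 0.
Proof.
pose K := @cube_rV R d (r + 1).
have mK : measurable K by exact: measurable_cube_rV.
have Kfin : (mu K < +oo)%E by exact: cube_rV_lty.
have rK x : cube_rV r x -> K x.
  by move=> h; apply: (@cube_shift _ 0); rewrite ?normr0// scale0r addr0.
have nK x : ~ K x -> ~ cube_rV r x by move=> h /rK.
have nK' x k : ~ K x -> F (x + k.+1%:R^-1 *: e_ i) = 0.
  move=> h; apply: F0 => /cube_shift; apply: contra_not h; apply.
  by rewrite ger0_norm// invf_le1// ler1n.
pose Q k (x : 'rV[R]_d) : R := k.+1%:R * (F (x + k.+1%:R^-1 *: e_ i) - F x).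
have mS k : measurable_fun setT (fun x : 'rV[R]_d => F (x + k.+1%:R^-1 *: e_ i)).
  exact: measurableT_comp mF (measurable_shift_rV _).
have iF : mu.-integrable K (EFin \o F).
  apply: (rint_le mK (g := fun=> M)) => //; [exact: measurable_funS mF|exact: rint_cst].
have iFS k : mu.-integrable K (EFin \o (fun x : 'rV[R]_d => F (x + k.+1%:R^-1 *: e_ i))).
  apply: (rint_le mK (g := fun=> M)) => //; [exact: measurable_funS (mS k)|exact: rint_cst].
have Q0 k : \int[mu]_(x in K) Q k x = 0.
  rewrite RintegralZl//; last exact: rintB.
  rewrite RintegralB// -Rintegral_supp; last by move=> x /nK'.
  rewrite Rintegral_shift// -Rintegral_supp ?subrr ?mulr0//.
  by move=> x /nK; exact: F0.
have mQ k : measurable_fun setT (Q k).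
  by apply: measurable_funM => //; exact: measurable_funB.
have h := @dominated_cvg _ _ _ mu K mK (fun k x => (Q k x)%:E) (EFin \o F') (fun=> M%:E).
rewrite (@Rintegral_supp K); last by move=> x /nK; exact: F'0.
have iQ k : mu.-integrable K (EFin \o Q k) by apply: rintZ => //; exact: rintB.
rewrite /Rintegral; suff -> : (\int[mu]_(x in K) (F' x)%:E = 0)%E by [].
have z k : (\int[mu]_(x in K) (Q k x)%:E = 0)%E.
  have fin : (\int[mu]_(x in K) (Q k x)%:E \is a fin_num)%E by exact: (integrable_fin_num mK (iQ k)).
  by rewrite -(fineK fin) -/(Rintegral mu K (Q k)) Q0.
have {}h := h _ _ _ _ _.
have zz : (fun k : nat => \int[mu]_(x in K) (Q k x)%:E)%E = fun=> 0%E.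
  by apply/funext => k; exact: z.
rewrite zz in h.
apply/esym/(cvg_unique _ (cvg_cst _) (h _ _ _ _ _)) => //.
- by move=> k; apply/measurable_EFinP; exact: measurable_funS (mQ k).
- by move=> x _; apply: cvg_EFin; [exact: nearW|exact: quotient_cvg].
- exact: rint_cst.
- move=> k x _; rewrite lee_fin /Q normrM ger0_norm// -ler_pdivlMl//.
  by rewrite mulrC line_lipschitz// invr_gt0.
Qed.

Lemma line_FTC x (h : R) : 0 < h ->
  (\int[leb]_(s in `[0%R, h]) (F' (x + s *: e_ i)%R)%:E)%E = (F (x + h *: e_ i) - F x)%:E.
Proof.
move=> h0; have cl := @line_continuous x F cF.
rewrite (@continuous_FTC2 _ _ (fun s : R => F (x + s *: e_ i)) 0 h h0).
- by rewrite scale0r addr0.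
- by apply: continuous_subspaceT; exact: line_continuous.
- split.
  + by move=> s _; case: (line_is_derive x s).
  + by apply: cvg_at_right_filter; exact: cl.
  + by apply: cvg_at_left_filter; exact: cl.
- by move=> s _; rewrite derive1E; apply: derive_val; exact: line_is_derive.
Qed.

(** Cauchy--Schwarz on an interval of length [h]. *)
Lemma line_sqr_le x (h : R) : 0 < h ->
  (((F (x + h *: e_ i) - F x) ^+ 2)%:E <=
   h%:E * \int[leb]_(s in `[0%R, h]) ((F' (x + s *: e_ i)%R) ^+ 2)%:E)%E.
Proof.
move=> h0; set D := F (x + h *: e_ i) - F x; set J := `[0, h]%classic.
pose f (s : measurableTypeR R) : R := F' (x + s *: e_ i).
have cf : continuous (f : R -> R) by exact: line_continuous.
have mJ : measurable (J : set (measurableTypeR R)) by exact: measurable_itv.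
have mf : measurable_fun J f.
  by apply: measurable_funS (continuous_measurable_fun cf).
have lJ : leb J = h%:E.
  by have := @lebesgue_measure_itv R `[0, h]; rewrite /= lte_fin h0 oppr0 adde0.
have icst (c : R) : leb.-integrable J (fun=> c%:E).
  apply/integrableP; split; first exact: measurable_cst.
  rewrite (integral_cst leb mJ (`|c|)%:E) // lte_mul_pinfty//.
  by rewrite [X in (X < _)%E]lJ ltry.
have iJ (g : measurableTypeR R -> R) (N : R) : measurable_fun J g -> (forall s, `|g s| <= N) -> leb.-integrable J (EFin \o g).
  move=> mg gN; apply: (le_integrable mJ _ _ (icst N)); first exact/measurable_EFinP.
  by move=> s _ /=; rewrite lee_fin (le_trans (gN s))// ler_norm.
have if1 : leb.-integrable J (EFin \o f) by apply: (iJ _ M) => // s; exact: F'M.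
have if2 : leb.-integrable J (EFin \o (fun s => f s ^+ 2)).
  apply: (iJ _ (M ^+ 2)); first exact: measurable_funX.
  by move=> s; rewrite normrX lerXn2r// ?nnegrE//; [exact: le_trans (F'M 0)|exact: F'M].
pose c := D / h.
have icf : leb.-integrable J (EFin \o (fun s => 2 * c * f s)).
  by have := integrableZl mJ (2 * c) if1.
have fE : \int[leb]_(s in J) f s = D by rewrite /Rintegral line_FTC.
(* The inequality 2 c f - c ^ 2 <= f ^ 2 is integrated, with c the mean value of f. *)
have : \int[leb]_(s in J) (2 * c * f s - c ^+ 2) <= \int[leb]_(s in J) (f s ^+ 2).
  apply: le_Rintegral => //.
    have := integrableB mJ (integrableZl mJ (2 * c) if1) (icst (c ^+ 2)).
    by [].
  by move=> s _; have := sqr_ge0 (f s - c); lra.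
rewrite (RintegralB mJ icf (icst _)) RintegralZl// fE Rintegral_cst// => le1.
rewrite -[X in (_ <= _ * X)%E]fineK ?integrable_fin_num// -EFinM lee_fin.
rewrite [X in fine X]lJ /= in le1.
have E : 2 * c * D - c ^+ 2 * h = h^-1 * D ^+ 2 by rewrite /c; field; rewrite gt_eqF.
by rewrite E ler_pdivrMl// in le1.
Qed.

Lemma measurable_line_rV : measurable_fun setT
  (fun p : 'rV[R]_d * measurableTypeR R => (p.1 + p.2 *: e_ i : 'rV[R]_d)).
Proof.
apply: measurable_fun_rV => j.
have -> : @rV_coord R d j \o (fun p : 'rV[R]_d * measurableTypeR R => p.1 + p.2 *: e_ i) =
  (fun p => rV_coord j p.1 + p.2 * (e_ i) ord0 j).
  by apply/funext => p; rewrite /rV_coord /= !mxE.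
apply: measurable_funD.
  have h : measurable_fun setT (@rV_coord R d j \o (fst : 'rV[R]_d * measurableTypeR R -> 'rV[R]_d)).
    by apply: measurableT_comp measurable_fst; exact: measurable_rV_coord.
  exact: h.
apply: measurable_funM; [exact: measurable_snd|exact: measurable_cst].
Qed.

(** [line_sqr_le] is integrated over all base points; by translation invariance the inner
    integral does not depend on the position on the line. *)
Lemma shift_sqr_le (h : R) : 0 < h ->
  (\int[mu]_x ((F (x + h *: e_ i)%R - F x) ^+ 2)%:E <= (h ^+ 2)%:E * \int[mu]_x (F' x ^+ 2)%:E)%E.
Proof.
move=> h0; pose J : set (measurableTypeR R) := `[0, h]%classic.
have mJ : measurable J by exact: measurable_itv.
pose f (p : 'rV[R]_d * measurableTypeR R) : \bar R := ((F' (p.1 + p.2 *: e_ i) ^+ 2) * \1_J p.2)%:E.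
have mf : measurable_fun setT f.
  apply/measurable_EFinP; apply: measurable_funM.
    apply: measurable_funX; exact: measurableT_comp mF' measurable_line_rV.
  by apply: measurableT_comp measurable_snd; exact: measurable_indic.
have f0 p : (0 <= f p)%E by rewrite lee_fin mulr_ge0// sqr_ge0.
have fE x : (\int[leb]_(s in J) ((F' (x + s *: e_ i)%R) ^+ 2)%:E = \int[leb]_s f (x, s))%E.
  rewrite integral_mkcond; apply: eq_integral => s _; rewrite /patch /f indicE.
  by case: ifP => _ /=; rewrite ?mulr1 ?mulr0.
have mx := measurable_fun_fubini_tonelli_F (m2 := leb) f mf f0.
apply: (@le_trans _ _ (\int[mu]_x (h%:E * \int[leb]_s f (x, s)))%E).
  apply: ge0_le_integral => //.
  - by move=> x _; rewrite lee_fin sqr_ge0.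
  - apply/measurable_EFinP; apply: measurable_funX; apply: measurable_funB => //.
    exact: measurableT_comp mF (measurable_shift_rV _).
  - by apply: emeasurable_funM => //; exact: measurable_cst.
  - by move=> x _; rewrite -fE; exact: line_sqr_le.
rewrite ge0_integralZl//; last 2 first.
  - by move=> x _; exact: integral_ge0.
  - by rewrite lee_fin ltW.
rewrite (fubini_tonelli (m1 := mu) (m2 := leb) f mf f0).
pose A := (\int[mu]_x (F' x ^+ 2)%:E)%E.
have -> : (\int[leb]_s \int[mu]_x f (x, s) = \int[leb]_(s in J) cst A s)%E.
  rewrite [RHS]integral_mkcond; apply: eq_integral => s _; rewrite /patch /f /= indicE.
  case: ifP => _ /=; last by under eq_integral do rewrite mulr0; rewrite integral0.
  under eq_integral do rewrite mulr1.
  rewrite /A -(ge0_integral_shift (s *: e_ i) (f := fun x => (F' x ^+ 2)%:E))//.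
    by apply/measurable_EFinP; exact: measurable_funX.
  by move=> x; rewrite lee_fin sqr_ge0.
have lJ : leb J = h%:E.
  by have := @lebesgue_measure_itv R `[0, h]; rewrite /= lte_fin h0 oppr0 adde0.
rewrite integral_cst// [X in (_ * (_ * X))%E]lJ.
by rewrite muleCA -EFinM -expr2 muleC.
Qed.

End difference_quotient.

(** * Weak derivatives and the space H10 *)

Lemma semi_inner_sub (R : realType) (X : lmodType R) (H H' : X -> Prop) (dot : X -> X -> R) :
  semi_inner H dot -> (forall u, H' u -> H u) -> H' 0 ->
  (forall a u v, H' u -> H' v -> H' (a *: u + v)) -> semi_inner H' dot.
Proof.
move=> hd sub h0 hl; split => //.
- by move=> a u v w /sub ? /sub ? /sub ?; apply: (si_dotl hd).
- by move=> u v /sub ? /sub ?; apply: (si_sym hd).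
- by move=> u /sub ?; apply: (si_ge0 hd).
Qed.

Lemma sconvP (R : realType) (X : lmodType R) (dot : X -> X -> R) (u_ : nat -> X) (u : X) :
  (forall n, 0 <= dot (u_ n - u) (u_ n - u)) ->
  sconv dot u_ u <-> forall e : R, 0 < e -> exists N, forall n, (N <= n)%N ->
    dot (u_ n - u) (u_ n - u) < e.
Proof.
move=> d0; split => [/cvgr0Pnorm_lt h e e0|h].
  have [N _ hN] := h e e0; exists N => n Nn.
  by have := hN n Nn; rewrite /= ger0_norm.
apply/cvgr0Pnorm_lt => e e0; have [N hN] := h e e0.
by exists N => // n /= Nn; rewrite ger0_norm// hN.
Qed.

Section weak_partial.
Context (R : realType) (d : nat) (Omega : set 'rV[R]_d).
Hypothesis oO : open Omega.
Hypothesis bO : bounded_set Omega.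
Implicit Types (u v w g phi psi : 'rV[R]_d -> R).
Notation e_ i := (delta_mx ord0 i : 'rV[R]_d).
Notation mu := (lebesgue_rV R d).
Notation rint f := (mu.-integrable Omega (EFin \o f)).
Notation wp := (weak_partial Omega).
Notation dot := (L2_dot Omega).

Let mO : measurable Omega := open_measurable_rV oO.
Let Ofin : (mu Omega < +oo)%E := bounded_measure_lty mO bO.
Let hL := L2_semi_inner mO.

Lemma test_L2 phi : test_function Omega phi -> L2 Omega phi.
Proof.
move=> tp; have [M _ pM] := test_function_bounded tp.
by apply: (L2_bounded mO Ofin (M := M)) => // ; exact: measurable_funS (test_function_measurable tp).
Qed.

(** Integration by parts: the derivative of the product of two test functions has zero
    integral. *)
Lemma test_weak_partial i phi : test_function Omega phi ->
  is_weak_partial Omega i phi (partial i phi).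
Proof.
move=> tp; have tp' := test_function_partial i tp; split; first exact: test_L2.
move=> psi tq; have tq' := test_function_partial i tq.
have [r r0 Or] := bounded_subset_cube bO.
have [M1 M10 hM1] := test_function_bounded tp; have [M2 M20 hM2] := test_function_bounded tq.
have [M3 M30 hM3] := test_function_bounded tp'; have [M4 M40 hM4] := test_function_bounded tq'.
pose F' x := phi x * partial i psi x + psi x * partial i phi x.
have c1 := test_function_continuous tp; have c2 := test_function_continuous tq.
have c3 := test_function_continuous tp'; have c4 := test_function_continuous tq'.
have cF' : continuous F'.
  by move=> x; exact: (cvgD (cvgM (c1 x) (c4 x)) (cvgM (c2 x) (c3 x))).
have cF : continuous (phi * psi).
  by move=> x; exact: (cvgM (c1 x) (c2 x)).
have dF x : is_derive x (e_ i) (phi * psi) (F' x).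
  have := is_deriveM (test_function_derive i tp x) (test_function_derive i tq x); exact.
have out phi' : test_function Omega phi' -> forall x, ~ cube_rV r x -> phi' x = 0.
  by move=> t x nx; apply: (test_function_out t) => /Or.
have F'b x : `|F' x| <= M1 * M4 + M2 * M3.
  apply: le_trans (ler_normD _ _) _; rewrite !normrM lerD// ler_pM//.
have F'0 x : ~ cube_rV r x -> F' x = 0.
  by move=> nx; rewrite /F' (out _ tp)// (out _ tq)// !mul0r addr0.
have Fb x : `|(phi * psi) x| <= M1 * M4 + M2 * M3 + M1 * M2.
  rewrite -[(_ * _) x]/(phi x * psi x) normrM; apply: le_trans (_ : M1 * M2 <= _).
    exact: ler_pM.
  by rewrite lerDr addr_ge0// mulr_ge0.
have F0 x : ~ cube_rV r x -> (phi * psi) x = 0.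
  by move=> nx; rewrite -[(_ * _) x]/(phi x * psi x) (out _ tp)// mul0r.
have F'b' x : `|F' x| <= M1 * M4 + M2 * M3 + M1 * M2.
  by apply: le_trans (F'b x) _; rewrite lerDl mulr_ge0.
have := Rintegral_derive_eq0 cF dF F0 F'0 Fb F'b'.
rewrite (@Rintegral_supp _ _ Omega); last first.
  by move=> x nx; rewrite /F' (test_function_out tp)// (test_function_out tq)// !mul0r addr0.
rewrite RintegralD//.
- move/eqP; rewrite addr_eq0 => /eqP; rewrite /L2_dot => ->.
  by congr (- _); apply: eq_Rintegral => x _; rewrite mulrC.
- by apply: L2_rintM; rewrite //; exact: test_L2.
- by apply: L2_rintM; rewrite //; exact: test_L2.
Qed.

Lemma is_weak_partial_lin a i u v g h : L2 Omega u -> L2 Omega v ->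
  is_weak_partial Omega i u g -> is_weak_partial Omega i v h ->
  is_weak_partial Omega i (a *: u + v) (a *: g + h).
Proof.
move=> hu hv [Lg ug] [Lh vh]; split; first exact: L2_lin.
move=> phi tp; have tp1 := test_L2 tp; have tp2 := test_L2 (test_function_partial i tp).
by rewrite !(si_dotl hL)// ug// vh//; ring.
Qed.

Lemma is_weak_partial_uniq i u g h : is_weak_partial Omega i u g ->
  is_weak_partial Omega i u h -> ae_eq mu Omega g h.
Proof.
move=> [Lg ug] [Lh uh].
have Lgh : L2 Omega (g - h) by exact: (siB hL).
have : ae_eq mu Omega (g - h) (cst 0).
  apply: fundamental_lemma => // phi tp; have tL := test_L2 tp.
  have := ug _ tp; rewrite uh// (dotBl hL)// => /oppr_inj ->; exact: subrr.
apply: filterS => x /= e Ox; have /eqP := e Ox.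
by rewrite -[(g - h) x]/(g x - h x) subr_eq0 => /eqP.
Qed.

Lemma weak_partialP i u : H1 Omega u -> is_weak_partial Omega i u (wp i u).
Proof. by move=> [_ /(_ i)] [g hg]; rewrite /weak_partial; apply: (@xgetPex _ _ [set g | is_weak_partial Omega i u g]); exists g. Qed.

Lemma weak_partial_L2 i u : H1 Omega u -> L2 Omega (wp i u).
Proof. by move=> /(weak_partialP i)[]. Qed.

Lemma weak_partial_ae i u g : H1 Omega u -> is_weak_partial Omega i u g ->
  ae_eq mu Omega (wp i u) g.
Proof. by move=> hu; exact: is_weak_partial_uniq (weak_partialP i hu). Qed.

Lemma test_H1 phi : test_function Omega phi -> H1 Omega phi.
Proof. by move=> tp; split; [exact: test_L2|move=> i; eexists; exact: test_weak_partial]. Qed.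

Lemma H1_lin a u v : H1 Omega u -> H1 Omega v -> H1 Omega (a *: u + v).
Proof.
move=> hu hv; split; first by apply: L2_lin => //; [case: hu|case: hv].
move=> i; eexists; apply: is_weak_partial_lin; first by case: hu.
- by case: hv.
- exact: weak_partialP.
- exact: weak_partialP.
Qed.

Lemma weak_partial_lin a i u v : H1 Omega u -> H1 Omega v ->
  ae_eq mu Omega (wp i (a *: u + v)) (a *: wp i u + wp i v).
Proof.
move=> hu hv; apply: weak_partial_ae; first exact: H1_lin.
by apply: is_weak_partial_lin; [case: hu|case: hv|exact: weak_partialP|exact: weak_partialP].
Qed.

Definition gdot u v : R := \sum_(i < d) dot (wp i u) (wp i v).
Definition h1dot u v : R := dot u v + gdot u v.

Lemma grad_dot_rint u v : H1 Omega u -> H1 Omega v -> rint (grad_dot Omega u v).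
Proof.
move=> hu hv; apply: rint_sum => // i _.
by apply: L2_rintM; rewrite //; exact: weak_partial_L2.
Qed.

Lemma Rintegral_grad_dot u v : H1 Omega u -> H1 Omega v ->
  \int[mu]_(x in Omega) grad_dot Omega u v x = gdot u v.
Proof.
move=> hu hv; rewrite /grad_dot Rintegral_sum// => i.
by apply: L2_rintM; rewrite //; exact: weak_partial_L2.
Qed.

Lemma H1_0 : H1 Omega (0 : 'rV[R]_d -> R).
Proof. by apply: test_H1; exact: test_function0. Qed.

Lemma gdot_semi_inner : semi_inner (H1 Omega) gdot.
Proof.
split.
- exact: H1_0.
- exact: H1_lin.
- move=> a u v w hu hv hw; rewrite /gdot mulr_sumr -big_split/=; apply: eq_bigr => i _.
  have [lu lv lw] := And3 (weak_partial_L2 i hu) (weak_partial_L2 i hv) (weak_partial_L2 i hw).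
  rewrite -(si_dotl hL)//; apply: ae_eq_L2_dot => //.
  + by apply: weak_partial_L2; exact: H1_lin.
  + exact: L2_lin.
  + exact: weak_partial_lin.
  + exact: ae_eq_refl.
- by move=> u v hu hv; apply: eq_bigr => i _; apply: (si_sym hL); exact: weak_partial_L2.
- by move=> u hu; apply: sumr_ge0 => i _; apply: (si_ge0 hL); exact: weak_partial_L2.
Qed.

Lemma h1dot_semi_inner : semi_inner (H1 Omega) h1dot.
Proof.
have hg := gdot_semi_inner; split.
- exact: H1_0.
- exact: H1_lin.
- move=> a u v w hu hv hw; rewrite /h1dot (si_dotl hg a hu hv hw).
  rewrite (si_dotl hL a (proj1 hu) (proj1 hv) (proj1 hw)).
  by rewrite mulrDr addrACA.
- move=> u v hu hv; rewrite /h1dot (si_sym hg hu hv).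
  by rewrite (si_sym hL (proj1 hu) (proj1 hv)).
- by move=> u [hu hu']; apply: addr_ge0; [apply: (si_ge0 hL)|apply: (si_ge0 hg)].
Qed.

Lemma H1_normE u : H1 Omega u -> H1_norm Omega u = Num.sqrt (h1dot u u).
Proof.
move=> hu; rewrite /H1_norm; congr Num.sqrt; rewrite RintegralD//.
- by rewrite Rintegral_grad_dot.
- by case: hu => -[].
- exact: grad_dot_rint.
Qed.

Lemma H10_normE u : H1 Omega u -> H10_norm Omega u = Num.sqrt (gdot u u).
Proof. by move=> hu; rewrite /H10_norm Rintegral_grad_dot. Qed.

Lemma H10_H1 u : H10 Omega u -> H1 Omega u. Proof. by case. Qed.
Lemma H1_L2 u : H1 Omega u -> L2 Omega u. Proof. by case. Qed.
Lemma H10_L2 u : H10 Omega u -> L2 Omega u. Proof. by move=> [[]]. Qed.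

Lemma H10P u : H10 Omega u <-> H1 Omega u /\ forall e : R, 0 < e ->
  exists2 phi, test_function Omega phi & h1dot (u - phi) (u - phi) < e.
Proof.
have hB phi : H1 Omega u -> test_function Omega phi -> H1 Omega (u - phi).
  by move=> hu /test_H1; exact: (siB h1dot_semi_inner).
split => [[hu h]|[hu h]]; split=> // e e0.
  have [|phi [tp]] := h (Num.sqrt e); first by rewrite sqrtr_gt0.
  rewrite -[u \- phi]/(u - phi) H1_normE; last exact: hB.
  by rewrite ltr_sqrt// => ?; exists phi.
have [|phi tp hp] := h (e ^+ 2); first by rewrite exprn_gt0.
exists phi; split => //; rewrite -[u \- phi]/(u - phi) H1_normE; last exact: hB.
by rewrite -[ltRHS](gtr0_norm e0) -sqrtr_sqr ltr_sqrt// exprn_gt0.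
Qed.

Lemma test_H10 phi : test_function Omega phi -> H10 Omega phi.
Proof.
move=> tp; apply/H10P; split; first exact: test_H1.
move=> e e0; exists phi => //; rewrite subrr (dot0l h1dot_semi_inner)//; exact: H1_0.
Qed.

Lemma H10_0 : H10 Omega (0 : 'rV[R]_d -> R).
Proof. by apply: test_H10; exact: test_function0. Qed.

Lemma H10_lin a u v : H10 Omega u -> H10 Omega v -> H10 Omega (a *: u + v).
Proof.
move=> /H10P[hu au] /H10P[hv av]; apply/H10P; split; first exact: H1_lin.
have h1 := h1dot_semi_inner.
move=> e e0.
have a0 : 0 < 4 * (a ^+ 2 + 1) by have := sqr_ge0 a; lra.
have [phi tp hp] := au (e / (4 * (a ^+ 2 + 1))) (divr_gt0 e0 a0).
have [psi tq hq] := av (e / 4) (divr_gt0 e0 (ltr0n _ 4)).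
exists (a *: phi + psi); first exact: test_function_lin.
have Hp := siB h1 hu (test_H1 tp); have Hq := siB h1 hv (test_H1 tq).
have -> : a *: u + v - (a *: phi + psi) = a *: (u - phi) + (v - psi).
  by rewrite scalerBr opprD addrACA.
apply: le_lt_trans (parallelogram_le h1 (siZ h1 a Hp) Hq) _.
rewrite (dotZl h1)// ?(dotZr h1)//; last exact: (siZ h1).
rewrite ltr_pdivlMr// in hp.
have p0 := si_ge0 h1 Hp; have := sqr_ge0 a.
move: (h1dot (u - phi) (u - phi)) (h1dot (v - psi) (v - psi)) hp hq p0 => s t; nra.
Qed.

End weak_partial.

Lemma cvg_sum0 (R : realType) (I : Type) (r : seq I) (F : I -> nat -> R) :
  (forall i, F i @ \oo --> 0) -> \sum_(i <- r) F i k @[k --> \oo] --> 0.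
Proof.
move=> cF; elim: r => [|i r IH].
  by under eq_fun do rewrite big_nil; exact: cvg_cst.
apply: (cvg_to_eq (addr0 0)); under eq_fun do rewrite big_cons.
by apply: cvgD; [exact: cF|exact: IH].
Qed.

Section H10_space.
Context (R : realType) (d : nat) (Omega : set 'rV[R]_d).
Hypothesis oO : open Omega.
Hypothesis bO : bounded_set Omega.
Implicit Types (u v w g phi psi : 'rV[R]_d -> R).
Notation e_ i := (delta_mx ord0 i : 'rV[R]_d).
Notation mu := (lebesgue_rV R d).
Notation wp := (weak_partial Omega).
Notation dot := (L2_dot Omega).
Notation gdot := (gdot Omega).
Notation h1dot := (h1dot Omega).

Let mO : measurable Omega := open_measurable_rV oO.
Let Ofin : (mu Omega < +oo)%E := bounded_measure_lty mO bO.
Let hL := L2_semi_inner mO.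
Let h1 := h1dot_semi_inner oO bO.
Let hg := gdot_semi_inner oO bO.

Lemma h1dot_H10 : semi_inner (H10 Omega) h1dot.
Proof. by apply: (semi_inner_sub h1); [exact: H10_H1|exact: H10_0|exact: H10_lin]. Qed.

Lemma gdot_H10 : semi_inner (H10 Omega) gdot.
Proof. by apply: (semi_inner_sub hg); [exact: H10_H1|exact: H10_0|exact: H10_lin]. Qed.

Lemma L2_dot_H10 : semi_inner (H10 Omega) dot.
Proof. by apply: (semi_inner_sub hL); [exact: H10_L2|exact: H10_0|exact: H10_lin]. Qed.

Lemma L2_dot_le_h1dot u : H1 Omega u -> dot u u <= h1dot u u.
Proof. by move=> hu; rewrite lerDl; apply: (si_ge0 hg). Qed.

Lemma gdot_le_h1dot u : H1 Omega u -> gdot u u <= h1dot u u.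
Proof. by move=> hu; rewrite lerDr; apply: (si_ge0 hL); case: hu. Qed.

Lemma weak_partial_le_gdot i u : H1 Omega u -> dot (wp i u) (wp i u) <= gdot u u.
Proof.
move=> hu; rewrite /gdot (bigD1 i)//= lerDl; apply: sumr_ge0 => j _.
by apply: (si_ge0 hL); exact: weak_partial_L2.
Qed.

Lemma weak_partialB i u v : H1 Omega u -> H1 Omega v ->
  ae_eq mu Omega (wp i (u - v)) (wp i u - wp i v).
Proof.
move=> hu hv; have := weak_partial_lin oO bO (-1) i hv hu.
by rewrite !scaleN1r [- v + u]addrC [- wp i v + _]addrC.
Qed.

Lemma dot_weak_partialB i u v g : H1 Omega u -> H1 Omega v ->
  L2 Omega g -> ae_eq mu Omega (wp i v) g ->
  dot (wp i (u - v)) (wp i (u - v)) = dot (wp i u - g) (wp i u - g).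
Proof.
move=> hu hv lg vg; have lu := weak_partial_L2 i hu; have lv := weak_partial_L2 i hv.
have e : ae_eq mu Omega (wp i (u - v)) (wp i u - g).
  have := weak_partialB i hu hv; apply: filterS2 vg => x h2 h3 Ox.
  by rewrite h3// -[LHS]/(wp i u x - wp i v x) h2.
have l1 : L2 Omega (wp i (u - v)) by apply: weak_partial_L2; apply: (siB h1).
have l2 : L2 Omega (wp i u - g) by apply: (siB hL).
exact: ae_eq_L2_dot.
Qed.

(** The functions and their weak derivatives converge in L2, and the relation between them
    passes to the limit against every test function. *)
Theorem H10_complete : semi_complete (H10 Omega) h1dot.
Proof.
move=> u_ hu cau.
have Hu n : H1 Omega (u_ n) by case: (hu n).
have Lu n : L2 Omega (u_ n) by case: (Hu n).
have HuB m n : H1 Omega (u_ m - u_ n) by apply: (siB h1).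
have [u Lu0 cu] : exists2 u, L2 Omega u & forall e : R, 0 < e -> exists N, forall n, (N <= n)%N ->
     dot (u_ n - u) (u_ n - u) < e.
  apply: (L2_complete mO Ofin) => // e e0; have [N hN] := cau e e0; exists N => m n Nm Nn.
  by apply: le_lt_trans (hN m n Nm Nn); exact: L2_dot_le_h1dot.
have {}cu : sconv dot u_ u.
  by apply/sconvP => // n; apply: (si_ge0 hL); apply: (siB hL).
have Lw n i : L2 Omega (wp i (u_ n)) by exact: weak_partial_L2.
have /choice[g gP] (i : 'I_d) : exists g, L2 Omega g /\ sconv dot (fun n => wp i (u_ n)) g.
  have [g Lg cg] : exists2 g, L2 Omega g & forall e : R, 0 < e -> exists N, forall n, (N <= n)%N ->
     dot (wp i (u_ n) - g) (wp i (u_ n) - g) < e.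
    apply: (L2_complete mO Ofin) => // e e0; have [N hN] := cau e e0; exists N => m n Nm Nn.
    rewrite -(dot_weak_partialB (Hu m) (Hu n))//; last exact: ae_eq_refl.
    apply: le_lt_trans (weak_partial_le_gdot i (HuB m n)) _.
    exact: le_lt_trans (gdot_le_h1dot (HuB m n)) (hN m n Nm Nn).
  exists g; split => //; apply/sconvP => // n; apply: (si_ge0 hL); apply: (siB hL) => //.
have ug i : is_weak_partial Omega i u (g i).
  have [Lg cg] := gP i; split => // phi tp.
  have tp1 := test_L2 oO bO tp; have tp2 := test_L2 oO bO (test_function_partial i tp).
  have l1 := cvg_dot hL Lu (fun=> tp2) Lu0 tp2 cu (sconv_cst hL tp2).
  have l2 := cvg_dot hL (fun n => Lw n i) (fun=> tp1) Lg tp1 cg (sconv_cst hL tp1).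
  have E : (fun n => dot (u_ n) (partial i phi)) = (fun n => - dot (wp i (u_ n)) phi).
    by apply/funext => n; have [_ ->] := weak_partialP i (Hu n).
  by rewrite E in l1; exact: (cvg_unique _ l1 (cvgN l2)).
have H1u : H1 Omega u by split => // i; exists (g i).
have cv : sconv h1dot u_ u.
  rewrite /sconv /h1dot; apply: (cvg_to_eq (addr0 0)); apply: cvgD => //.
  rewrite /gdot; apply: (@cvg_sum0 R _ _ (fun i n => dot (wp i (u_ n - u)) (wp i (u_ n - u)))) => i.
  have [Lg cg] := gP i.
  have E : (fun n => dot (wp i (u_ n - u)) (wp i (u_ n - u))) =
      (fun n => dot (wp i (u_ n) - g i) (wp i (u_ n) - g i)).
    by apply/funext => n; apply: dot_weak_partialB => //; exact: weak_partial_ae.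
  by rewrite E.
have HB n : H1 Omega (u_ n - u) by apply: (siB h1).
have {}cv := (sconvP (fun n => si_ge0 h1 (HB n))).1 cv.
exists u => //; apply/(H10P oO bO); split => // e e0.
have [N hN] := cv (e / 4) (divr_gt0 e0 (ltr0n _ 4)).
have [_ /(_ (e / 4) (divr_gt0 e0 (ltr0n _ 4)))[phi tp hp]] := (H10P oO bO (u_ N)).1 (hu N).
exists phi => //; have {}hN := hN N (leqnn N).
have Hp : H1 Omega (u_ N - phi) by apply: (siB h1) => //; exact: test_H1.
have -> : u - phi = (-1) *: (u_ N - u) + (u_ N - phi).
  by rewrite scaleN1r opprB addrA subrK.
apply: le_lt_trans (parallelogram_le h1 (siZ h1 (-1) (HB N)) Hp) _.
rewrite (dotZl h1 (-1) (HB N) (siZ h1 (-1) (HB N))) (dotZr h1 (-1) (HB N) (HB N)).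
move: (h1dot (u_ N - u) (u_ N - u)) (h1dot (u_ N - phi) (u_ N - phi)) hN hp => s t; lra.
Qed.

(** Weak derivatives only depend on the class of a function. *)
Lemma L2_dot_eq0_gdot u : H1 Omega u -> dot u u = 0 -> gdot u u = 0.
Proof.
move=> hu u0; have Lu := H1_L2 hu; have ae0 := L2_dot_eq0 mO Lu u0.
have L0 := L2_0 Omega.
have w0 i : is_weak_partial Omega i u 0.
  split=> // phi tp; have tp1 := test_L2 oO bO tp.
  have tp2 := test_L2 oO bO (test_function_partial i tp).
  rewrite (ae_eq_L2_dot mO Lu L0 tp2 tp2 ae0 (ae_eq_refl _ _ _)).
  by rewrite !(dot0l hL)// oppr0.
rewrite /gdot big1// => i _; have Lw := weak_partial_L2 i hu.
have e := weak_partial_ae oO bO hu (w0 i).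
by rewrite (ae_eq_L2_dot mO Lw L0 Lw L0 e e) (dot0l hL).
Qed.

(** ** Poincare inequality *)

Lemma test_integral_dot phi psi : test_function Omega phi -> test_function Omega psi ->
  (\int[mu]_x (phi x * psi x)%:E)%E = (dot phi psi)%:E.
Proof.
move=> tp tq; rewrite (L2_dot_EFin mO (test_L2 oO bO tp) (test_L2 oO bO tq)).
rewrite [RHS]integral_mkcond; apply: eq_integral => x _; rewrite /patch.
by case: ifPn => // /negP; rewrite inE => nx; rewrite (test_function_out tp)// mul0r.
Qed.

Lemma test_dot_partial i phi : test_function Omega phi ->
  dot (partial i phi) (partial i phi) = dot (wp i phi) (wp i phi).
Proof.
move=> tp; have H1p := test_H1 oO bO tp; have e := weak_partial_ae oO bO H1p (test_weak_partial oO bO i tp).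
apply/esym; apply: ae_eq_L2_dot => //; [exact: weak_partial_L2|..|exact: weak_partial_L2|];
  exact: (test_L2 oO bO (test_function_partial i tp)).
Qed.

Lemma test_dot_partial_le i phi : test_function Omega phi ->
  dot (partial i phi) (partial i phi) <= gdot phi phi.
Proof.
by move=> tp; rewrite test_dot_partial//; apply: weak_partial_le_gdot; exact: test_H1.
Qed.

Lemma test_shift_sqr_le i phi (h : R) : 0 < h -> test_function Omega phi ->
  (\int[mu]_x ((phi (x + h *: e_ i)%R - phi x) ^+ 2)%:E <= (h ^+ 2 * dot (partial i phi) (partial i phi))%:E)%E.
Proof.
move=> h0 tp; have tp' := test_function_partial i tp.
have [M _ hM] := test_function_bounded tp'.
have := shift_sqr_le (test_function_continuous tp) (test_function_continuous tp') (test_function_derive i tp).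
move=> /(_ _ hM h h0) /le_trans; apply.
by rewrite [leRHS]EFinM -(test_integral_dot tp' tp'); under eq_integral do rewrite expr2.
Qed.

(** If [Omega] fits into a cube of side [h], a translation by [h] along an axis
   moves the support of a test function off itself. *)
Lemma test_poincare : (0 < d)%N -> exists2 P : R, 0 < P &
  forall phi, test_function Omega phi -> dot phi phi <= P * gdot phi phi.
Proof.
move=> d0; have [r r0 Or] := bounded_subset_cube bO.
pose i := Ordinal d0; pose h := 2 * r; have h0 : 0 < h by rewrite mulr_gt0.
exists (h ^+ 2) => [|phi tp]; first by rewrite exprn_gt0.
have disj x : phi (x + h *: e_ i) * phi x = 0.
  have [cx|ncx] := pselect (cube_rV r x); last first.
    by rewrite [phi x](test_function_out tp) ?mulr0// => /Or.
  rewrite [phi (x + _)](test_function_out tp) ?mul0r// => /Or /(_ i).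
  have := cx i; rewrite /rV_coord /= !mxE !in_itv/= ?eqxx/= /h => /andP[? ?] /andP[? ?]; lra.
have le1 : ((dot phi phi)%:E <= \int[mu]_x ((phi (x + h *: e_ i)%R - phi x) ^+ 2)%:E)%E.
  rewrite -test_integral_dot//.
  have mphi : measurable_fun setT phi by exact: (test_function_measurable tp).
  apply: ge0_le_integral => //.
  - by move=> x _; rewrite lee_fin -expr2 sqr_ge0.
  - by apply/measurable_EFinP; exact: measurable_funM.
  - apply/measurable_EFinP; apply: measurable_funX; apply: measurable_funB => //.
    exact: measurableT_comp mphi (measurable_shift_rV _).
  - move=> x _; rewrite lee_fin sqrrB disj mul0rn subr0 -expr2 lerDr.
    exact: sqr_ge0.
have := le_trans le1 (test_shift_sqr_le i h0 tp); rewrite lee_fin => /le_trans; apply.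
by rewrite ler_pM2l ?exprn_gt0//; exact: test_dot_partial_le.
Qed.

Lemma H10_approx u : H10 Omega u -> exists2 phi : nat -> 'rV[R]_d -> R,
  (forall n, test_function Omega (phi n)) & sconv h1dot phi u.
Proof.
move=> hu; have [H1u au] := (H10P oO bO u).1 hu.
have /choice[phi phiP] (n : nat) : exists phi, test_function Omega phi /\
    h1dot (u - phi) (u - phi) < n.+1%:R^-1.
  have n0 : 0 < n.+1%:R^-1 :> R by rewrite invr_gt0.
  by have [phi tp hp] := au _ n0; exists phi.
exists phi => [n|]; first by case: (phiP n).
apply: (@cvg0_of_le _ _ (fun n => n.+1%:R^-1)); last exact: cvg_harmonic.
move=> n; have [tp hp] := phiP n; have H1p := test_H1 oO bO tp.
have Hup := siB h1 H1u H1p; have Hpu := siB h1 H1p H1u.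
rewrite (si_ge0 h1 Hpu)/=; apply: le_trans (ltW hp).
have -> : phi n - u = (-1) *: (u - phi n) by rewrite scaleN1r opprB.
by rewrite (dotZl h1 (-1) Hup (siZ h1 (-1) Hup)) (dotZr h1 (-1) Hup Hup) !mulN1r opprK.
Qed.

Lemma sconv_h1dot_gdot (u_ : nat -> 'rV[R]_d -> R) u : (forall n, H1 Omega (u_ n)) -> H1 Omega u ->
  sconv h1dot u_ u -> sconv gdot u_ u /\ sconv dot u_ u.
Proof.
move=> Hu_ Hu cu; have HB n : H1 Omega (u_ n - u) by apply: (siB h1).
split; apply: cvg0_of_le cu => n.
- by rewrite (si_ge0 hg (HB n))/= gdot_le_h1dot.
- by rewrite (si_ge0 hL (H1_L2 (HB n)))/= L2_dot_le_h1dot.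
Qed.

Lemma cvg_sqr_norm (dt : ('rV[R]_d -> R) -> ('rV[R]_d -> R) -> R) (H : ('rV[R]_d -> R) -> Prop)
  (hd : semi_inner H dt) (u_ : nat -> 'rV[R]_d -> R) u : (forall n, H (u_ n)) -> H u ->
  sconv dt u_ u -> dt (u_ n) (u_ n) @[n --> \oo] --> dt u u.
Proof. by move=> Hu_ Hu cu; exact: (cvg_dot hd Hu_ Hu_ Hu Hu cu cu). Qed.

Theorem poincare : (0 < d)%N -> exists2 P : R, 0 < P &
  forall u, H10 Omega u -> dot u u <= P * gdot u u.
Proof.
move=> d0; have [P P0 hP] := test_poincare d0; exists P => // u hu.
have [phi tp cphi] := H10_approx hu.
have H1p n := test_H1 oO bO (tp n); have H1u := H10_H1 hu.
have [cg cd] := sconv_h1dot_gdot H1p H1u cphi.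
have l1 := cvg_sqr_norm hL (fun n => H1_L2 (H1p n)) (H1_L2 H1u) cd.
have l2 : P * gdot (phi n) (phi n) @[n --> \oo] --> P * gdot u u.
  by apply: cvgMr; exact: (cvg_sqr_norm hg H1p H1u cg).
by apply: (ler_cvg_to l1 l2); apply: nearW => n; exact: hP.
Qed.

End H10_space.

(** * Ladyzhenskaya inequality *)

Section cauchy_schwarz.
Local Open Scope ereal_scope.
Context d (T : measurableType d) (R : realType) (m : {measure set T -> \bar R}).

Lemma poweR2 (x : \bar R) : 0 <= x -> x `^ 2 = x * x.
Proof.
case: x => [r| |] // r0; last by rewrite poweRyr ?mulyy.
by rewrite poweR_EFin powR_mulrn -?EFinM ?expr2.
Qed.

Lemma integral_abs_mul_sqr_le (f g : T -> R) : measurable_fun setT f -> measurable_fun setT g ->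
  let I := \int[m]_x (`|f x * g x|)%:E in
  I * I <= (\int[m]_x (f x ^+ 2)%:E) * (\int[m]_x (g x ^+ 2)%:E).
Proof.
move=> mf mg /=; set I := (X in X * X <= _).
have two0 : (0 < 2 :> R)%R by [].
have h : (2^-1 + 2^-1 = 1 :> R)%R by field.
have := hoelder m mf mg two0 two0 h; rewrite Lnorm1 -/I => le1.
have sq (k : T -> R) : 'N[m]_2%:E[EFin \o k] `^ 2 = \int[m]_x (k x ^+ 2)%:E.
  rewrite poweR_Lnorm//; apply: eq_integral => x _ /=.
  by rewrite powR_mulrn// real_normK ?num_real.
rewrite -!sq -poweRM ?Lnorm_ge0// -poweR2 ?integral_ge0//.
by apply: gt0_ler_poweR => //; rewrite in_itv/= leey andbT ?mule_ge0 ?Lnorm_ge0 ?integral_ge0.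
Qed.

Lemma integral_2mul_sqr_le (f g : T -> R) : measurable_fun setT f -> measurable_fun setT g ->
  let S := \int[m]_x (2 * `|f x * g x|)%:E in
  S * S <= 4%:E * ((\int[m]_x (f x ^+ 2)%:E) * \int[m]_x (g x ^+ 2)%:E).
Proof.
move=> mf mg /=; have := integral_abs_mul_sqr_le mf mg; set J := \int[m]_x (`|_|)%:E => le1.
have -> : \int[m]_x (2 * `|f x * g x|)%:E = 2%:E * J.
  rewrite /J; under eq_integral do rewrite EFinM.
  rewrite ge0_integralZl//.
  by apply/measurable_EFinP; apply: measurableT_comp => //; exact: measurable_funM.
rewrite muleACA -EFinM (_ : (2 * 2 = 4 :> R)%R); last by ring.
by rewrite lee_wpmul2l.
Qed.

Lemma ereal_amgm (x y : \bar R) : 0 <= x -> 0 <= y -> 2%:E * (x * y) <= x * x + y * y.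
Proof.
case: x => [r| |] //; case: y => [s| |] // r0 s0.
- by rewrite -!EFinM -EFinD lee_fin; have := sqr_ge0 (r - s)%R; lra.
- by rewrite mulyy addey ?leey// -EFinM.
- by rewrite mulyy addye ?leey// -EFinM.
- by rewrite mulyy addey ?leey.
Qed.

End cauchy_schwarz.

Section ladyzhenskaya2.
Local Open Scope ereal_scope.
Context (R : realType).
Notation leb := (@lebesgue_measure R).
Notation RR := (measurableTypeR R * measurableTypeR R)%type.
Context (u u1 u2 : RR -> R).
Hypotheses (mu0 : measurable_fun setT u) (mu1 : measurable_fun setT u1) (mu2 : measurable_fun setT u2).
Hypothesis h1 : forall b c, (u (b, c) ^+ 2)%:E <= \int[leb]_s (2 * `|u (s, c) * u1 (s, c)|)%:E.
Hypothesis h2 : forall b c, (u (b, c) ^+ 2)%:E <= \int[leb]_s (2 * `|u (b, s) * u2 (b, s)|)%:E.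

(** The square of [u] at [(b, c)] is bounded by a function of [c] alone and by a function of
    [b] alone; the integral of the product of the two bounds factorizes. *)
Lemma ladyzhenskaya_plane :
  \int[leb \x leb]_p (u p ^+ 4)%:E <=
  2%:E * \int[leb \x leb]_p (u p ^+ 2)%:E *
    (\int[leb \x leb]_p (u1 p ^+ 2)%:E + \int[leb \x leb]_p (u2 p ^+ 2)%:E).
Proof.
pose A1 p := (2 * `|u p * u1 p|)%:E; pose A2 p := (2 * `|u p * u2 p|)%:E.
have mA1 : measurable_fun setT A1.
  apply/measurable_EFinP; apply: measurable_funM => //; apply: measurableT_comp => //.
  exact: measurable_funM.
have mA2 : measurable_fun setT A2.
  apply/measurable_EFinP; apply: measurable_funM => //; apply: measurableT_comp => //.
  exact: measurable_funM.
have A10 p : 0 <= A1 p by rewrite lee_fin mulr_ge0.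
have A20 p : 0 <= A2 p by rewrite lee_fin mulr_ge0.
pose al c := \int[leb]_s A1 (s, c); pose be b := \int[leb]_s A2 (b, s).
have mal : measurable_fun setT al by exact: measurable_fun_fubini_tonelli_G A1 mA1 A10.
have mbe : measurable_fun setT be by exact: measurable_fun_fubini_tonelli_F A2 mA2 A20.
have al0 c : 0 <= al c by apply: integral_ge0.
have be0 b : 0 <= be b by apply: integral_ge0.
have mu4 : measurable_fun setT (fun p => (u p ^+ 4)%:E).
  by apply/measurable_EFinP; exact: measurable_funX.
have u40 p : 0 <= (u p ^+ 4)%:E by rewrite lee_fin exprn_even_ge0.
set I := (X in X <= _); set N := (X in 2%:E * X * _).
set P1 := (X in X + _); set P2 := (X in _ + X).
pose S1 := \int[leb \x leb]_p A1 p; pose S2 := \int[leb \x leb]_p A2 p.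
have IS : I <= S2 * S1.
  rewrite /I (fubini_tonelli1 (m1 := leb) (m2 := leb) _ mu4 u40).
  apply: (@le_trans _ _ (\int[leb]_b (be b * S1))).
    apply: ge0_le_integral => //.
    - by move=> b _; apply: integral_ge0.
    - exact: measurable_fun_fubini_tonelli_F mu4 u40.
    - apply: emeasurable_funM => //.
    - move=> b _; rewrite /fubini_F.
      have -> : be b * S1 = \int[leb]_c (be b * al c).
        by rewrite ge0_integralZl// /S1 (fubini_tonelli2 (m1 := leb) (m2 := leb) _ mA1 A10).
      apply: ge0_le_integral => //.
      + exact: measurableT_comp mu4 (pair1_measurable b).
      + by apply: emeasurable_funM => //.
      + move=> c _; have -> : (u (b, c) ^+ 4)%:E = (u (b, c) ^+ 2)%:E * (u (b, c) ^+ 2)%:E.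
          by rewrite -EFinM; congr EFin; ring.
        by apply: lee_pmul; rewrite ?lee_fin ?sqr_ge0//.
  rewrite ge0_integralZr//; last exact: integral_ge0.
  by rewrite /S2 (fubini_tonelli1 (m1 := leb) (m2 := leb) _ mA2 A20).
have S0 k : (forall p, 0 <= k p) -> 0 <= \int[leb \x leb]_p k p by move=> k0; exact: integral_ge0.
have CS k := integral_2mul_sqr_le (leb \x leb) (g := k) mu0.
have := ereal_amgm (S0 _ A20) (S0 _ A10); rewrite -/S1 -/S2 => amgm.
have c1 := CS _ mu1; have c2 := CS _ mu2; rewrite -/S1 -/S2 -/P1 -/P2 in c1 c2.
have N0 : 0 <= N by apply: integral_ge0 => p _; rewrite lee_fin sqr_ge0.
have P10 : 0 <= P1 by apply: integral_ge0 => p _; rewrite lee_fin sqr_ge0.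
have P20 : 0 <= P2 by apply: integral_ge0 => p _; rewrite lee_fin sqr_ge0.
rewrite -(@lee_pmul2l _ 2%:E)//; apply: le_trans (_ : 2%:E * (S2 * S1) <= _).
  by rewrite lee_pmul2l.
apply: le_trans amgm _; apply: le_trans (leeD c2 c1) _.
rewrite -ge0_muleDr ?mule_ge0// -ge0_muleDr// addeC !muleA -EFinM.
by rewrite (_ : (2 * 2 = 4 :> R)%R)//; ring.
Qed.

End ladyzhenskaya2.

Section slices.
Context (R : realType).
Notation leb := (@lebesgue_measure R).
Notation RR := (measurableTypeR R * measurableTypeR R)%type.
Notation e_ i := (delta_mx ord0 i : 'rV[R]_ _).

Lemma rV_coordDZ n (x y : 'rV[R]_n) t j :
  rV_coord j (x + t *: y) = rV_coord j x + t * rV_coord j y.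
Proof. by rewrite /rV_coord !mxE. Qed.

Lemma rV_coord_delta n (i j : 'I_n) : rV_coord j (delta_mx ord0 i : 'rV[R]_n) = (j == i)%:R.
Proof. by rewrite /rV_coord mxE eqxx. Qed.

Lemma rV_ext n (x y : 'rV[R]_n) : (forall j, rV_coord j x = rV_coord j y) -> x = y.
Proof. by move=> h; apply/rowP => j; exact: h. Qed.

Lemma rV_consD0 n (a t : R) (y : 'rV[R]_n) :
  rV_cons (a, y) + t *: delta_mx ord0 ord0 = rV_cons (a + t, y).
Proof.
apply: rV_ext => j; rewrite rV_coordDZ rV_coord_delta; case: (unliftP ord0 j) => [k|] ->.
  by rewrite !rV_consS mulr0 addr0.
by rewrite !rV_cons0 mulr1.
Qed.

Lemma rV_consDS n (a t : R) (y : 'rV[R]_n) j :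
  rV_cons (a, y) + t *: delta_mx ord0 (lift ord0 j) = rV_cons (a, y + t *: delta_mx ord0 j).
Proof.
apply: rV_ext => i; rewrite rV_coordDZ rV_coord_delta; case: (unliftP ord0 i) => [k|] ->.
  by rewrite !rV_consS rV_coordDZ rV_coord_delta (inj_eq lift_inj).
by rewrite !rV_cons0 mulr0 addr0.
Qed.

Definition plane (p : RR) : 'rV[R]_2 := rV_cons (p.1, rV_cons (p.2, 0)).
Definition axis (s : measurableTypeR R) : 'rV[R]_1 := rV_cons (s, 0).

Lemma measurable_axis : measurable_fun setT axis.
Proof.
have h : measurable_fun setT (fun s : measurableTypeR R => (s, 0 : 'rV[R]_0)).
  by apply/measurable_fun_pairP; split; [exact: measurable_id|exact: measurable_cst].
exact: measurableT_comp (@measurable_rV_cons R 0) h.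
Qed.

Lemma measurable_plane : measurable_fun setT plane.
Proof.
have h : measurable_fun setT (fun p : RR => (p.1, axis p.2)).
  apply/measurable_fun_pairP; split; first exact: measurable_fst.
  by apply: (measurableT_comp measurable_axis); exact: measurable_snd.
exact: measurableT_comp (@measurable_rV_cons R 1) h.
Qed.

Local Open Scope ereal_scope.

Lemma integral_axis (f : 'rV[R]_1 -> \bar R) : measurable_fun setT f -> (forall x, 0 <= f x) ->
  \int[lebesgue_rV R 1]_x f x = \int[leb]_s f (axis s).
Proof.
move=> mf f0; rewrite tonelli_cons//; apply: eq_integral => s _.
rewrite /= integral_dirac//; first by rewrite diracE mem_set// mul1e.
apply: (measurableT_comp mf); apply: (measurableT_comp (@measurable_rV_cons R 0)).
by apply/measurable_fun_pairP; split; [exact: measurable_cst|exact: measurable_id].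
Qed.

Lemma integral_plane (f : 'rV[R]_2 -> \bar R) : measurable_fun setT f -> (forall x, 0 <= f x) ->
  \int[lebesgue_rV R 2]_x f x = \int[leb \x leb]_p f (plane p).
Proof.
move=> mf f0; rewrite tonelli_cons//.
rewrite fubini_tonelli1//; last exact: measurableT_comp mf measurable_plane.
apply: eq_integral => a _; rewrite integral_axis//.
apply: (measurableT_comp mf); apply: (measurableT_comp (@measurable_rV_cons R 1)).
by apply/measurable_fun_pairP; split; [exact: measurable_cst|exact: measurable_id].
Qed.

End slices.

Section line_sup.
Context (R : realType) (d : nat) (Omega : set 'rV[R]_d).
Hypothesis bO : bounded_set Omega.
Notation leb := (@lebesgue_measure R).
Notation e_ i := (delta_mx ord0 i : 'rV[R]_d).

(** One-dimensional Agmon bound: the derivative of the square of [phi] is integrated along a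
    line, from outside the support. *)
Lemma line_sup i (phi : 'rV[R]_d -> R) x (t : R) : test_function Omega phi ->
  ((phi (x + t *: e_ i)%R ^+ 2)%:E <=
   \int[leb]_s (2 * `|phi (x + s *: e_ i)%R * partial i phi (x + s *: e_ i)%R|)%:E)%E.
Proof.
move=> tp; have tp' := test_function_partial i tp.
have [r r0 Or] := bounded_subset_cube bO.
pose f (s : R) := phi (x + s *: e_ i); pose f' (s : R) := partial i phi (x + s *: e_ i).
pose F : R -> R := f * f; pose F' : R -> R := fun s => 2 * (f s * f' s).
have cf : continuous f by exact: line_continuous (test_function_continuous tp).
have cf' : continuous f' by exact: line_continuous (test_function_continuous tp').
have dF (s : R) : is_derive s 1 F (F' s).
  have df := line_is_derive (test_function_derive i tp) x s.
  have := is_deriveM df df; rewrite -/f -/f' => h; apply: (is_derive_eq h).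
  by rewrite -mulr2n -mulr_natl.
have cF : continuous F by move=> s; exact: (cvgM (cf s) (cf s)).
have cF' : continuous F' by move=> s; apply: cvgM; [exact: cvg_cst|exact: (cvgM (cf s) (cf' s))].
pose h := `|x ord0 i + t| + r + 1.
have h0 : 0 < h by rewrite /h; have := normr_ge0 (x ord0 i + t); lra.
have fth : F (t - h) = 0.
  rewrite /F -[(_ * _) _]/(f (t - h) * f (t - h)) /f (test_function_out tp) ?mul0r// => /Or /(_ i).
  rewrite /rV_coord /= !mxE !in_itv/= ?eqxx/= mulr1 => /andP[+ _].
  by have := ler_norm (x ord0 i + t); rewrite /h; lra.
have th : t - h < t by lra.
have ftc : (\int[leb]_(s in `[(t - h)%R, t]) (F' s)%:E = (F t)%:E)%E.
  rewrite (@continuous_FTC2 _ F' F _ _ th) ?fth ?sube0//.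
  - exact: continuous_subspaceT.
  - split; first by move=> s _; case: (dF s).
    + by apply: cvg_at_right_filter; exact: cF.
    + by apply: cvg_at_left_filter; exact: cF.
  - by move=> s _; rewrite derive1E; apply: derive_val; exact: dF.
have mF' : measurable_fun setT (F' : measurableTypeR R -> R) by exact: continuous_measurable_fun.
have mJ : measurable (`[t - h, t]%classic : set (measurableTypeR R)) by exact: measurable_itv.
have -> : (phi (x + t *: e_ i)%R ^+ 2)%:E = (F t)%:E by [].
rewrite -ftc; apply: le_trans (lee_abs _) _.
have mFJ : measurable_fun (`[t - h, t]%classic : set (measurableTypeR R)) (EFin \o F').
  by apply/measurable_EFinP; exact: measurable_funS mF'.
apply: le_trans (le_abse_integral leb mJ mFJ) _.
have -> : (\int[leb]_s (2 * `|phi (x + s *: e_ i)%R * partial i phi (x + s *: e_ i)%R|)%:E =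
    \int[leb]_s `|(EFin \o F') s|)%E.
  apply: eq_integral => s _; congr EFin.
  by rewrite /F' [RHS]normrM (ger0_norm (ler0n _ 2)).
apply: ge0_subset_integral => //.
by apply: measurableT_comp => //; exact/measurable_EFinP.
Qed.

End line_sup.

Section ladyzhenskaya_test.
Context (R : realType).
Notation leb := (@lebesgue_measure R).
Notation RR := (measurableTypeR R * measurableTypeR R)%type.
Local Open Scope ereal_scope.

Lemma measurable_rV_consr n (a : R) : measurable_fun setT (fun y : 'rV[R]_n => rV_cons (a : measurableTypeR R, y)).
Proof.
apply: (measurableT_comp (@measurable_rV_cons R n)).
by apply/measurable_fun_pairP; split; [exact: measurable_cst|exact: measurable_id].
Qed.

Lemma tonelli_cons_sym n (f : 'rV[R]_n.+1 -> \bar R) :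
  measurable_fun setT f -> (forall x, 0 <= f x) ->
  \int[lebesgue_rV R n.+1]_x f x =
  \int[lebesgue_rV R n]_y \int[leb]_a f (rV_cons (a, y)).
Proof.
move=> mf f0; rewrite tonelli_cons//.
rewrite (@fubini_tonelli _ _ _ _ _ leb (lebesgue_rV R n) (f \o @rV_cons R n))//; last by move=> p /=.
exact: measurableT_comp mf (@measurable_rV_cons R n).
Qed.

Section first_coordinate.
Context (n : nat) (Omega : set 'rV[R]_n.+1).
Hypothesis bO : bounded_set Omega.
Context (phi : 'rV[R]_n.+1 -> R) (tp : test_function Omega phi).
Notation d0 := (partial ord0 phi).

(** The bound of [line_sup] does not depend on the first coordinate; it is integrated over
    the others. *)
Lemma slice_sqr_le (a : R) :
  \int[lebesgue_rV R n]_y (phi (rV_cons (a, y)) ^+ 2)%:E <=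
  \int[lebesgue_rV R n.+1]_x (2 * `|phi x * d0 x|)%:E.
Proof.
have mp := test_function_measurable tp; have md := test_function_measurable (test_function_partial ord0 tp).
have m2 : measurable_fun setT (fun x => (2 * `|phi x * d0 x|)%:E).
  apply/measurable_EFinP; apply: measurable_funM => //; apply: measurableT_comp => //.
  exact: measurable_funM.
rewrite tonelli_cons_sym//.
apply: ge0_le_integral => //.
- by move=> y _; rewrite lee_fin sqr_ge0.
- apply/measurable_EFinP; apply: measurable_funX; exact: measurableT_comp mp (measurable_rV_consr a).
- apply: (measurable_fun_fubini_tonelli_G (fun p => (2 * `|phi (rV_cons p) * d0 (rV_cons p)|)%:E)) => //.
  exact: measurableT_comp m2 (@measurable_rV_cons R n).
move=> y _; have := line_sup bO ord0 (rV_cons (0%R : measurableTypeR R, y)) a tp.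
rewrite rV_consD0 add0r => /le_trans; apply.
rewrite le_eqVlt; apply/orP; left; apply/eqP; apply: eq_integral => s _.
by rewrite !rV_consD0 add0r.
Qed.

End first_coordinate.

Notation i0 := (ord0 : 'I_2).
Notation i1 := (lift ord0 ord0 : 'I_2).

Lemma ladyzhenskaya_slice (psi psi1 psi2 : 'rV[R]_2 -> R) :
  measurable_fun setT psi -> measurable_fun setT psi1 -> measurable_fun setT psi2 ->
  (forall x t, (psi (x + t *: delta_mx ord0 i0)%R ^+ 2)%:E <=
    \int[leb]_s (2 * `|psi (x + s *: delta_mx ord0 i0)%R * psi1 (x + s *: delta_mx ord0 i0)%R|)%:E) ->
  (forall x t, (psi (x + t *: delta_mx ord0 i1)%R ^+ 2)%:E <=
    \int[leb]_s (2 * `|psi (x + s *: delta_mx ord0 i1)%R * psi2 (x + s *: delta_mx ord0 i1)%R|)%:E) ->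
  \int[lebesgue_rV R 2]_x (psi x ^+ 4)%:E <= 2%:E * \int[lebesgue_rV R 2]_x (psi x ^+ 2)%:E *
    (\int[lebesgue_rV R 2]_x (psi1 x ^+ 2)%:E + \int[lebesgue_rV R 2]_x (psi2 x ^+ 2)%:E).
Proof.
move=> mp m1 m2 h1 h2.
have mX k (f : 'rV[R]_2 -> R) : measurable_fun setT f -> measurable_fun setT (fun x => (f x ^+ k)%:E).
  by move=> mf; apply/measurable_EFinP; exact: measurable_funX.
have sq0 (f : 'rV[R]_2 -> R) x : 0 <= (f x ^+ 2)%:E by rewrite lee_fin sqr_ge0.
rewrite (integral_plane (mX 4%N _ mp)) => [|x]; last by rewrite lee_fin exprn_even_ge0.
rewrite (integral_plane (mX 2%N _ mp) (sq0 _)) (integral_plane (mX 2%N _ m1) (sq0 _)).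
rewrite (integral_plane (mX 2%N _ m2) (sq0 _)).
apply: (@ladyzhenskaya_plane _ (psi \o @plane R) (psi1 \o @plane R) (psi2 \o @plane R)).
- exact: measurableT_comp mp (@measurable_plane R).
- exact: measurableT_comp m1 (@measurable_plane R).
- exact: measurableT_comp m2 (@measurable_plane R).
- move=> b c; have := h1 (plane (0%R : measurableTypeR R, c)) b.
  have e s : (plane (0%R : measurableTypeR R, c) + s *: delta_mx ord0 i0)%R = plane (s : measurableTypeR R, c).
    by rewrite /plane rV_consD0 add0r.
  by rewrite e => /le_trans; apply; under eq_integral do rewrite e.
- move=> b c; have := h2 (plane (b, 0%R : measurableTypeR R)) c.
  have e s : (plane (b, 0%R : measurableTypeR R) + s *: delta_mx ord0 i1)%R = plane (b, s : measurableTypeR R).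
    by rewrite /plane rV_consDS rV_consD0 add0r.
  by rewrite e => /le_trans; apply; under eq_integral do rewrite e.
Qed.

Lemma integral_test_sqr d (Omega : set 'rV[R]_d) phi : open Omega -> bounded_set Omega ->
  test_function Omega phi -> \int[lebesgue_rV R d]_x (phi x ^+ 2)%:E = (L2_dot Omega phi phi)%:E.
Proof.
move=> oO bO tp; rewrite -(test_integral_dot oO bO tp tp).
by apply: eq_integral => x _; rewrite expr2.
Qed.

End ladyzhenskaya_test.

Section ladyzhenskaya_dims.
Context (R : realType).
Local Open Scope ereal_scope.
Notation mu := (lebesgue_rV R _).

Lemma integral_test_partial_le d (Omega : set 'rV[R]_d) i phi : open Omega -> bounded_set Omega ->
  test_function Omega phi -> \int[mu]_x (partial i phi x ^+ 2)%:E <= (gdot Omega phi phi)%:E.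
Proof.
move=> oO bO tp; rewrite (integral_test_sqr oO bO (test_function_partial i tp)) lee_fin.
exact: test_dot_partial_le.
Qed.

Lemma agmon_sqr_le n (Omega : set 'rV[R]_n.+1) phi : open Omega -> bounded_set Omega ->
  test_function Omega phi ->
  let S := \int[mu]_x (2 * `|phi x * partial ord0 phi x|)%:E in
  S * S <= (4 * (L2_dot Omega phi phi * gdot Omega phi phi))%:E.
Proof.
move=> oO bO tp /=; have tp' := test_function_partial ord0 tp.
have := integral_2mul_sqr_le mu (test_function_measurable tp) (test_function_measurable tp').
move=> /le_trans; apply; rewrite [leRHS]EFinM lee_pmul2l//.
rewrite (integral_test_sqr oO bO tp) EFinM; apply: lee_wpmul2l; last exact: integral_test_partial_le.
rewrite lee_fin; exact: (si_ge0 (L2_semi_inner (open_measurable_rV oO)) (test_L2 oO bO tp)).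
Qed.

Lemma ladyzhenskaya1 (Omega : set 'rV[R]_1) phi : open Omega -> bounded_set Omega ->
  test_function Omega phi ->
  let I := \int[mu]_x (phi x ^+ 4)%:E in
  I * I <= (4 * L2_dot Omega phi phi ^+ 3 * gdot Omega phi phi)%:E.
Proof.
move=> oO bO tp /=; set I := (X in X * X <= _).
have mp := test_function_measurable tp.
have := agmon_sqr_le oO bO tp; set S := \int[mu]_x (2 * _)%:E => /= SS.
have N0 : (0 <= L2_dot Omega phi phi)%R.
  exact: (si_ge0 (L2_semi_inner (open_measurable_rV oO)) (test_L2 oO bO tp)).
have S0 : 0 <= S by apply: integral_ge0.
have IS : I <= S * (L2_dot Omega phi phi)%:E.
  rewrite -(integral_test_sqr oO bO tp) -ge0_integralZl//.
  - apply: ge0_le_integral => //.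
    + by move=> x _; rewrite lee_fin exprn_even_ge0.
    + by apply/measurable_EFinP; exact: measurable_funX.
    + by apply: emeasurable_funM => //; apply/measurable_EFinP; exact: measurable_funX.
    + move=> x _; rewrite (_ : phi x ^+ 4 = phi x ^+ 2 * phi x ^+ 2)%R; last by ring.
      rewrite EFinM; apply: lee_wpmul2r; first by rewrite lee_fin sqr_ge0.
      have := slice_sqr_le bO tp (x ord0 ord0); apply: le_trans.
      rewrite integral_dirac//; last first.
        apply/measurable_EFinP; apply: measurable_funX; exact: measurableT_comp mp (measurable_rV_consr _).
      rewrite diracE mem_set// mul1e (_ : rV_cons _ = x)//.
      by apply/rowP => j; rewrite !ord1; exact: rV_cons0.
  - by apply/measurable_EFinP; exact: measurable_funX.
  - by move=> x _; rewrite lee_fin sqr_ge0.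
have I0 : 0 <= I by apply: integral_ge0 => x _; rewrite lee_fin exprn_even_ge0.
apply: le_trans (lee_pmul I0 I0 IS IS) _; rewrite muleACA.
apply: (@le_trans _ _ ((4 * (L2_dot Omega phi phi * gdot Omega phi phi))%:E * (L2_dot Omega phi phi * L2_dot Omega phi phi)%:E)).
  by rewrite -EFinM; apply: lee_wpmul2r => //; rewrite lee_fin mulr_ge0.
by rewrite -EFinM lee_fin le_eqVlt; apply/orP; left; apply/eqP; ring.
Qed.

Lemma ladyzhenskaya2 (Omega : set 'rV[R]_2) phi : open Omega -> bounded_set Omega ->
  test_function Omega phi ->
  \int[mu]_x (phi x ^+ 4)%:E <= (4 * L2_dot Omega phi phi * gdot Omega phi phi)%:E.
Proof.
move=> oO bO tp; have mp := test_function_measurable tp.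
have mpi i := test_function_measurable (test_function_partial i tp).
have := ladyzhenskaya_slice mp (mpi ord0) (mpi (lift ord0 ord0)) (fun x t => line_sup bO _ x t tp)
  (fun x t => line_sup bO _ x t tp).
rewrite (integral_test_sqr oO bO tp) => /le_trans; apply.
rewrite -EFinM (_ : (4 * _ * _ = 2 * L2_dot Omega phi phi * (gdot Omega phi phi + gdot Omega phi phi))%R); last by ring.
rewrite [leRHS]EFinM; apply: lee_wpmul2l.
  by rewrite lee_fin mulr_ge0//; exact: (si_ge0 (L2_semi_inner (open_measurable_rV oO)) (test_L2 oO bO tp)).
by rewrite EFinD; apply: leeD; exact: integral_test_partial_le.
Qed.

(** The planar inequality on each slice orthogonal to the first axis, where the L2 norm of
    the slice is bounded uniformly by [slice_sqr_le]. *)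
Lemma ladyzhenskaya3 (Omega : set 'rV[R]_3) phi : open Omega -> bounded_set Omega ->
  test_function Omega phi ->
  let I := \int[mu]_x (phi x ^+ 4)%:E in
  I * I <= (64 * L2_dot Omega phi phi * gdot Omega phi phi ^+ 3)%:E.
Proof.
move=> oO bO tp /=; set I := (X in X * X <= _).
have mp := test_function_measurable tp.
have mpi i := test_function_measurable (test_function_partial i tp).
have := agmon_sqr_le oO bO tp; set S := \int[mu]_x (2 * _)%:E => /= SS.
have S0 : 0 <= S by apply: integral_ge0.
have mXE k (f : 'rV[R]_3 -> R) : measurable_fun setT f -> measurable_fun setT (fun x => (f x ^+ k)%:E).
  by move=> mf; apply/measurable_EFinP; exact: measurable_funX.
pose j1 : 'I_3 := lift ord0 ord0; pose j2 : 'I_3 := lift ord0 (lift ord0 ord0).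
pose P j (a : measurableTypeR R) := \int[lebesgue_rV R 2]_y (partial j phi (rV_cons (a, y)) ^+ 2)%:E.
have mP j : measurable_fun setT (P j).
  apply: (measurable_fun_fubini_tonelli_F (fun p => (partial j phi (rV_cons p) ^+ 2)%:E)).
    exact: measurableT_comp (mXE 2%N _ (mpi j)) (@measurable_rV_cons R 2).
  by move=> p; rewrite lee_fin sqr_ge0.
have P0 j a : 0 <= P j a by apply: integral_ge0 => y _; rewrite lee_fin sqr_ge0.
have PE j : \int[@lebesgue_measure R]_a P j a <= (gdot Omega phi phi)%:E.
  apply: le_trans (integral_test_partial_le j oO bO tp).
  by rewrite tonelli_cons//; [exact: mXE|move=> x; rewrite lee_fin sqr_ge0].
have IS : I <= 2%:E * S * (2 * gdot Omega phi phi)%:E.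
  rewrite /I tonelli_cons; [|exact: mXE|by move=> x; rewrite lee_fin exprn_even_ge0].
  apply: (@le_trans _ _ (\int[@lebesgue_measure R]_a (2%:E * S * (P j1 a + P j2 a)))).
    apply: ge0_le_integral => //.
    + by move=> a _; apply: integral_ge0 => y _; rewrite lee_fin exprn_even_ge0.
    + apply: (measurable_fun_fubini_tonelli_F (fun p => (phi (rV_cons p) ^+ 4)%:E)).
        exact: measurableT_comp (mXE 4%N _ mp) (@measurable_rV_cons R 2).
      by move=> p; rewrite lee_fin exprn_even_ge0.
    + by apply: emeasurable_funM => //; exact: emeasurable_funD.
    + move=> a _.
      have ms (f : 'rV[R]_3 -> R) : measurable_fun setT f -> measurable_fun setT (fun y : 'rV[R]_2 => f (rV_cons (a, y))).
        by move=> mf; exact: measurableT_comp mf (measurable_rV_consr a).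
      have hl (i : 'I_2) (x : 'rV[R]_2) (t : R) := line_sup bO (lift ord0 i) (rV_cons (a, x)) t tp.
      have hl' (i : 'I_2) (x : 'rV[R]_2) (t : R) : (phi (rV_cons (a, x + t *: delta_mx ord0 i)%R) ^+ 2)%:E <=
         \int[@lebesgue_measure R]_s (2 * `|phi (rV_cons (a, x + s *: delta_mx ord0 i)%R) *
            partial (lift ord0 i) phi (rV_cons (a, x + s *: delta_mx ord0 i)%R)|)%:E.
        have := hl i x t; rewrite rV_consDS => /le_trans; apply.
        by under eq_integral do rewrite rV_consDS.
      have := ladyzhenskaya_slice (ms _ mp) (ms _ (mpi j1)) (ms _ (mpi j2)) (hl' _) (hl' _).
      move=> /le_trans; apply; rewrite -/(P j1 a) -/(P j2 a).
      apply: lee_wpmul2r; first exact: adde_ge0.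
      by apply: lee_wpmul2l => //; exact: (slice_sqr_le bO tp a).
  rewrite ge0_integralZl//; last 3 first.
  - exact: emeasurable_funD.
  - by move=> a _; exact: adde_ge0.
  - exact: mule_ge0.
  apply: lee_wpmul2l; first exact: mule_ge0.
  rewrite ge0_integralD// mulr_natl mulr2n EFinD; exact: leeD.
have I0 : 0 <= I by apply: integral_ge0 => x _; rewrite lee_fin exprn_even_ge0.
have D0 : (0 <= gdot Omega phi phi)%R by exact: (si_ge0 (gdot_semi_inner oO bO) (test_H1 oO bO tp)).
apply: le_trans (lee_pmul I0 I0 IS IS) _.
rewrite muleACA -[X in X * _]muleACA -!EFinM.
apply: (@le_trans _ _ ((2 * 2)%:E * (4 * (L2_dot Omega phi phi * gdot Omega phi phi))%:E * ((2 * gdot Omega phi phi) * (2 * gdot Omega phi phi))%:E)).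
  apply: lee_wpmul2r; first by rewrite lee_fin !mulr_ge0.
  by apply: lee_wpmul2l.
by rewrite -!EFinM lee_fin le_eqVlt; apply/orP; left; apply/eqP; ring.
Qed.

End ladyzhenskaya_dims.

(** ** The embedding of [H10] into the space of fourth powers *)

Section fourth_power.
Context (R : realType) (d : nat) (Omega : set 'rV[R]_d).
Hypothesis mO : measurable Omega.
Notation dot := (L2_dot Omega).
Let hL := L2_semi_inner mO.

Definition sqf (u : 'rV[R]_d -> R) : 'rV[R]_d -> R := fun x => u x ^+ 2.
Definition quartic u := dot (sqf u) (sqf u).
Definition L4 u := L2 Omega u /\ L2 Omega (sqf u).

Lemma L2_mul u v : L4 u -> L4 v -> L2 Omega (fun x => u x * v x).
Proof.
move=> [[mu1 _] hu] [[mv _] hv]; split; first exact: measurable_funM.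
by have := L2_rintM mO hu hv; congr (integrable _ _ _); apply/funext => x; rewrite /= exprMn.
Qed.

Lemma dot_mul_sqr_le u v : L4 u -> L4 v ->
  dot (fun x => u x * v x) (fun x => u x * v x) ^+ 2 <= quartic u * quartic v.
Proof.
move=> [_ hu] [_ hv]; apply: le_trans (semi_inner_CS hL hu hv).
rewrite le_eqVlt; apply/orP; left; apply/eqP; congr (_ ^+ 2); apply: eq_Rintegral => x _.
by rewrite /sqf; ring.
Qed.

Lemma quartic_ge0 u : 0 <= quartic u.
Proof. by apply: Rintegral_ge0 => x _; rewrite -expr2 sqr_ge0. Qed.

Lemma quartic_mul_sqr u v : dot (fun x => u x * v x) (fun x => u x * v x) = dot (sqf u) (sqf v).
Proof. by apply: eq_Rintegral => x _; rewrite /sqf; ring. Qed.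

Lemma L2_ae_eq u w : measurable_fun Omega u -> L2 Omega w -> ae_eq (lebesgue_rV R d) Omega u w -> L2 Omega u.
Proof.
move=> mu1 [mw iw] uw; split => //; apply/integrableP.
have m (f : 'rV[R]_d -> R) : measurable_fun Omega f -> measurable_fun Omega (fun x => (f x ^+ 2)%:E).
  by move=> mf; apply/measurable_EFinP; exact: measurable_funX.
split; first exact: m.
have [_] := integrableP _ _ _ iw; congr (_ < _)%E; apply: ae_eq_integral => //.
- by apply: measurableT_comp => //; exact: m.
- by apply: measurableT_comp => //; exact: m.
- by apply: filterS uw => x h Ox /=; rewrite h.
Qed.

End fourth_power.

Lemma cvg_bounded_above (R : realType) (f : nat -> R) (l : R) : f n @[n --> \oo] --> l ->
  exists2 M : R, 0 <= M & forall n, f n <= M.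
Proof.
move=> fl; have /cvg_seq_bounded[M [Mr hM]] : cvgn f by apply/cvg_ex; exists l.
exists (`|M| + 1) => [|n]; first by rewrite addr_ge0.
apply: le_trans (ler_norm _) _; apply: hM => //.
by have := ler_norm M; lra.
Qed.

Lemma le_4mul (R : realDomainType) (x a b M : R) : x <= 2 * a + 2 * b -> a <= M -> b <= M -> x <= 4 * M.
Proof. lra. Qed.

Lemma le_exp (R : realDomainType) n (x y : R) : 0 <= x -> x <= y -> x ^+ n <= y ^+ n.
Proof. by move=> x0 xy; rewrite lerXn2r// nnegrE// (le_trans x0). Qed.

Lemma cvg_exp (R : realType) (f : nat -> R) (l : R) k : f n @[n --> \oo] --> l ->
  f n ^+ k @[n --> \oo] --> l ^+ k.
Proof.
move=> fl; elim: k => [|k IH]; first by under eq_fun do rewrite expr0; rewrite expr0; exact: cvg_cst.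
by under eq_fun do rewrite exprS; rewrite exprS; exact: cvgM.
Qed.

Section test_quartic.
Context (R : realType).
Notation mu := (lebesgue_rV R _).
Notation dot Omega := (L2_dot Omega).

Lemma test_L4 d (Omega : set 'rV[R]_d) phi : open Omega -> bounded_set Omega ->
  test_function Omega phi -> L4 Omega phi.
Proof.
move=> oO bO tp; have [M M0 hM] := test_function_bounded tp.
have mO := open_measurable_rV oO.
split; first exact: test_L2.
apply: (L2_bounded mO (bounded_measure_lty mO bO) (M := M ^+ 2)).
  by apply: measurable_funX; exact: measurable_funS (test_function_measurable tp).
by move=> x _; rewrite /sqf normrX ler_pXn2r// ?nnegrE.
Qed.

Lemma integral_test_quartic d (Omega : set 'rV[R]_d) phi : open Omega -> bounded_set Omega ->
  test_function Omega phi -> (\int[mu]_x (phi x ^+ 4)%:E)%E = (quartic Omega phi)%:E.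
Proof.
move=> oO bO tp; have [_ h] := test_L4 oO bO tp; have mO := open_measurable_rV oO.
rewrite /quartic (L2_dot_EFin mO h h) [RHS]integral_mkcond; apply: eq_integral => x _.
rewrite /patch; case: ifPn => [_|/negP]; first by congr EFin; rewrite /sqf; ring.
by rewrite inE => nx; rewrite (test_function_out tp)// expr0n.
Qed.

(** In dimensions one and two the powers of the two norms are different; the Poincare
    inequality reduces these cases to the form natural in dimension three. *)
Theorem test_ladyzhenskaya d (Omega : set 'rV[R]_d) : (1 <= d <= 3)%N -> open Omega -> bounded_set Omega ->
  exists2 K : R, 0 < K & forall phi, test_function Omega phi ->
    quartic Omega phi ^+ 2 <= K * dot Omega phi phi * gdot Omega phi phi ^+ 3.
Proof.
move=> hd oO bO; have d0 : (0 < d)%N by case/andP: hd.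
have [P P0 hP] := test_poincare oO bO d0.
have mO := open_measurable_rV oO.
have N0 phi : test_function Omega phi -> 0 <= dot Omega phi phi.
  by move=> tp; exact: (si_ge0 (L2_semi_inner mO) (test_L2 oO bO tp)).
have D0 phi : test_function Omega phi -> 0 <= gdot Omega phi phi.
  by move=> tp; exact: (si_ge0 (gdot_semi_inner oO bO) (test_H1 oO bO tp)).
case: d Omega hd oO bO d0 hP mO N0 D0 => [//|[|[|[|//]]]] Omega _ oO bO _ hP mO N0 D0.
- exists (4 * P ^+ 2) => [|phi tp]; first by rewrite mulr_gt0// exprn_gt0.
  have := ladyzhenskaya1 oO bO tp; rewrite /= (integral_test_quartic oO bO tp) -EFinM lee_fin -expr2.
  move=> /le_trans; apply.
  have := D0 _ tp; have := N0 _ tp; have := hP _ tp.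
  move: (L2_dot _ _ _) (gdot _ _ _) => N D h n0 d0.
  have h2 : N ^+ 2 <= (P * D) ^+ 2 by rewrite ler_pXn2r// nnegrE mulr_ge0// ltW.
  have := ler_wpM2l (mulr_ge0 n0 d0) h2; lra.
- exists (16 * P) => [|phi tp]; first by rewrite mulr_gt0.
  have := ladyzhenskaya2 oO bO tp; rewrite (integral_test_quartic oO bO tp) lee_fin.
  have := D0 _ tp; have := N0 _ tp; have := hP _ tp; have := quartic_ge0 Omega phi.
  move: (quartic _ _) (L2_dot _ _ _) (gdot _ _ _) => q N D q0 h n0 d0 hq.
  have h2 : q ^+ 2 <= (4 * N * D) ^+ 2 by rewrite ler_pXn2r// nnegrE !mulr_ge0.
  apply: le_trans h2 _; have := ler_wpM2l (mulr_ge0 n0 (mulr_ge0 d0 d0)) h; lra.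
- exists 64 => [|phi tp]; first by [].
  have := ladyzhenskaya3 oO bO tp.
  by rewrite /= (integral_test_quartic oO bO tp) -EFinM lee_fin -expr2.
Qed.

End test_quartic.

Section H10_quartic.
Context (R : realType) (d : nat) (Omega : set 'rV[R]_d).
Hypothesis oO : open Omega.
Hypothesis bO : bounded_set Omega.
Notation mu := (lebesgue_rV R d).
Notation dot := (L2_dot Omega).
Notation gd := (gdot Omega).
Notation quartic := (quartic Omega).
Let mO := open_measurable_rV oO.
Let Ofin := bounded_measure_lty mO bO.
Let hL := L2_semi_inner mO.
Let hg := gdot_semi_inner oO bO.

(** The square is locally Lipschitz from L2 to L1. *)
Lemma sqr_limit_ae (phi : nat -> 'rV[R]_d -> R) u w : (forall n, L4 Omega (phi n)) -> L2 Omega u ->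
  L2 Omega w -> sconv dot phi u -> sconv dot (fun n => sqf (phi n)) w -> ae_eq mu Omega (sqf u) w.
Proof.
move=> h4 hu hw cu cw; have h2 n : L2 Omega (phi n) by case: (h4 n).
have h22 n : L2 Omega (sqf (phi n)) by case: (h4 n).
pose J := \int[mu]_(x in Omega) `|sqf u x - w x|.
have iu : mu.-integrable Omega (EFin \o sqf u) by case: hu.
have iw := L2_rint mO Ofin hw.
have iJ : mu.-integrable Omega (EFin \o (fun x => `|sqf u x - w x|)).
  have := integrable_abse (rintB mO iu iw); congr (integrable _ _ _).
have J0 : 0 <= J by apply: Rintegral_ge0.
pose a n := dot (sqf (phi n) - w) (sqf (phi n) - w).
pose b n := dot (phi n - u) (phi n - u).
pose c n := dot (phi n + u) (phi n + u).
have bnd n : J ^+ 2 <= 2 * (fine (mu Omega) * a n) + 2 * (b n * c n).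
  have hBw := siB hL (h22 n) hw; have hB := siB hL (h2 n) hu; have hD := siD hL (h2 n) hu.
  have hA1 := L2_abs hB; have hA2 := L2_abs hD.
  pose J1 := \int[mu]_(x in Omega) `|(sqf (phi n) - w) x|.
  pose J2 := dot (fun x => `|(phi n - u) x|) (fun x => `|(phi n + u) x|).
  have j1 : J1 ^+ 2 <= fine (mu Omega) * a n by exact: Rintegral_abs_sqr_le.
  have j2 : J2 ^+ 2 <= b n * c n.
    have := semi_inner_CS hL hA1 hA2.
    have e (f : 'rV[R]_d -> R) : dot (fun x => `|f x|) (fun x => `|f x|) = dot f f.
      by apply: eq_Rintegral => x _; rewrite -normrM ger0_norm// -expr2 sqr_ge0.
    by rewrite !e.
  have jj : J <= J1 + J2.
    have i1 := integrable_abse (L2_rint mO Ofin hBw).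
    have i2 := L2_rintM mO hA1 hA2.
    rewrite /J1 /J2 /L2_dot -RintegralD//; apply: le_Rintegral => //; first exact: (rintD mO i1 i2).
    move=> x Ox; rewrite -normrM -[(phi n - u) x]/(phi n x - u x) -[(phi n + u) x]/(phi n x + u x).
    rewrite -[(sqf (phi n) - w) x]/(phi n x ^+ 2 - w x) /sqf.
    rewrite (_ : u x ^+ 2 - w x = (phi n x ^+ 2 - w x) - (phi n x - u x) * (phi n x + u x)); last by ring.
    exact: ler_normB.
  have J10 : 0 <= J1 by apply: Rintegral_ge0.
  have J20 : 0 <= J2 by apply: Rintegral_ge0 => x _; exact: mulr_ge0.
  have : J ^+ 2 <= (J1 + J2) ^+ 2 by rewrite ler_pXn2r// nnegrE addr_ge0.
  by have := sqr_ge0 (J1 - J2); lra.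
have cc : c n @[n --> \oo] --> dot (u + u) (u + u).
  have hDD n := siD hL (h2 n) hu.
  apply: (cvg_dot hL hDD hDD (siD hL hu hu) (siD hL hu hu));
    exact: (sconvD hL h2 (fun=> hu) hu hu cu (sconv_cst hL hu)).
have lim0 : 2 * (fine (mu Omega) * a n) + 2 * (b n * c n) @[n --> \oo] --> 0.
  have e : 2 * (fine (mu Omega) * 0) + 2 * (0 * dot (u + u) (u + u)) = 0 by ring.
  apply: (cvg_to_eq e); apply: cvgD; apply: cvgMr; last exact: cvgM.
  exact: cvgMr.
have J2 : J ^+ 2 <= 0.
  by apply: (ler_cvg_to (cvg_cst (J ^+ 2)) lim0); exact: nearW.
have {J2} Je : J = 0 by apply/eqP; rewrite -sqrf_eq0 eq_le J2 sqr_ge0.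
have mJ : measurable_fun Omega (EFin \o (fun x => sqf u x - w x)).
  by apply/measurable_EFinP; exact: measurable_funB (rint_measurable iu) (rint_measurable iw).
have : (\int[mu]_(x in Omega) `|(EFin \o (fun x => sqf u x - w x)%R) x|)%E = 0%E.
  transitivity (J%:E); last by rewrite Je.
  by rewrite /J /Rintegral fineK//; apply: integrable_fin_num.
move/(ae_eq_integral_abs mu mO mJ); apply: filterS => x h Ox.
by have /= [] := h Ox; move/eqP; rewrite subr_eq0 => /eqP.
Qed.

(** The squares of approximating test functions form a Cauchy sequence in L2, because
    [f ^ 2 - g ^ 2 = (f - g) (f + g)] and both factors are controlled by
    [test_ladyzhenskaya]; its limit is the square of [u]. *)
Theorem ladyzhenskaya : (1 <= d <= 3)%N -> exists2 K : R, 0 < K & forall u, H10 Omega u ->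
  L4 Omega u /\ quartic u ^+ 2 <= K * dot u u * gd u u ^+ 3.
Proof.
move=> hd; have [K K0 hK] := test_ladyzhenskaya hd oO bO; exists K => // u hu.
have [phi tp cphi] := H10_approx oO bO hu.
have H1p n := test_H1 oO bO (tp n); have H1u := H10_H1 hu.
have [cg cd] := sconv_h1dot_gdot oO bO H1p H1u cphi.
have h2 n := H1_L2 (H1p n); have hu2 := H1_L2 H1u.
have h4 n := test_L4 oO bO (tp n).
have cg' := cvg_sqr_norm hg H1p H1u cg; have cd' := cvg_sqr_norm hL h2 hu2 cd.
have [M M0 hM] := cvg_bounded_above cg'; have [M1 M10 hM1] := cvg_bounded_above cd'.
pose K2 := K * (4 * M1) * (4 * M) ^+ 3.
have K20 : 0 <= K2 by rewrite !mulr_ge0// ?exprn_ge0// ?mulr_ge0// ltW.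
have g0 v : H1 Omega v -> 0 <= gd v v by move=> hv; exact: (si_ge0 hg hv).
have d0 v : L2 Omega v -> 0 <= dot v v by move=> hv; exact: (si_ge0 hL hv).
have tB m n : test_function Omega (phi m - phi n).
  by rewrite addrC -scaleN1r; exact: test_function_lin.
have tD m n : test_function Omega (phi m + phi n).
  by rewrite -[phi m]scale1r; exact: test_function_lin.
have gB m n : gd (phi m - phi n) (phi m - phi n) <= 4 * M.
  have := parallelogram_le hg (H1p m) (siN hg (H1p n)); rewrite -[- phi n]scaleN1r.
  rewrite (dotZl hg (-1) (H1p n) (siZ hg (-1) (H1p n))) (dotZr hg (-1) (H1p n) (H1p n)).
  by rewrite !mulN1r opprK => /le_4mul; apply.
have gD m n : gd (phi m + phi n) (phi m + phi n) <= 4 * M.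
  exact: le_4mul (parallelogram_le hg (H1p m) (H1p n)) (hM m) (hM n).
have dD m n : dot (phi m + phi n) (phi m + phi n) <= 4 * M1.
  exact: le_4mul (parallelogram_le hL (h2 m) (h2 n)) (hM1 m) (hM1 n).
have qle m n : dot (sqf (phi m) - sqf (phi n)) (sqf (phi m) - sqf (phi n)) ^+ 4 <=
    K2 * (K * (4 * M) ^+ 3 * dot (phi m - phi n) (phi m - phi n)).
  have -> : sqf (phi m) - sqf (phi n) = fun x => (phi m - phi n) x * (phi m + phi n) x.
    apply/funext => x; rewrite -[LHS]/(phi m x ^+ 2 - phi n x ^+ 2).
    by rewrite -[RHS]/((phi m x - phi n x) * (phi m x + phi n x)); ring.
  have hB4 := test_L4 oO bO (tB m n); have hD4 := test_L4 oO bO (tD m n).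
  have h := dot_mul_sqr_le mO hB4 hD4.
  have qB0 := quartic_ge0 Omega (phi m - phi n); have qD0 := quartic_ge0 Omega (phi m + phi n).
  have qB := hK _ (tB m n); have qD := hK _ (tD m n).
  have dB0 := d0 _ (test_L2 oO bO (tB m n)); have dD0 := d0 _ (test_L2 oO bO (tD m n)).
  have gB0 := g0 _ (test_H1 oO bO (tB m n)); have gD0 := g0 _ (test_H1 oO bO (tD m n)).
  have qD' : quartic (phi m + phi n) ^+ 2 <= K2.
    apply: le_trans qD _; apply: ler_pM => //; [by rewrite mulr_ge0// ltW|by rewrite exprn_ge0|..].
    - by apply: ler_wpM2l; [exact: ltW|exact: dD].
    - exact: le_exp gD0 (gD m n).
  have qB' : quartic (phi m - phi n) ^+ 2 <= K * (4 * M) ^+ 3 * dot (phi m - phi n) (phi m - phi n).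
    apply: le_trans qB _; rewrite [leRHS]mulrAC; apply: ler_wpM2l; first by rewrite mulr_ge0// ltW.
    exact: le_exp gB0 (gB m n).
  rewrite -[4%N]/(2 * 2)%N exprM.
  have : (dot (fun x => (phi m - phi n) x * (phi m + phi n) x) (fun x => (phi m - phi n) x * (phi m + phi n) x) ^+ 2) ^+ 2 <=
    (quartic (phi m - phi n) * quartic (phi m + phi n)) ^+ 2.
    by rewrite ler_pXn2r// nnegrE ?sqr_ge0// mulr_ge0.
  move=> /le_trans; apply; rewrite exprMn mulrC; apply: ler_pM => //; exact: sqr_ge0.
have [w hw cw] : exists2 w, L2 Omega w & forall e : R, 0 < e -> exists N, forall n, (N <= n)%N ->
    dot (sqf (phi n) - w) (sqf (phi n) - w) < e.
  apply: (L2_complete mO Ofin) => [n|e e0]; first by case: (h4 n).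
  pose K3 := K2 * (K * (4 * M) ^+ 3); have K30 : 0 <= K3.
    by rewrite !mulr_ge0// ?exprn_ge0// ?mulr_ge0// ltW.
  have [|N hN] := (sconvP (fun n => d0 _ (siB hL (h2 n) hu2))).1 cd (e ^+ 4 / (4 * K3 + 1)).
    by rewrite divr_gt0 ?exprn_gt0// ltr_wpDl// mulr_ge0.
  exists N => m n Nm Nn; rewrite -(@ltr_pXn2r _ 4)// ?nnegrE ?(ltW e0)//; last first.
    by apply: d0; apply: (siB hL); [case: (h4 m)|case: (h4 n)].
  apply: le_lt_trans (qle m n) _; rewrite mulrA -/K3.
  have dB : dot (phi m - phi n) (phi m - phi n) <= 4 * (e ^+ 4 / (4 * K3 + 1)).
    have hm := siB hL (h2 m) hu2; have hn := siB hL (h2 n) hu2.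
    have -> : phi m - phi n = (phi m - u) + (-1) *: (phi n - u).
      by rewrite scaleN1r opprB addrA subrK.
    have := parallelogram_le hL hm (siZ hL (-1) hn).
    rewrite (dotZl hL (-1) hn (siZ hL (-1) hn)) (dotZr hL (-1) hn hn).
    by rewrite !mulN1r opprK => /le_4mul; apply; exact/ltW/hN.
  apply: le_lt_trans (ler_wpM2l K30 dB) _.
  have K31 : 0 < 4 * K3 + 1 by rewrite ltr_wpDl// mulr_ge0.
  rewrite (_ : K3 * _ = e ^+ 4 * (4 * K3) / (4 * K3 + 1)); last by ring.
  by rewrite ltr_pdivrMr// ltr_pM2l ?exprn_gt0// ltrDl.
have cw' : sconv dot (fun n => sqf (phi n)) w.
  by apply/sconvP => // n; apply: d0; apply: (siB hL) => //; case: (h4 n).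
have uw := sqr_limit_ae h4 hu2 hw cd cw'.
have hsu : L2 Omega (sqf u).
  apply: (L2_ae_eq mO _ hw uw); apply: measurable_funX; by case: hu2.
have qu : quartic u = dot w w by apply: ae_eq_L2_dot.
split=> //; rewrite qu.
have c1 : quartic (phi n) ^+ 2 @[n --> \oo] --> dot w w ^+ 2.
  have h := cvg_sqr_norm hL (fun n => (h4 n).2) hw cw'.
  exact: cvg_exp h.
have c2 : K * dot (phi n) (phi n) * gd (phi n) (phi n) ^+ 3 @[n --> \oo] --> K * dot u u * gd u u ^+ 3.
  by apply: cvgM; [exact: cvgMr cd'|exact: cvg_exp cg'].
by apply: (ler_cvg_to c1 c2); apply: nearW => n; exact: hK.
Qed.

End H10_quartic.

(** * Rellich compactness *)

Section box_average.
Context (R : realType) (d : nat).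
Notation mu := (lebesgue_rV R d).
Context (h : R) (h0 : 0 < h).

Definition corner_box : set 'rV[R]_d := [set y | forall i, `]0, h]%classic (rV_coord i y)].
Notation B := corner_box.

Lemma measurable_corner_box : measurable B.
Proof. by apply: (@measurable_box _ _ (fun=> `]0, h]%classic)) => i; exact: measurable_itv. Qed.

Lemma corner_box_measure : mu B = (h ^+ d)%:E.
Proof.
rewrite (lebesgue_rV_box (A := fun=> `]0, h]%classic)); last by move=> i; exact: measurable_itv.
rewrite -[in RHS](card_ord d) -prodr_const -prodEFin; apply: eq_bigr => i _.
by rewrite lebesgue_measure_itv/= lte_fin h0 sube0.
Qed.

Lemma fine_corner_box : fine (mu B) = h ^+ d.
Proof. by rewrite corner_box_measure. Qed.

Lemma corner_box_lty : (mu B < +oo)%E.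
Proof. by rewrite corner_box_measure ltry. Qed.

Definition box_average (phi : 'rV[R]_d -> R) x := \int[mu]_(y in B) phi (x + y).

Context (phi : 'rV[R]_d -> R) (M : R).
Hypothesis mphi : measurable_fun setT phi.
Hypothesis phiM : forall x, `|phi x| <= M.

Let mB := measurable_corner_box.
Let Bfin := corner_box_lty.
Let m1B : measurable_fun setT (\1_B : 'rV[R]_d -> R).
Proof. exact: measurable_indic. Qed.

Lemma measurable_addl_rV x : measurable_fun setT (fun y : 'rV[R]_d => phi (x + y)).
Proof.
rewrite (_ : (fun y => _) = phi \o (fun y => y + x)); last by apply/funext => y /=; rewrite addrC.
exact: measurableT_comp mphi (measurable_shift_rV _).
Qed.

Lemma measurable_add_rV : measurable_fun setT (fun p : 'rV[R]_d * 'rV[R]_d => p.1 + p.2).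
Proof.
apply: measurable_fun_rV => i.
rewrite (_ : _ \o _ = fun p => rV_coord i p.1 + rV_coord i p.2); last first.
  by apply/funext => p; rewrite /rV_coord /= mxE.
apply: measurable_funD.
  exact: measurableT_comp (@measurable_rV_coord R d i) measurable_fst.
exact: measurableT_comp (@measurable_rV_coord R d i) measurable_snd.
Qed.

Lemma rint_box x : mu.-integrable B (EFin \o (fun y => phi (x + y))).
Proof.
apply: (L2_rint mB Bfin); apply: (L2_bounded mB Bfin (M := M)) => [|y _]; last exact: phiM.
exact: measurable_funS (measurable_addl_rV x).
Qed.

Lemma measurable_box_average : measurable_fun setT (box_average phi).
Proof.
pose F (p : 'rV[R]_d * 'rV[R]_d) := ((phi (p.1 + p.2) + M) * \1_B p.2)%:E.
have mF : measurable_fun setT F.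
  apply/measurable_EFinP; apply: measurable_funM.
    by apply: measurable_funD => //; exact: measurableT_comp mphi measurable_add_rV.
  exact: measurableT_comp m1B measurable_snd.
have F0 p : (0 <= F p)%E.
  rewrite lee_fin; apply: mulr_ge0; last by rewrite indicE.
  by have := phiM (p.1 + p.2); rewrite ler_norml => /andP[]; lra.
have mG := measurable_fun_fubini_tonelli_F (m2 := mu) F mF F0.
have FE x : (\int[mu]_y F (x, y) = \int[mu]_(y in B) (phi (x + y) + M)%:E)%E.
  rewrite [RHS]integral_mkcond; apply: eq_integral => y _.
  by rewrite /F /= /patch indicE; case: ifP => _; rewrite ?mulr1 ?mulr0.
rewrite (_ : box_average phi = fun x => fine (\int[mu]_y F (x, y))%E - M * fine (mu B)); last first.
  apply/funext => x; rewrite /box_average FE.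
  have -> : fine (\int[mu]_(y in B) (phi (x + y) + M)%:E)%E = \int[mu]_(y in B) (phi (x + y) + M) by [].
  rewrite RintegralD//; [|exact: rint_box|exact: (rint_cst mB Bfin)].
  by rewrite Rintegral_cst// addrK.
apply: measurable_funB => //.
apply/measurable_EFinP; rewrite (_ : _ \o _ = fun x => \int[mu]_y F (x, y))%E//.
apply/funext => x /=; rewrite fineK// FE; apply: integrable_fin_num => //.
exact: (rintD mB (rint_box x) (rint_cst mB Bfin M)).
Qed.

Lemma box_average_le x : `|box_average phi x| <= M * h ^+ d.
Proof.
apply: le_trans (le_normr_Rintegral _ _) _ => //; first exact: rint_box.
have -> : M * h ^+ d = \int[mu]_(y in B) M by rewrite Rintegral_cst// fine_corner_box.
have i1 : mu.-integrable B (EFin \o (fun y => `|phi (x + y)|)).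
  by have := integrable_abse (rint_box x); congr (integrable _ _ _).
have i2 := rint_cst mB Bfin M.
by apply: (le_Rintegral mB i1 i2) => y _; exact: phiM.
Qed.

(** Cauchy--Schwarz on the box, then Tonelli. *)
Lemma box_average_dist_le (C : R) :
  (forall y, B y -> \int[mu]_x ((phi (x + y)%R - phi x) ^+ 2)%:E <= C%:E)%E ->
  (\int[mu]_x ((h ^+ d * phi x - box_average phi x) ^+ 2)%:E <= ((h ^+ d) ^+ 2 * C)%:E)%E.
Proof.
move=> hC.
pose F (p : 'rV[R]_d * 'rV[R]_d) := ((phi (p.1 + p.2) - phi p.1) ^+ 2 * \1_B p.2)%:E.
have mF : measurable_fun setT F.
  apply/measurable_EFinP; apply: measurable_funM; last first.
    exact: measurableT_comp m1B measurable_snd.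
  apply: measurable_funX; apply: measurable_funB; first exact: measurableT_comp mphi measurable_add_rV.
  exact: measurableT_comp mphi measurable_fst.
have F0 p : (0 <= F p)%E.
  by rewrite lee_fin; apply: mulr_ge0; rewrite ?sqr_ge0// indicE.
have FB x : (\int[mu]_y F (x, y) = \int[mu]_(y in B) ((phi (x + y) - phi x) ^+ 2)%:E)%E.
  rewrite [RHS]integral_mkcond; apply: eq_integral => y _.
  by rewrite /F /= /patch indicE; case: ifP => _; rewrite ?mulr1 ?mulr0.
have pt x : (((h ^+ d * phi x - box_average phi x) ^+ 2)%:E <= (h ^+ d)%:E * \int[mu]_y F (x, y))%E.
  pose u y := phi (x + y) - phi x.
  have mu1 : measurable_fun setT u.
    by apply: measurable_funB => //; exact: measurable_addl_rV.
  have hu : L2 B u.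
    apply: (L2_bounded mB Bfin (M := M + M)) => [|y _]; first exact: measurable_funS mu1.
    by apply: le_trans (ler_normB _ _) _; apply: lerD.
  have e : h ^+ d * phi x - box_average phi x = - \int[mu]_(y in B) u y.
    rewrite /u RintegralB//; [|exact: rint_box|exact: (rint_cst mB Bfin)].
    by rewrite Rintegral_cst// fine_corner_box opprB mulrC.
  rewrite e sqrrN FB.
  have -> : (\int[mu]_(y in B) ((phi (x + y) - phi x) ^+ 2)%:E = (L2_dot B u u)%:E)%E.
    by rewrite (L2_dot_EFin mB hu hu); apply: eq_integral => y _; rewrite expr2.
  rewrite -EFinM lee_fin.
  have := Rintegral_abs_sqr_le mB Bfin hu; rewrite fine_corner_box.
  apply: le_trans; rewrite -[leLHS]real_normK ?num_real//; apply: le_exp => //.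
  by apply: le_normr_Rintegral => //; exact: (L2_rint mB Bfin hu).
have mA := measurable_box_average.
have hd0 : (0 <= (h ^+ d)%:E)%E by rewrite lee_fin exprn_ge0// ltW.
have mG := measurable_fun_fubini_tonelli_F (m2 := mu) F mF F0.
have G0 x : (0 <= \int[mu]_y F (x, y))%E by apply: integral_ge0.
apply: (@le_trans _ _ (\int[mu]_x ((h ^+ d)%:E * \int[mu]_y F (x, y)))%E).
  apply: ge0_le_integral => //.
  - by move=> x _; rewrite lee_fin sqr_ge0.
  - apply/measurable_EFinP; apply: measurable_funX; apply: measurable_funB => //.
    exact: measurable_funM.
  - by apply: emeasurable_funM.
rewrite ge0_integralZl// fubini_tonelli//.
rewrite expr2 -mulrA [leRHS]EFinM; apply: lee_wpmul2l => //.
apply: (@le_trans _ _ (\int[mu]_(y in B) C%:E)%E); last first.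
  have -> : (\int[mu]_(y in B) C%:E = C%:E * mu B)%E by exact: integral_cst.
  by rewrite corner_box_measure -EFinM mulrC.
rewrite [leRHS]integral_mkcond; apply: ge0_le_integral => //.
- by move=> y _; apply: integral_ge0.
- exact: (measurable_fun_fubini_tonelli_G (m1 := mu) F mF F0).
- by have /(measurable_restrictT _ mB) := @measurable_cst _ _ _ _ B (C%:E : \bar R).
- move=> y _; rewrite /patch; case: ifPn => [|nB].
    rewrite inE => By; apply: le_trans (hC y By).
    by under eq_integral do rewrite /F /= indicE mem_set// mulr1.
  under eq_integral do rewrite /F /= indicE (negbTE nB) mulr0.
  by rewrite integral0.
Qed.

End box_average.

Lemma dot_le_sub (R : realType) (X : lmodType R) (H : X -> Prop) (dot : X -> X -> R) u v :
  semi_inner H dot -> H u -> H v -> dot v v <= 2 * dot u u + 2 * dot (u - v) (u - v).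
Proof.
move=> hd Hu Hv; have Hb := siB hd Hu Hv; have := parallelogram_le hd Hu (siN hd Hb).
rewrite -scaleN1r (dotZl hd (-1) Hb (siZ hd (-1) Hb)) (dotZr hd (-1) Hb Hb) !mulN1r opprK.
by rewrite scaleN1r opprB addrC subrK.
Qed.

Section rellich.
Context (R : realType) (d : nat) (Omega : set 'rV[R]_d).
Hypothesis oO : open Omega.
Hypothesis bO : bounded_set Omega.
Notation e_ i := (delta_mx ord0 i : 'rV[R]_d).
Notation mu := (lebesgue_rV R d).
Notation dot := (L2_dot Omega).
Notation gd := (gdot Omega).
Notation B := corner_box.
Let mO := open_measurable_rV oO.
Let Ofin := bounded_measure_lty mO bO.
Let hL := L2_semi_inner mO.
Let hg := gdot_semi_inner oO bO.

(** A translation is a composition of translations along the axes, each of which is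
    controlled by a partial derivative. *)
Lemma test_shift_sum (s : seq 'I_d) (phi : 'rV[R]_d -> R) (y : 'I_d -> R) h : test_function Omega phi ->
  (forall i, 0 < y i <= h) ->
  (\int[mu]_x ((phi (x + \sum_(i <- s) y i *: e_ i)%R - phi x) ^+ 2)%:E <=
   ((2 ^+ (size s).+1 - 2) * (h ^+ 2 * gd phi phi))%:E)%E.
Proof.
move=> tp hy; have mphi : measurable_fun setT phi by exact: (test_function_measurable tp).
have msh (v : 'rV[R]_d) : measurable_fun setT (fun x : 'rV[R]_d => phi (x + v)).
  exact: measurableT_comp mphi (measurable_shift_rV v).
have mT (v : 'rV[R]_d) : measurable_fun setT (fun x : 'rV[R]_d => ((phi (x + v) - phi x) ^+ 2)%:E).
  by apply/measurable_EFinP; apply: measurable_funX; exact: measurable_funB.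
have g0 : 0 <= gd phi phi by exact: (si_ge0 hg (test_H1 oO bO tp)).
elim: s => [|i s IH].
  under eq_integral do rewrite big_nil addr0 subrr expr0n.
  by rewrite integral0 expr1 subrr mul0r.
set b := \sum_(j <- s) _ in IH *; have /andP[y0 yh] := hy i.
have Ti := test_shift_sqr_le oO bO i y0 tp.
set a := y i *: e_ i in Ti; rewrite big_cons -/a -/b.
apply: (@le_trans _ _ (\int[mu]_x (2%:E * ((phi (x + b + a) - phi (x + b)) ^+ 2)%:E + 2%:E * ((phi (x + b) - phi x) ^+ 2)%:E)))%E.
  apply: ge0_le_integral => //.
  - by move=> x _; rewrite lee_fin sqr_ge0.
  - apply: emeasurable_funD; apply: emeasurable_funM => //.
    exact: (measurableT_comp (mT a) (measurable_shift_rV b)).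
  - move=> x _; rewrite -!EFinM -EFinD lee_fin addrA [x + a + b]addrAC.
    by have := sqr_ge0 ((phi (x + b + a) - phi (x + b)) - (phi (x + b) - phi x)); lra.
have n0 (v w : 'rV[R]_d) : (0 <= ((phi v - phi w) ^+ 2)%:E)%E by rewrite lee_fin sqr_ge0.
rewrite ge0_integralD//; last 4 first.
- by move=> x _; exact: mule_ge0.
- by apply: emeasurable_funM => //; exact: (measurableT_comp (mT a) (measurable_shift_rV b)).
- by move=> x _; exact: mule_ge0.
- exact: emeasurable_funM.
rewrite !ge0_integralZl//; last exact: (measurableT_comp (mT a) (measurable_shift_rV b)).
rewrite (ge0_integral_shift b (f := fun z => ((phi (z + a) - phi z) ^+ 2)%:E))//.
have -> : (2 ^+ (size (i :: s)).+1 - 2) * (h ^+ 2 * gd phi phi) =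
   2 * (h ^+ 2 * gd phi phi) + 2 * ((2 ^+ (size s).+1 - 2) * (h ^+ 2 * gd phi phi)).
  by rewrite [size _]/= [2 ^+ (size s).+2]exprS; ring.
rewrite [leRHS]EFinD [in leRHS]EFinM [X in (_ <= _ + X)%E]EFinM; apply: leeD; apply: lee_wpmul2l => //.
apply: le_trans Ti _; rewrite lee_fin; apply: ler_pM.
- exact: sqr_ge0.
- exact: (si_ge0 hL (test_L2 oO bO (test_function_partial i tp))).
- by apply: le_exp => //; exact: ltW.
- exact: test_dot_partial_le.
Qed.

(** A test function is close in L2 to its averages over small boxes, at a rate that only
    depends on its gradient. *)
Lemma test_average_le (phi : 'rV[R]_d -> R) h : 0 < h -> test_function Omega phi ->
  (h ^+ d) ^+ 2 * dot phi phi <= 2 * ((h ^+ d) ^+ 2 * (2 ^+ d.+1 * (h ^+ 2 * gd phi phi))) +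
    2 * dot (box_average h phi) (box_average h phi).
Proof.
move=> h0 tp; have [M M0 hM] := test_function_bounded tp.
have mphi : measurable_fun setT phi by exact: (test_function_measurable tp).
have hp := test_L2 oO bO tp; have g0 : 0 <= gd phi phi by exact: (si_ge0 hg (test_H1 oO bO tp)).
have mA := measurable_box_average h0 mphi hM.
have hA : L2 Omega (box_average h phi).
  apply: (L2_bounded mO Ofin (M := M * h ^+ d)) => [|x _]; first exact: measurable_funS mA.
  exact: box_average_le.
have hmp := siZ hL (h ^+ d) hp; have hB := siB hL hmp hA.
have -> : (h ^+ d) ^+ 2 * dot phi phi = dot (h ^+ d *: phi) (h ^+ d *: phi).
  by rewrite (dotZl hL _ hp hmp) (dotZr hL _ hp hp); ring.
have := dot_le_sub hL hA hmp; rewrite addrC => /le_trans; apply; rewrite lerD2r ler_pM2l//.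
have hBA := siB hL hA hmp.
rewrite -lee_fin (L2_dot_EFin mO hBA hBA).
have hC y : B h y -> (\int[mu]_x ((phi (x + y)%R - phi x) ^+ 2)%:E <= (2 ^+ d.+1 * (h ^+ 2 * gd phi phi))%:E)%E.
  move=> By; have hy i : 0 < y ord0 i <= h by have := By i; rewrite /= in_itv.
  have := test_shift_sum (index_enum 'I_d) tp hy; rewrite -(row_sum_delta y) => /le_trans; apply.
  rewrite lee_fin; apply: ler_wpM2r; first by rewrite mulr_ge0// sqr_ge0.
  have -> : size (index_enum 'I_d) = d by rewrite -sum1_size -[RHS]card_ord -sum1_card; apply: eq_bigl.
  by rewrite lerBlDr lerDl.
apply: le_trans (box_average_dist_le h0 mphi hM hC).
have mD : measurable_fun setT (fun x : 'rV[R]_d => (h ^+ d * phi x - box_average h phi x) ^+ 2).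
  by apply: measurable_funX; apply: measurable_funB => //; exact: measurable_funM.
apply: le_trans (_ : \int[mu]_(x in Omega) ((h ^+ d * phi x - box_average h phi x) ^+ 2)%:E <= _)%E.
  rewrite le_eqVlt; apply/orP; left; apply/eqP; apply: eq_integral => x _; congr EFin.
  by rewrite -[(_ - _) x]/(box_average h phi x - h ^+ d * phi x); ring.
apply: ge0_subset_integral => //; first exact/measurable_EFinP.
by move=> x _; rewrite lee_fin sqr_ge0.
Qed.

Definition box_at h x : 'rV[R]_d -> R := fun z => \1_(B h) (z - x).

Lemma box_at_L2 h x : L2 Omega (box_at h x).
Proof.
apply: (L2_bounded mO Ofin (M := 1)) => [|z _]; last by rewrite /box_at indicE; case: (_ \in _); rewrite ?normr1 ?normr0.
have m1 : measurable_fun setT (\1_(B h) : 'rV[R]_d -> R).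
  by apply: measurable_indic; exact: measurable_corner_box.
have := measurableT_comp m1 (measurable_shift_rV (- x)); exact: measurable_funS.
Qed.

Lemma dot_box_at_le h x : dot (box_at h x) (box_at h x) <= fine (mu Omega).
Proof.
have -> : fine (mu Omega) = \int[mu]_(x in Omega) 1 by rewrite Rintegral_cst// mul1r.
have i1 := L2_rintM mO (box_at_L2 h x) (box_at_L2 h x); have i2 := rint_cst mO Ofin 1.
apply: (le_Rintegral mO i1 i2) => z _.
by rewrite /box_at indicE; case: (_ \in _); rewrite ?mulr1 ?mulr0.
Qed.

(** The average at a point is a continuous linear functional, to which weak convergence
    applies. *)
Lemma box_averageE h (phi : 'rV[R]_d -> R) x : test_function Omega phi ->
  box_average h phi x = dot (box_at h x) phi.
Proof.
move=> tp; pose f z := box_at h x z * phi z.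
have mphi : measurable_fun setT phi by exact: (test_function_measurable tp).
have m1 : measurable_fun setT (\1_(B h) : 'rV[R]_d -> R).
  by apply: measurable_indic; exact: measurable_corner_box.
have mf : measurable_fun setT f.
  by apply: measurable_funM => //; exact: measurableT_comp m1 (measurable_shift_rV (- x)).
transitivity (\int[mu]_z f z); last first.
  by apply: Rintegral_supp => z nz; rewrite /f (test_function_out tp) ?mulr0.
rewrite -(Rintegral_shift x mf) /box_average Rintegral_mkcond; apply: eq_Rintegral => y _.
rewrite /f /box_at addrK /patch indicE [x + y]addrC.
by case: ifP => _; rewrite ?mul1r ?mul0r.
Qed.

Lemma box_at_dual h x : (0 < d)%N -> H10_dual Omega (dot (box_at h x)).
Proof.
move=> d0; have [P P0 hP] := poincare oO bO d0; have hb := box_at_L2 h x; split.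
  move=> a u v hu hv; have hu2 := H10_L2 hu; have hv2 := H10_L2 hv.
  rewrite -[_ \+ _]/(a *: u + v) (dotDr hL (siZ hL a hu2) hv2 hb).
  by rewrite (dotZr hL a hu2 hb).
exists (Num.sqrt (fine (mu Omega) * P)) => u hu; have hu2 := H10_L2 hu.
rewrite (H10_normE oO (H10_H1 hu)) -sqrtrM; last by apply: mulr_ge0; [exact: fine_ge0|exact: ltW].
rewrite -sqrtr_sqr; apply: ler_wsqrtr.
apply: le_trans (semi_inner_CS hL hb hu2) _; rewrite -mulrA; apply: ler_pM.
- exact: (si_ge0 hL hb).
- exact: (si_ge0 hL hu2).
- exact: dot_box_at_le.
- exact: hP.
Qed.

(** The [v n] are replaced by nearby test functions. Their averages over boxes of a fixed
    size tend to zero pointwise by weak convergence, hence in L2 by dominated convergence,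
    and their distance to these averages is uniformly small with the size of the boxes. *)
Theorem rellich (v : nat -> 'rV[R]_d -> R) (M : R) : (0 < d)%N -> (forall n, H10 Omega (v n)) ->
  (forall n, gd (v n) (v n) <= M) ->
  (forall l, H10_dual Omega l -> l (v n) @[n --> \oo] --> 0) ->
  dot (v n) (v n) @[n --> \oo] --> 0.
Proof.
move=> d0 hv vM wv; have [P P0 hP] := poincare oO bO d0.
have h1 := h1dot_semi_inner oO bO.
have /choice[phi phiP] (n : nat) : exists phi, test_function Omega phi /\
    h1dot Omega (v n - phi) (v n - phi) < n.+1%:R^-1.
  have n0 : 0 < n.+1%:R^-1 :> R by rewrite invr_gt0.
  by have [phi tp hp] := ((H10P oO bO (v n)).1 (hv n)).2 _ n0; exists phi.
have tp n : test_function Omega (phi n) by case: (phiP n).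
have H1p n := test_H1 oO bO (tp n); have H1v n := H10_H1 (hv n).
have Hp n := test_H10 oO bO (tp n).
have L2p n := H1_L2 (H1p n); have L2v n := H1_L2 (H1v n).
have Hd n := siB h1 (H1v n) (H1p n).
have d1 n : dot (v n - phi n) (v n - phi n) <= n.+1%:R^-1.
  by apply: le_trans (L2_dot_le_h1dot oO bO (Hd n)) _; apply: ltW; case: (phiP n).
have n1 n : n.+1%:R^-1 <= 1 :> R by rewrite invf_le1// ler1n.
pose M' := 2 * M + 2.
have gM n : gd (phi n) (phi n) <= M'.
  apply: le_trans (dot_le_sub hg (H1v n) (H1p n)) _.
  have := le_trans (gdot_le_h1dot oO (Hd n)) (le_trans (ltW (proj2 (phiP n))) (n1 n)).
  by move=> le1; apply: lerD; [|rewrite -[leRHS]mulr1]; rewrite ler_pM2l.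
have M'0 : 0 <= M' by apply: le_trans (gM 0%N); exact: (si_ge0 hg (H1p 0%N)).
have dM n : dot (phi n) (phi n) <= P * M'.
  by apply: le_trans (hP _ (Hp n)) _; rewrite ler_pM2l.
have avg0 h : 0 < h -> dot (box_average h (phi n)) (box_average h (phi n)) @[n --> \oo] --> 0.
  move=> h0; pose A n := box_average h (phi n).
  have AE n x : A n x = dot (box_at h x) (phi n) by exact: box_averageE.
  have mA n : measurable_fun Omega (A n).
    have [N _ hN] := test_function_bounded (tp n).
    apply: measurable_funS (measurable_box_average h0 _ hN) => //.
    exact: test_function_measurable (tp n).
  have Ale n x : A n x ^+ 2 <= fine (mu Omega) * (P * M').
    have hb := box_at_L2 h x; rewrite AE; apply: le_trans (semi_inner_CS hL hb (L2p n)) _.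
    apply: ler_pM; [exact: (si_ge0 hL hb)|exact: (si_ge0 hL (L2p n))|exact: dot_box_at_le|exact: dM].
  have A0 x : A n x @[n --> \oo] --> 0.
    have hb := box_at_L2 h x.
    have E n : A n x = dot (box_at h x) (v n) - dot (box_at h x) (v n - phi n).
      by rewrite AE (dotBr hL (L2v n) (L2p n) hb); ring.
    under eq_fun do rewrite E; apply: (cvg_to_eq (subr0 0)); apply: cvgB.
      exact: (wv _ (box_at_dual h x d0)).
    apply: (@cvg0_of_sqr_le _ _ (fun n => fine (mu Omega) * n.+1%:R^-1)) => [n|].
      have L2d := siB hL (L2v n) (L2p n); apply: le_trans (semi_inner_CS hL hb L2d) _.
      apply: ler_pM; [exact: (si_ge0 hL hb)|exact: (si_ge0 hL L2d)|exact: dot_box_at_le|exact: d1].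
    by apply: (cvg_to_eq (mulr0 (fine (mu Omega)))); apply: cvgMr; exact: cvg_harmonic.
  have hA n : L2 Omega (A n).
    have [N N0 hN] := test_function_bounded (tp n).
    apply: (L2_bounded mO Ofin (M := N * h ^+ d)) => // x _.
    exact: (box_average_le h0 (test_function_measurable (tp n)) hN).
  have E : (fun n => \int[mu]_(x in Omega) (A n x * A n x)%:E)%E = EFin \o (fun n => dot (A n) (A n)).
    by apply/funext => n; rewrite /= (L2_dot_EFin mO (hA n) (hA n)).
  have := @dominated_cvg _ _ _ mu Omega mO (fun n x => (A n x * A n x)%:E) (fun=> 0%E)
    (fun=> (fine (mu Omega) * (P * M'))%:E).
  rewrite E integral0 => h2.
  suff /fine_cvg : (EFin \o (fun n => dot (A n) (A n))) n @[n --> \oo] --> (0%:E : \bar R) by [].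
  apply: h2 => //.
  - move=> n; apply/measurable_EFinP; exact: measurable_funM.
  - move=> x _; apply: cvg_EFin; first exact: nearW.
    by apply: (cvg_to_eq (mulr0 0)); exact: cvgM.
  - exact: (rint_cst mO Ofin).
  - by move=> n x _; rewrite gee0_abs lee_fin -expr2 ?sqr_ge0.
apply/cvgr0Pnorm_lt => e e0.
pose C : R := 2 ^+ d.+1; have C0 : 0 < C by rewrite exprn_gt0.
have M1 : 0 < M' + 1 by rewrite ltr_wpDl.
(* The side h of the boxes is such that averaging costs at most e / 2. *)
pose q := e / (8 * C * (M' + 1)); have q0 : 0 < q by rewrite divr_gt0// !mulr_gt0.
pose h := Num.sqrt q; have h0 : 0 < h by rewrite sqrtr_gt0.
have hq : h ^+ 2 = q by rewrite sqr_sqrtr// ltW.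
pose m := (h ^+ d) ^+ 2; have m0 : 0 < m by rewrite !exprn_gt0.
pose av n := dot (box_average h (phi n)) (box_average h (phi n)).
pose g n := 4 / m * av n + 2 * n.+1%:R^-1.
have gl : g n @[n --> \oo] --> 0.
  have z : 4 / m * 0 + 2 * 0 = 0 by ring.
  apply: (cvg_to_eq z); apply: cvgD; apply: cvgMr; [exact: avg0|exact: cvg_harmonic].
have e2 : 0 < e / 2 by rewrite divr_gt0.
have [N _ hN] := (cvgr0Pnorm_lt _).1 gl _ e2.
exists N => // n Nn; rewrite ger0_norm; last exact: (si_ge0 hL (L2v n)).
have {}hN := le_lt_trans (ler_norm _) (hN n Nn).
have t1 := test_average_le h0 (tp n); rewrite -/m -/C hq -/(av n) in t1.
have t2 := dot_le_sub hL (L2p n) (L2v n).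
have t3 : dot (phi n - v n) (phi n - v n) <= n.+1%:R^-1.
  have L2d := siB hL (L2v n) (L2p n).
  have -> : phi n - v n = (-1) *: (v n - phi n) by rewrite scaleN1r opprB.
  by rewrite (dotZl hL (-1) L2d (siZ hL (-1) L2d)) (dotZr hL (-1) L2d L2d) !mulN1r opprK.
have t4 : m * (C * (q * gd (phi n) (phi n))) <= m * (C * (q * M')).
  by rewrite !ler_pM2l.
have t5 : 4 * (C * (q * M')) <= e / 2.
  rewrite /q (_ : 4 * _ = (e / 2) * (M' / (M' + 1))); last first.
    by field; rewrite !gt_eqF.
  by apply: ler_piMr; [exact: ltW|rewrite ler_pdivrMr// mul1r lerDl].
have t6 : dot (phi n) (phi n) <= 2 * (C * (q * M')) + 2 / m * av n.
  rewrite -(ler_pM2l m0); apply: le_trans t1 _.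
  have -> : m * (2 * (C * (q * M')) + 2 / m * av n) = 2 * (m * (C * (q * M'))) + 2 * av n.
    by field; rewrite gt_eqF.
  by rewrite lerD2r ler_pM2l.
apply: le_lt_trans t2 _; move: hN; rewrite /g.
move: (dot (phi n) (phi n)) (dot (phi n - v n) _) t3 t5 t6 => x y t3 t5 t6 hN.
have E4 : 4 / m * av n = 2 * (2 / m * av n) by ring.
rewrite E4 in hN; move: (2 / m * av n) (C * (q * M')) (n.+1%:R^-1) t3 t5 t6 hN => k l b t3 t5 t6 hN {t1 t4 E4}.
lra.
Qed.

End rellich.

(** * The Gross--Pitaevskii energy *)

Lemma semi_complete_equiv (R : realType) (X : lmodType R) (H : X -> Prop) (dot1 dot2 : X -> X -> R) (C1 C2 : R) :
  semi_inner H dot1 -> 0 < C1 -> 0 < C2 -> (forall u, H u -> dot1 u u <= C1 * dot2 u u) ->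
  (forall u, H u -> dot2 u u <= C2 * dot1 u u) -> semi_complete H dot1 -> semi_complete H dot2.
Proof.
move=> hd C10 C20 h1 h2 cpl u_ Hu cu.
have [|u Hlim lim] := cpl u_ Hu.
  move=> e e0; have [|N hN] := cu (e / C1); first exact: divr_gt0.
  exists N => m n Nm Nn; apply: le_lt_trans (h1 _ (siB hd (Hu m) (Hu n))) _.
  by rewrite mulrC -ltr_pdivlMr//; exact: hN.
exists u => // e e0; have [|N hN] := lim (e / C2); first exact: divr_gt0.
exists N => n Nn; apply: le_lt_trans (h2 _ (siB hd (Hu n) Hlim)) _.
by rewrite mulrC -ltr_pdivlMr//; exact: hN.
Qed.

Section gross_pitaevskii_space.
Context (R : realType) (d : nat) (Omega : set 'rV[R]_d).
Hypothesis hd : (1 <= d <= 3)%N.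
Hypothesis oO : open Omega.
Hypothesis bO : bounded_set Omega.
Context (V : 'rV[R]_d -> R) (Vmax : R).
Hypothesis mV : measurable_fun Omega V.
Hypothesis hV : \forall x \ae lebesgue_rV R d, Omega x -> 0 <= V x <= Vmax.
Notation mu := (lebesgue_rV R d).
Notation dot := (L2_dot Omega).
Notation gd := (gdot Omega).
Notation a0 := (a0_dot Omega V).
Notation quartic := (quartic Omega).
Notation H := (H10 Omega).
Let mO := open_measurable_rV oO.
Let Ofin := bounded_measure_lty mO bO.
Let hL := L2_semi_inner mO.
Let hg := gdot_H10 oO bO.
Let hLH := L2_dot_H10 oO bO.
Let d0 : (0 < d)%N. Proof. by case/andP: hd. Qed.

(** ** The [a0] inner product *)

(** Equal to [V] almost everywhere in [Omega], and bounded everywhere. *)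
Definition potential x := Num.min (Num.max (V x) 0) `|Vmax|.

Lemma potential_bounds x : 0 <= potential x <= `|Vmax|.
Proof. by rewrite /potential le_min normr_ge0 le_max lexx orbT/= ge_min lexx orbT. Qed.

Lemma potential_ae : ae_eq mu Omega V potential.
Proof.
apply: filterS hV => x h Ox; have /andP[V0 VM] := h Ox.
by rewrite /potential max_l// min_l// (le_trans VM) ?ler_norm.
Qed.

Lemma measurable_potential : measurable_fun Omega potential.
Proof. by apply: measurable_minr => //; exact: measurable_maxr. Qed.

Lemma potential_L2 u : L2 Omega u -> L2 Omega (fun x => potential x * u x).
Proof.
move=> hu; have [mu1 iu] := hu; split; first exact: measurable_funM measurable_potential mu1.
apply: (rint_le mO _ (rintZ mO (`|Vmax| ^+ 2) iu)).
  by apply: measurable_funX; exact: measurable_funM measurable_potential mu1.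
move=> x _; have /andP[p0 pM] := potential_bounds x.
rewrite ger0_norm ?sqr_ge0// exprMn; apply: ler_wpM2r; [exact: sqr_ge0|exact: le_exp].
Qed.

Definition vdot z w := dot (fun x => potential x * z x) w.

Lemma vdot_le u : L2 Omega u -> 0 <= vdot u u <= `|Vmax| * dot u u.
Proof.
move=> hu; apply/andP; split.
  apply: Rintegral_ge0 => x _; have /andP[p0 pM] := potential_bounds x.
  by rewrite -mulrA mulr_ge0// -expr2 sqr_ge0.
have i1 := L2_rintM mO (potential_L2 hu) hu; have i2 := rintZ mO `|Vmax| (L2_rintM mO hu hu).
have -> : `|Vmax| * dot u u = \int[mu]_(x in Omega) (`|Vmax| * (u x * u x)).
  by rewrite RintegralZl//; exact: L2_rintM.
apply: (le_Rintegral mO i1 i2) => x _; have /andP[p0 pM] := potential_bounds x.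
by rewrite -mulrA; apply: ler_wpM2r => //; rewrite -expr2 sqr_ge0.
Qed.

Lemma a0E z w : H z -> H w -> a0 z w = gd z w + vdot z w.
Proof.
move=> Hz Hw; have hz := H10_L2 Hz; have hw := H10_L2 Hw.
have [mz _] := hz; have [mw _] := hw.
have i1 := grad_dot_rint oO (H10_H1 Hz) (H10_H1 Hw).
have i2 := L2_rintM mO (potential_L2 hz) hw.
rewrite -(Rintegral_grad_dot oO (H10_H1 Hz) (H10_H1 Hw)) /vdot /L2_dot -RintegralD//.
have m1 := rint_measurable i1.
have m2 (W : 'rV[R]_d -> R) : measurable_fun Omega W ->
    measurable_fun Omega (fun x => grad_dot Omega z w x + W x * z x * w x).
  by move=> mW; apply: measurable_funD => //; apply: measurable_funM => //; exact: measurable_funM.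
apply: (ae_eq_Rintegral mO (m2 _ mV) (m2 _ measurable_potential)).
by apply: filterS potential_ae => x h Ox; rewrite h.
Qed.

Lemma a0_semi_inner : semi_inner H a0.
Proof.
have H0 := H10_0 oO bO; have Hl := @H10_lin _ _ _ oO bO.
split => //.
- move=> a u v w Hu Hv Hw; rewrite (a0E (Hl a u v Hu Hv) Hw) (a0E Hu Hw) (a0E Hv Hw).
  have hu := potential_L2 (H10_L2 Hu); have hv := potential_L2 (H10_L2 Hv).
  rewrite (si_dotl hg a Hu Hv Hw) /vdot.
  have -> : (fun x => potential x * (a *: u + v) x) =
      a *: (fun x => potential x * u x) + (fun x => potential x * v x).
    apply/funext => x; rewrite -[LHS]/(potential x * (a * u x + v x)).
    by rewrite -[RHS]/(a * (potential x * u x) + potential x * v x); ring.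
  have e := si_dotl hL a hu hv (H10_L2 Hw).
  rewrite {}e; move: (dot _ w) (dot _ w) (gd u w) (gd v w) => A B C D.
  by rewrite mulrDr addrACA.
- move=> u v Hu Hv; rewrite (a0E Hu Hv) (a0E Hv Hu) (si_sym hg Hu Hv); congr (_ + _).
  by apply: eq_Rintegral => x _; ring.
- move=> u Hu; rewrite (a0E Hu Hu); apply: addr_ge0; first exact: (si_ge0 hg Hu).
  by case/andP: (vdot_le (H10_L2 Hu)).
Qed.
Let ha := a0_semi_inner.

Lemma gdot_le_a0 u : H u -> gd u u <= a0 u u.
Proof. by move=> Hu; rewrite (a0E Hu Hu) lerDl; case/andP: (vdot_le (H10_L2 Hu)). Qed.

Lemma a0_le u : H u -> a0 u u <= gd u u + `|Vmax| * dot u u.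
Proof. by move=> Hu; rewrite (a0E Hu Hu) lerD2l; case/andP: (vdot_le (H10_L2 Hu)). Qed.

Lemma L2_dot_le_a0 : exists2 P : R, 0 < P & forall u, H u -> dot u u <= P * a0 u u.
Proof.
have [P P0 hP] := poincare oO bO d0; exists P => // u Hu.
by apply: le_trans (hP _ Hu) _; rewrite ler_pM2l//; exact: gdot_le_a0.
Qed.

Lemma a0_le_gdot : exists2 C : R, 0 < C & forall u, H u -> a0 u u <= C * gd u u.
Proof.
have [P P0 hP] := poincare oO bO d0; exists (1 + `|Vmax| * P) => [|u Hu].
  by rewrite ltr_pwDl// mulr_ge0// ltW.
apply: le_trans (a0_le Hu) _; rewrite mulrDl mul1r lerD2l -mulrA.
by apply: ler_wpM2l => //; exact: hP.
Qed.

Lemma a0_complete : semi_complete H a0.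
Proof.
have [P P0 hP] := poincare oO bO d0; have [C C0 hC] := a0_le_gdot.
apply: (@semi_complete_equiv _ _ _ (h1dot Omega) a0 (P + 1) C _ _ C0).
- exact: (h1dot_H10 oO bO).
- by rewrite addr_gt0.
- move=> u Hu; apply: (@le_trans _ _ ((P + 1) * gd u u)); last first.
    by rewrite ler_pM2l ?addr_gt0//; exact: gdot_le_a0.
  by rewrite /h1dot mulrDl mul1r lerD2r; exact: hP.
- move=> u Hu; apply: le_trans (hC _ Hu) _; rewrite ler_pM2l//.
  exact: (gdot_le_h1dot oO (H10_H1 Hu)).
- exact: (H10_complete oO bO).
Qed.

Lemma L2_dot_eq0_a0 u : H u -> dot u u = 0 -> a0 u u = 0.
Proof.
move=> Hu u0; apply/eqP; rewrite eq_le (si_ge0 ha Hu) andbT.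
by apply: le_trans (a0_le Hu) _; rewrite u0 (L2_dot_eq0_gdot oO bO (H10_H1 Hu) u0) mulr0 addr0.
Qed.

(** ** Green's operator *)

Lemma is_green_Riesz w (C : R) : 0 <= C -> (forall a u v, H u -> H v ->
    dot (a *: u + v) w = a * dot u w + dot v w) ->
  (forall u, H u -> dot u w ^+ 2 <= C * a0 u u) -> is_green Omega V w (green Omega V w).
Proof.
move=> C0 lw bw; have [g Hg gP] := Riesz_representation ha a0_complete C0 lw bw.
by apply: (@xgetPex _ (cst 0) [set g | is_green Omega V w g]); exists g; split.
Qed.

Lemma greenP w : L2 Omega w -> is_green Omega V w (green Omega V w).
Proof.
move=> hw; have [P P0 hP] := L2_dot_le_a0.
apply: (@is_green_Riesz w (dot w w * P)).
- by apply: mulr_ge0; [exact: (si_ge0 hL)|exact: ltW].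
- by move=> a u v Hu Hv; apply: (si_dotl hL) => //; exact: H10_L2.
- move=> u Hu; apply: le_trans (semi_inner_CS hL (H10_L2 Hu) hw) _; rewrite mulrC -mulrA.
  by apply: ler_wpM2l; [exact: (si_ge0 hL)|exact: hP].
Qed.

(** ** The quartic term *)

Definition cubic u z := dot (fun x => u x * z x) (sqf u).

Lemma dot_cube u z : dot z (cube u) = cubic u z.
Proof.
apply: eq_Rintegral => x _; rewrite /cube /sqf real_normK ?num_real//; ring.
Qed.

Lemma L4_H10 u : H u -> L4 Omega u.
Proof. by move=> Hu; have [K _ hK] := ladyzhenskaya oO bO hd; case: (hK u Hu). Qed.

(** The last bound, which retains a power of the L2 norm, makes L2 convergence of a
    sequence bounded in [H10] imply convergence of the fourth powers. *)
Lemma quartic_a0 : exists2 K : R, 0 < K & [/\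
  forall u, H u -> quartic u <= K * a0 u u ^+ 2,
  forall u z, H u -> H z -> dot (fun x => u x * z x) (fun x => u x * z x) <= K * (a0 u u * a0 z z) &
  forall u, H u -> quartic u ^+ 2 <= K * a0 u u ^+ 3 * dot u u].
Proof.
have [K0 K00 hK0] := ladyzhenskaya oO bO hd; have [P P0 hP] := L2_dot_le_a0.
have q2 u : H u -> quartic u ^+ 2 <= K0 * a0 u u ^+ 3 * dot u u.
  move=> Hu; apply: le_trans (hK0 u Hu).2 _; rewrite mulrAC.
  apply: ler_wpM2r; first exact: (si_ge0 hLH).
  by rewrite ler_pM2l//; apply: le_exp; [exact: (si_ge0 hg)|exact: gdot_le_a0].
pose K1 := Num.sqrt (K0 * P); have K1E : K1 ^+ 2 = K0 * P by rewrite sqr_sqrtr// mulr_ge0// ltW.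
have K10 : 0 < K1 by rewrite sqrtr_gt0 mulr_gt0.
have q1 u : H u -> quartic u <= K1 * a0 u u ^+ 2.
  move=> Hu; have A0 := si_ge0 ha Hu; apply: le_of_sqr; first by rewrite mulr_ge0 ?exprn_ge0// ltW.
  apply: le_trans (q2 u Hu) _; rewrite exprMn K1E.
  have -> : K0 * P * (a0 u u ^+ 2) ^+ 2 = K0 * a0 u u ^+ 3 * (P * a0 u u) by ring.
  by apply: ler_wpM2l; [rewrite mulr_ge0 ?exprn_ge0// ltW|exact: hP].
exists (K1 + K0) => [|]; first by rewrite addr_gt0.
split.
- by move=> u Hu; apply: le_trans (q1 u Hu) _; apply: ler_wpM2r; [exact: sqr_ge0|rewrite lerDl ltW].
- move=> u z Hu Hz; have A0 := si_ge0 ha Hu; have B0 := si_ge0 ha Hz.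
  apply: (@le_trans _ _ (K1 * (a0 u u * a0 z z))); last first.
    by apply: ler_wpM2r; [exact: mulr_ge0|rewrite lerDl ltW].
  apply: le_of_sqr; first by rewrite !mulr_ge0// ltW.
  apply: le_trans (dot_mul_sqr_le mO (L4_H10 Hu) (L4_H10 Hz)) _.
  have -> : (K1 * (a0 u u * a0 z z)) ^+ 2 = (K1 * a0 u u ^+ 2) * (K1 * a0 z z ^+ 2) by ring.
  by apply: ler_pM; rewrite ?quartic_ge0 ?q1.
- move=> u Hu; have A0 := si_ge0 ha Hu; apply: le_trans (q2 u Hu) _.
  apply: ler_wpM2r; first exact: (si_ge0 hLH).
  by apply: ler_wpM2r; [exact: exprn_ge0|rewrite lerDr ltW].
Qed.

Lemma quarticZ (t : R) u : H u -> quartic (t *: u) = t ^+ 4 * quartic u.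
Proof.
move=> Hu; have [_ hu] := L4_H10 Hu.
have -> : quartic (t *: u) = dot (t ^+ 2 *: sqf u) (t ^+ 2 *: sqf u).
  by apply: eq_Rintegral => x _; rewrite /sqf -[(t *: u) x]/(t * u x) -[(t ^+ 2 *: _) x]/(t ^+ 2 * u x ^+ 2); ring.
by rewrite (dotZl hL _ hu (siZ hL _ hu)) (dotZr hL _ hu hu) /quartic; ring.
Qed.

Lemma cubic_sqr_le u z : H u -> H z ->
  cubic u z ^+ 2 <= dot (fun x => u x * z x) (fun x => u x * z x) * quartic u.
Proof.
move=> Hu Hz; apply: (semi_inner_CS hL); last by case: (L4_H10 Hu).
by apply: (L2_mul mO); exact: L4_H10.
Qed.

(** Expansion of the fourth power of [u - t g], the term of order three in [t] being
   absorbed by those of order two and four. *)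
Lemma quartic_taylor (t : R) u g : H u -> H g ->
  quartic (u - t *: g) <= quartic u - 4 * t * cubic u g
    + 8 * t ^+ 2 * dot (fun x => u x * g x) (fun x => u x * g x) + 3 * t ^+ 4 * quartic g.
Proof.
move=> Hu Hg; have hu4 := L4_H10 Hu; have hg4 := L4_H10 Hg.
have [_ hs] := hu4; have [_ hr] := hg4; have hp := L2_mul mO hu4 hg4.
rewrite /cubic; move: (quartic_mul_sqr Omega u g).
set p := fun x => u x * g x in hp *; move=> ppE.
have -> : quartic (u - t *: g) = dot (t ^+ 2 *: sqf g + ((- (2 * t)) *: p + sqf u))
    (t ^+ 2 *: sqf g + ((- (2 * t)) *: p + sqf u)).
  apply: eq_Rintegral => x _.
  have -> : (t ^+ 2 *: sqf g + ((- (2 * t)) *: p + sqf u)) x = sqf (u - t *: g) x => //.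
  rewrite -[LHS]/(t ^+ 2 * g x ^+ 2 + ((- (2 * t)) * (u x * g x) + u x ^+ 2)).
  by rewrite -[RHS]/((u x - t * g x) ^+ 2); ring.
have hq := siZ hL (- (2 * t)) hp; have hr' := siZ hL (t ^+ 2) hr.
have hsq := siD hL hq hs.
rewrite (dot_sqrD hL (t ^+ 2) hr hsq) (dot_sqrD hL (- (2 * t)) hp hs).
rewrite (dotDr hL hq hs hr) (dotZr hL _ hp hr) (si_sym hL hr hs) -ppE (si_sym hL hr hp).
have := si_ge0 hL (siD hL (siZ hL t hr) hp); rewrite (dot_sqrD hL t hr hp) (si_sym hL hr hp).
rewrite -/(quartic u) -/(quartic g).
move: (dot p p) (dot p (sqf g)) (quartic u) (quartic g) (dot p (sqf u)) => A B q r c h.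
have := mulr_ge0 (sqr_ge0 t) h; lra.
Qed.

(** From [v ^ 3 - u ^ 3 = (v - u) (v ^ 2 + u v + u ^ 2)]. *)
Lemma cubic_diff_sqr_le u v z : H u -> H v -> H z ->
  (cubic v z - cubic u z) ^+ 2 <= dot (fun x => (v - u) x * z x) (fun x => (v - u) x * z x) *
    (4 * quartic v + 4 * dot (fun x => u x * v x) (fun x => u x * v x) + 2 * quartic u).
Proof.
move=> Hu Hv Hz; have hu4 := L4_H10 Hu; have hv4 := L4_H10 Hv; have hz4 := L4_H10 Hz.
have hw4 := L4_H10 (siB ha Hv Hu).
have [_ hsu] := hu4; have [_ hsv] := hv4; have huv := L2_mul mO hu4 hv4.
have hwz := L2_mul mO hw4 hz4.
set p := fun x => u x * v x in huv *.
have hS := siD hL (siD hL hsv huv) hsu.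
have -> : cubic v z - cubic u z = dot (fun x => (v - u) x * z x) (sqf v + p + sqf u).
  have i1 := L2_rintM mO (L2_mul mO hv4 hz4) hsv; have i2 := L2_rintM mO (L2_mul mO hu4 hz4) hsu.
  rewrite /cubic /L2_dot -RintegralB//; apply: eq_Rintegral => x _.
  rewrite /sqf -[(v - u) x]/(v x - u x) -[(_ + _ + _) x]/(v x ^+ 2 + u x * v x + u x ^+ 2); ring.
apply: le_trans (semi_inner_CS hL hwz hS) _; apply: ler_wpM2l; first exact: (si_ge0 hL).
apply: le_trans (parallelogram_le hL (siD hL hsv huv) hsu) _.
have := parallelogram_le hL hsv huv; rewrite -/(quartic u) -/(quartic v).
by move: (dot _ _) (dot _ _) (quartic u) (quartic v) => A B q r; lra.
Qed.

End gross_pitaevskii_space.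

Lemma cvg0_subseq (R : realType) (f : nat -> R) (psi : nat -> nat) :
  {homo psi : m n / (m < n)%N} -> f n @[n --> \oo] --> 0 -> f (psi n) @[n --> \oo] --> 0.
Proof.
move=> psiH f0; have psi_ge n : (n <= psi n)%N by elim: n => // n /leq_ltn_trans; apply; exact: psiH.
apply/cvgr0Pnorm_lt => e e0; have [N _ hN] := (cvgr0Pnorm_lt _).1 f0 _ e0.
by exists N => // n /= Nn; apply: hN; exact: leq_trans (psi_ge n).
Qed.

Section gradient_flow.
Context (R : realType) (d : nat) (Omega : set 'rV[R]_d).
Hypothesis hd : (1 <= d <= 3)%N.
Hypothesis oO : open Omega.
Hypothesis bO : bounded_set Omega.
Context (V : 'rV[R]_d -> R) (Vmax : R).
Hypothesis mV : measurable_fun Omega V.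
Hypothesis hV : \forall x \ae lebesgue_rV R d, Omega x -> 0 <= V x <= Vmax.
Context (beta : R).
Hypothesis beta0 : 0 <= beta.
Notation mu := (lebesgue_rV R d).
Notation dot := (L2_dot Omega).
Notation gd := (gdot Omega).
Notation a0 := (a0_dot Omega V).
Notation quartic := (quartic Omega).
Notation cubic := (cubic Omega).
Notation H := (H10 Omega).
Notation G := (green Omega V).
Notation C := (fun u => green Omega V (cube u)).
Let mO := open_measurable_rV oO.
Let Ofin := bounded_measure_lty mO bO.
Let hL := L2_semi_inner mO.
Let hg := gdot_H10 oO bO.
Let hLH := L2_dot_H10 oO bO.
Let ha := a0_semi_inner oO bO mV hV.
Let d0 : (0 < d)%N. Proof. by case/andP: hd. Qed.
Let L4H u : H u -> L4 Omega u. Proof. exact: L4_H10 hd oO bO u. Qed.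

Lemma quartic_bounds : exists2 K : R, 0 < K & [/\
  forall u, H u -> quartic u <= K * a0 u u ^+ 2,
  forall u z, H u -> H z -> cubic u z ^+ 2 <= K * a0 u u ^+ 3 * a0 z z &
  forall (t : R) u g, H u -> H g -> 0 <= t <= 1 -> quartic (u - t *: g) <=
    quartic u - 4 * t * cubic u g + t ^+ 2 * (K * (a0 u u + a0 g g) * a0 g g)].
Proof.
have [K K0 [q1 q2 _]] := quartic_a0 hd oO bO mV hV.
(* 8 K serves the expansion of the fourth power, K ^ 2 the bound on the cubic form. *)
exists (8 * K + K ^+ 2); first by rewrite addr_gt0 ?mulr_gt0// exprn_gt0.
have K1 : K <= 8 * K + K ^+ 2 by have := sqr_ge0 K; lra.
have K2 : K ^+ 2 <= 8 * K + K ^+ 2 by lra.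
have K8 : 8 * K <= 8 * K + K ^+ 2 by have := sqr_ge0 K; lra.
split.
- by move=> u Hu; apply: le_trans (q1 u Hu) _; apply: ler_wpM2r => //; exact: sqr_ge0.
- move=> u z Hu Hz; have A0 := si_ge0 ha Hu; have B0 := si_ge0 ha Hz.
  apply: le_trans (cubic_sqr_le hd oO bO Hu Hz) _.
  apply: (@le_trans _ _ (K * (a0 u u * a0 z z) * (K * a0 u u ^+ 2))).
    apply: ler_pM; [exact: (si_ge0 hL (L2_mul mO (L4H Hu) (L4H Hz)))|exact: quartic_ge0|exact: q2|exact: q1].
  have -> : K * (a0 u u * a0 z z) * (K * a0 u u ^+ 2) = K ^+ 2 * (a0 u u ^+ 3 * a0 z z) by ring.
  by rewrite -mulrA; apply: ler_wpM2r => //; rewrite mulr_ge0// exprn_ge0.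
- move=> t u g Hu Hg /andP[t0 t1]; have A0 := si_ge0 ha Hu; have B0 := si_ge0 ha Hg.
  apply: le_trans (quartic_taylor hd oO bO t Hu Hg) _; rewrite -addrA; apply: lerD => //.
  have t4 : t ^+ 4 <= t ^+ 2.
    by rewrite (_ : t ^+ 4 = t ^+ 2 * t ^+ 2)%R; [apply: ler_piMr; [exact: sqr_ge0|exact: exprn_ile1]|ring].
  have h1 := q2 u g Hu Hg; have h2 := q1 g Hg; have q0 := quartic_ge0 Omega g.
  have h3 : 8 * t ^+ 2 * dot (fun x => u x * g x) (fun x => u x * g x) <= t ^+ 2 * (8 * K * (a0 u u * a0 g g)).
    by have := ler_wpM2l (sqr_ge0 t) h1; lra.
  have h4 : 3 * t ^+ 4 * quartic g <= t ^+ 2 * (8 * K * a0 g g ^+ 2).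
    apply: (@le_trans _ _ (3 * t ^+ 2 * (K * a0 g g ^+ 2))).
      by apply: ler_pM => //; [rewrite mulr_ge0// exprn_ge0|rewrite ler_pM2l].
    have -> : t ^+ 2 * (8 * K * a0 g g ^+ 2) = 8 * t ^+ 2 * (K * a0 g g ^+ 2) by ring.
    apply: ler_wpM2r; first by rewrite mulr_ge0 ?sqr_ge0// ltW.
    by apply: ler_wpM2r; [exact: sqr_ge0|rewrite ler_nat].
  apply: le_trans (lerD h3 h4) _; rewrite -mulrDr; apply: ler_wpM2l; first exact: sqr_ge0.
  have -> : 8 * K * (a0 u u * a0 g g) + 8 * K * a0 g g ^+ 2 = 8 * K * (a0 u u + a0 g g) * a0 g g by ring.
  by apply: ler_wpM2r => //; apply: ler_wpM2r => //; exact: addr_ge0.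
Qed.

(** The fourth power of [v_ n - u] has an integral that tends to zero, by the last bound of
    [quartic_a0]. *)
Lemma cubic_continuous (v_ : nat -> 'rV[R]_d -> R) u (M : R) : (forall n, H (v_ n)) -> H u ->
  (forall n, a0 (v_ n) (v_ n) <= M) -> sconv dot v_ u ->
  exists2 e_ : nat -> R, e_ @ \oo --> 0 &
    forall n z, H z -> (cubic (v_ n) z - cubic u z) ^+ 2 <= e_ n * a0 z z.
Proof.
move=> Hv Hu vM vu; have [K K0 [q1 q2 q3]] := quartic_a0 hd oO bO mV hV.
have A0 := si_ge0 ha Hu; have M0 : 0 <= M by apply: le_trans (vM 0%N); exact: (si_ge0 ha (Hv 0%N)).
have Hw n : H (v_ n - u) := siB ha (Hv n) Hu.
pose D := 2 * M + 2 * a0 u u; have D0 : 0 <= D by rewrite addr_ge0// mulr_ge0.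
have wD n : a0 (v_ n - u) (v_ n - u) <= D.
  have := parallelogram_le ha (Hv n) (siN ha Hu); rewrite -scaleN1r.
  rewrite (dotZl ha (-1) Hu (siZ ha (-1) Hu)) (dotZr ha (-1) Hu Hu) !mulN1r opprK scaleN1r.
  by move=> /le_trans; apply; rewrite lerD2r ler_pM2l.
pose S := 4 * (K * M ^+ 2) + 4 * (K * (a0 u u * M)) + 2 * (K * a0 u u ^+ 2).
pose q n := quartic (v_ n - u); pose s n := Num.sqrt (q n * K).
have q0 n : 0 <= q n by exact: quartic_ge0.
have sE n : s n ^+ 2 = q n * K by rewrite sqr_sqrtr// mulr_ge0// ltW.
have qc : q n @[n --> \oo] --> 0.
  apply: (@cvg0_of_sqr_le _ _ (fun n => K * D ^+ 3 * dot (v_ n - u) (v_ n - u))) => [n|].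
    apply: le_trans (q3 _ (Hw n)) _; apply: ler_wpM2r; first exact: (si_ge0 hLH (Hw n)).
    by rewrite ler_pM2l//; apply: le_exp; [exact: (si_ge0 ha (Hw n))|exact: wD].
  by apply: (cvg_to_eq (mulr0 (K * D ^+ 3))); apply: cvgMr.
have sc : s n @[n --> \oo] --> 0.
  apply: (@cvg0_of_sqr_le _ _ (fun n => q n * K)) => [n|]; first by rewrite sE.
  by apply: (cvg_to_eq (mul0r K)); apply: cvgMl.
exists (fun n => s n * S); first by apply: (cvg_to_eq (mul0r S)); apply: cvgMl.
move=> n z Hz; have B0 := si_ge0 ha Hz.
apply: le_trans (cubic_diff_sqr_le hd oO bO mV hV Hu (Hv n) Hz) _.
rewrite mulrAC; apply: ler_pM.
- exact: (si_ge0 hL (L2_mul mO (L4H (Hw n)) (L4H Hz))).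
- have p0 := si_ge0 hL (L2_mul mO (L4H Hu) (L4H (Hv n))).
  by rewrite !addr_ge0// mulr_ge0// quartic_ge0.
- apply: le_of_sqr; first by rewrite mulr_ge0// sqrtr_ge0.
  apply: le_trans (dot_mul_sqr_le mO (L4H (Hw n)) (L4H Hz)) _.
  by rewrite exprMn sE -mulrA -/(q n); apply: ler_wpM2l => //; exact: q1.
- have vn0 := si_ge0 ha (Hv n).
  apply: lerD; [apply: lerD|]; rewrite ler_pM2l//.
  + apply: le_trans (q1 _ (Hv n)) _; rewrite ler_pM2l//; apply: le_exp => //; exact: vM.
  + apply: le_trans (q2 _ _ Hu (Hv n)) _; rewrite ler_pM2l//; apply: ler_wpM2l => //; exact: vM.
  + exact: q1.
Qed.

(** The product of [cube u] with [z] is that of [u z] and [u ^ 2], both in L2: the functional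
    to be represented is bounded, whether or not [cube u] is square integrable. *)
Lemma green_cube u : H u -> is_green Omega V (cube u) (green Omega V (cube u)).
Proof.
move=> Hu; have [K K0 [_ c2 _]] := quartic_bounds; have A0 := si_ge0 ha Hu.
apply: (@is_green_Riesz _ _ _ hd oO bO _ _ mV hV (cube u) (K * a0 u u ^+ 3)).
- by rewrite mulr_ge0 ?exprn_ge0// ltW.
- move=> a v w Hv Hw; rewrite !dot_cube /cubic.
  have -> : (fun x => u x * (a *: v + w) x) = a *: (fun x => u x * v x) + (fun x => u x * w x).
    apply/funext => x; rewrite -[LHS]/(u x * (a * v x + w x)).
    by rewrite -[RHS]/(a * (u x * v x) + u x * w x); ring.
  apply: (si_dotl hL); [exact: (L2_mul mO (L4H Hu) (L4H Hv))|exact: (L2_mul mO (L4H Hu) (L4H Hw))|].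
  by case: (L4H Hu).
- by move=> z Hz; rewrite dot_cube; exact: c2.
Qed.

Lemma greenH u : H u -> H (G u).
Proof. by move=> Hu; case: (greenP hd oO bO mV hV (H10_L2 Hu)). Qed.

Lemma a0_green u z : H u -> H z -> a0 z (G u) = dot u z.
Proof.
move=> Hu Hz; have [_ h] := greenP hd oO bO mV hV (H10_L2 Hu).
by rewrite h// (si_sym hL (H10_L2 Hu) (H10_L2 Hz)).
Qed.

Lemma green_cubeH u : H u -> H (C u).
Proof. by move=> Hu; case: (green_cube Hu). Qed.

Lemma a0_green_cube u z : H u -> H z -> a0 z (C u) = cubic u z.
Proof. by move=> Hu Hz; have [_ h] := green_cube Hu; rewrite h// dot_cube. Qed.

(** ** The scheme *)

Lemma a0_norm_sqr u : H u -> a0_norm Omega V u ^+ 2 = a0 u u.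
Proof. by move=> Hu; rewrite /a0_norm sqr_sqrtr//; exact: (si_ge0 ha Hu). Qed.

Lemma energyE u : H u -> energy Omega V beta u = model_energy a0 quartic beta u.
Proof.
move=> Hu; have hu := H10_L2 Hu; have [_ hs] := L4H Hu; have [mu1 _] := hu.
have i1 := grad_dot_rint oO (H10_H1 Hu) (H10_H1 Hu).
have i2 := L2_rintM mO (potential_L2 oO Vmax mV hu) hu.
have i3 := L2_rintM mO hs hs.
have m1 := rint_measurable i1.
have m2 (W : 'rV[R]_d -> R) : measurable_fun Omega W -> measurable_fun Omega (fun x =>
    2^-1 * grad_dot Omega u u x + 2^-1 * W x * `|u x| ^+ 2 + beta / 4 * `|u x| ^+ 4).
  move=> mW; have mu2 : measurable_fun Omega (fun x => `|u x|) by exact: measurableT_comp.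
  apply: measurable_funD; last by apply: measurable_funM => //; exact: measurable_funX.
  apply: measurable_funD; first exact: measurable_funM.
  by apply: measurable_funM; [exact: measurable_funM|exact: measurable_funX].
rewrite /energy (ae_eq_Rintegral mO (m2 _ mV) (m2 _ (measurable_potential Vmax mV))); last first.
  by apply: filterS (potential_ae hV) => x h Ox; rewrite h.
rewrite /model_energy (a0E oO mV hV Hu Hu) -(Rintegral_grad_dot oO (H10_H1 Hu) (H10_H1 Hu)) /vdot /quartic /L2_dot.
rewrite mulrDr -!RintegralZl// -RintegralD//; [|exact: (rintZ mO _ i1)|exact: (rintZ mO _ i2)].
rewrite -RintegralD//; [|exact: (rintD mO (rintZ mO _ i1) (rintZ mO _ i2))|exact: (rintZ mO _ i3)].
apply: eq_Rintegral => x _; rewrite /sqf (_ : `|u x| ^+ 4 = (`|u x| ^+ 2) ^+ 2); last by ring.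
by rewrite real_normK ?num_real//; ring.
Qed.

Lemma a0_riemannian_gradE u : H u -> a0_riemannian_grad Omega V beta u = rgrad a0 dot G C beta u.
Proof. by move=> Hu; rewrite /a0_riemannian_grad (a0_norm_sqr (greenH Hu)). Qed.

Lemma sphereP u : sphere Omega u <-> unit_sphere H dot u.
Proof.
split=> -[Hu u1]; split => //.
  by rewrite -(sqr_sqrtr (si_ge0 hLH Hu)) -/(L2_norm Omega u) u1 expr1n.
by rewrite /L2_norm u1 sqrtr1.
Qed.

Notation rgr := (rgrad a0 dot G C beta).
Notation it := (iterates a0 dot G C beta).

Lemma a0_iterateE alpha u0 n : (forall n, H (it alpha u0 n)) ->
  a0_iterate Omega V beta alpha u0 n = it alpha u0 n.
Proof.
move=> hH; elim: n => //= n ->; rewrite (a0_riemannian_gradE (hH n)).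
by apply/funext => x; rewrite /retraction /step mulrC.
Qed.

(** Of the initial point, the bounds of the abstract descent only see an upper bound on
    [a0 u0 u0], which [rho] provides. *)
Lemma scheme_bounds (rho : R) : exists A B tau : R, 0 < tau <= 1 /\
  forall u0 alpha amin, unit_sphere H dot u0 -> H10_norm Omega u0 = rho -> 0 < amin ->
    (forall n, amin <= alpha n <= tau) ->
  let u := it alpha u0 in
  [/\ forall n, unit_sphere H dot (u n), forall n, a0 (u n) (u n) <= A,
    forall n, a0 (egrad C beta (u n)) (egrad C beta (u n)) <= B,
    forall n, amin / 2 * a0 (rgr (u n)) (rgr (u n)) <=
      model_energy a0 quartic beta (u n) - model_energy a0 quartic beta (u n.+1) &
    a0 (rgr (u n)) (rgr (u n)) @[n --> \oo] --> 0].
Proof.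
have [C1 C10 hC1] := a0_le_gdot hd oO bO mV hV.
have [K /ltW K0 [q1 c2 t3]] := quartic_bounds.
have q0 u (_ : H u) := quartic_ge0 Omega u; have qZ := @quarticZ _ _ _ hd oO bO.
pose A0 := C1 * rho ^+ 2; have A00 : 0 <= A0 by rewrite mulr_ge0 ?sqr_ge0// ltW.
have sb := step_bound_le1 K0 beta0 A00.
exists (a_bound K beta A0), (egrad_bound K beta A0), (step_bound K beta A0); split => //.
move=> u0 alpha amin u0S u0rho amin0 hal u; have [Hu0 _] := u0S.
have u0A : a0 u0 u0 <= A0.
  apply: le_trans (hC1 _ Hu0) _; rewrite /A0 -u0rho (H10_normE oO (H10_H1 Hu0)) sqr_sqrtr//.
  exact: (si_ge0 hg Hu0).
have rs := run_sphere ha hLH K0 beta0 greenH a0_green green_cubeH a0_green_cube q0 qZ q1 c2 t3 u0S u0A amin0 hal.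
have ri n := run_invariant ha hLH K0 beta0 greenH a0_green green_cubeH a0_green_cube q0 qZ q1 c2 t3
  u0S u0A amin0 hal n (rs n).1 (rs n).2.
split.
- by move=> n; case: (rs n).
- by move=> n; case: (ri n).
- by move=> n; case: (ri n).
- exact: (run_decay ha hLH K0 beta0 greenH a0_green green_cubeH a0_green_cube q0 qZ q1 c2 t3 u0S u0A amin0 hal).
- exact: (run_gradient_cvg0 ha hLH K0 beta0 greenH a0_green green_cubeH a0_green_cube q0 qZ q1 c2 t3 u0S u0A amin0 hal).
Qed.

Lemma weak_limit_critical (v : nat -> 'rV[R]_d -> R) ustar (M : R) :
  (forall n, unit_sphere H dot (v n)) -> (forall n, a0 (v n) (v n) <= M) ->
  a0 (rgr (v n)) (rgr (v n)) @[n --> \oo] --> 0 -> weakly_converges Omega v ustar ->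
  critical_point Omega V beta ustar /\ strongly_converges Omega v ustar.
Proof.
move=> vS vM rc [Hs ws]; have [P P0 hP] := L2_dot_le_a0 hd oO bO mV hV.
have Hv n : H (v n) by case: (vS n).
have Hw n : H (v n - ustar) := siB ha (Hv n) Hs.
have vc : sconv dot v ustar.
  apply: (rellich oO bO (M := 2 * M + 2 * a0 ustar ustar) d0 Hw).
    move=> n; apply: le_trans (gdot_le_a0 oO mV hV (Hw n)) _.
    apply: le_trans (parallelogram_le ha (Hv n) (siN ha Hs)) _.
    rewrite -scaleN1r (dotZl ha (-1) Hs (siZ ha (-1) Hs)) (dotZr ha (-1) Hs Hs) !mulN1r opprK.
    by rewrite lerD2r ler_pM2l.
  move=> l lD; have := ws l lD; have [ll _] := lD.
  have E n : l (v n - ustar) = l (v n) - l ustar.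
    have -> : v n - ustar = ((-1) \*o ustar \+ v n).
      by apply/funext => x; rewrite /= mulN1r addrC.
    by rewrite (ll (-1) ustar (v n) Hs (Hv n)) mulN1r addrC.
  move=> lc; under eq_fun do rewrite E; apply: (cvg_to_eq (subrr (l ustar))).
  by apply: cvgB; [exact: lc|exact: cvg_cst].
have [s1 va rs0] := limit_is_critical ha hLH hP greenH a0_green green_cubeH a0_green_cube
  (L2_dot_eq0_a0 oO bO mV hV) cubic_continuous vS Hs vM rc vc.
split.
  split; first by apply/sphereP.
  rewrite (a0_riemannian_gradE Hs); have Hr := rgradH dot beta ha greenH green_cubeH Hs.
  apply: (L2_dot_eq0 mO (H10_L2 Hr)); apply/eqP; rewrite eq_le (si_ge0 hLH Hr) andbT.
  by apply: le_trans (hP _ Hr) _; rewrite rs0 mulr0.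
split => //; have E n : H10_norm Omega (v n \- ustar) = Num.sqrt (gd (v n - ustar) (v n - ustar)).
  exact: (H10_normE oO (H10_H1 (Hw n))).
under eq_fun do rewrite E.
apply: (@cvg0_of_sqr_le _ _ (fun n => a0 (v n - ustar) (v n - ustar))) => // n.
rewrite sqr_sqrtr; last exact: (si_ge0 hg (Hw n)).
exact: (gdot_le_a0 oO mV hV (Hw n)).
Qed.

End gradient_flow.

Theorem theorem3p4 (R : realType) (d : nat) (hd : (1 <= d <= 3)%N)
    (Omega : set 'rV[R]_d) (hOmega : bounded_lipschitz_domain Omega)
    (V : 'rV[R]_d -> R) (Vmax : R) (mV : measurable_fun Omega V)
    (hV : \forall x \ae lebesgue_rV R d, Omega x -> 0 <= V x <= Vmax)
    (beta : R) (hbeta : 0 <= beta) (rho : R) :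
  exists Cu Cg Calpha : R,
    [/\ 0 < Cu, 0 < Cg, 0 < Calpha <= 1 &
      forall u0 : 'rV[R]_d -> R, sphere Omega u0 -> H10_norm Omega u0 = rho ->
        energy_decay Omega V beta u0 Cu Cg Calpha /\
        forall (amin amax : R) (alpha : nat -> R),
          0 < amin -> amax <= Calpha ->
          (forall n, amin <= alpha n <= amax) ->
        let u := a0_iterate Omega V beta alpha u0 in
        forall (psi : nat -> nat) (ustar : 'rV[R]_d -> R),
          {homo psi : m n / (m < n)%N} ->
          weakly_converges Omega (u \o psi) ustar ->
        critical_point Omega V beta ustar /\
        exists phi : nat -> nat, {homo phi : m n / (m < n)%N} /\
          strongly_converges Omega (u \o phi) ustar].
Proof.
have [oO _ _ bO _] := hOmega; have ha := a0_semi_inner oO bO mV hV.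
have GH := greenH hd oO bO mV hV; have CH := green_cubeH hd oO bO mV hV.
have [A [B [tau [tau01 run]]]] := scheme_bounds hd oO bO mV hV hbeta rho.
(* The iterates of the scheme are identified with those of the abstract one only once the
   latter are known to stay on the sphere. *)
have itE alpha u0 : (forall n, unit_sphere (H10 Omega) (L2_dot Omega)
    (iterates (a0_dot Omega V) (L2_dot Omega) (green Omega V) (fun u => green Omega V (cube u)) beta alpha u0 n)) ->
  a0_iterate Omega V beta alpha u0 =
  iterates (a0_dot Omega V) (L2_dot Omega) (green Omega V) (fun u => green Omega V (cube u)) beta alpha u0.
  by move=> hS; apply/funext => n; apply: (a0_iterateE hd oO bO mV hV) => k; case: (hS k).
exists (Num.sqrt A + 1), (Num.sqrt B + 1), tau.
split => //.
move=> u0 /(sphereP oO bO) u0S u0rho; split.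
  move=> amin amax alpha amin0 _ amaxC halpha.
  have [|sS uA uB dec _] := run u0 alpha amin u0S u0rho amin0.
    by move=> n; have /andP[-> h] := halpha n; exact: le_trans h amaxC.
  rewrite (itE _ _ sS) => u n; have Hn k : H10 Omega (u k) by case: (sS k).
  rewrite (a0_riemannian_gradE hd oO bO mV hV _ (Hn n)).
  rewrite !(energyE hd oO bO mV hV _ (Hn _)); split.
  - by apply: le_trans (ler_wsqrtr (uA n)) _; rewrite lerDl.
  - exact: (ler_wsqrtr (rgrad_le_egrad beta ha (L2_dot_H10 oO bO) GH (a0_green hd oO bO mV hV) CH (sS n))).
  - by apply: le_trans (ler_wsqrtr (uB n)) _; rewrite lerDl.
  - rewrite (a0_norm_sqr oO bO mV hV (rgradH (L2_dot Omega) beta ha GH CH (Hn n))); exact: dec.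
move=> amin amax alpha amin0 amaxC halpha.
have [|sS uA _ _ r0] := run u0 alpha amin u0S u0rho amin0.
  by move=> n; have /andP[-> h] := halpha n; exact: le_trans h amaxC.
rewrite (itE _ _ sS) => u psi ustar psiH ws.
have [crit strong] := weak_limit_critical hd oO bO mV hV (fun n => sS (psi n)) (fun n => uA (psi n))
  (cvg0_subseq psiH r0) ws.
by split => //; exists psi.
Qed.
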